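(* For every $n\ge 3$, the flip graph of labeled combinatorial 4-PPTs with $n$ vertices and a fixed triangular outer face is connected with diameter $O(n^2)$: any two labeled combinatorial 4-PPTs on the same $n$ labeled vertices whose outer face consists of the same three labeled vertices in the same cyclic order can be transformed into each other by at most $Cn^2$ flips, for an absolute constant $C$.
   Context: An angle is a vertex–face incidence of a plane embedded graph. A combinatorial pseudo-triangulation is a combinatorial embedding in the plane (rotation system with designated outer face) of a connected planar simple graph, with a tag ''reflex'' or ''convex'' on each angle, such that every interior face has exactly three convex angles, all angles of the outer face are reflex, and no vertex is incident to more than one reflex angle; it is pointed if every vertex is incident to exactly one reflex angle. A combinatorial 4-PPT is a combinatorial pointed pseudo-triangulation whose interior faces all have size 3 or 4. In a labeled combinatorial 4-PPT the vertices carry distinct labels. Flip: for an interior triangular face $\triangle$, an edge $e$ of $\triangle$ not on the outer face, the other face $F$ at $e$, and the region $R$ obtained by deleting $e$, a flip replaces $e$ by an edge $e'\ne e$ inside $R$ that splits $R$ into a triangular face and a face of the same size as $F$, such that the result (tags outside $R$ unchanged) is again a combinatorial 4-PPT; in particular $e'$ may not join two vertices already adjacent. Flips preserve labels and the outer face. *)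

(* Defs.v *)
From mathcomp Require Import all_boot.
Set Implicit Arguments. Unset Strict Implicit. Unset Printing Implicit Defensive.

(* A combinatorial embedding with tags on vertex set 'I_n (labels = ordinals).
   - adj      : adjacency of the (simple) graph;
   - succ v   : cyclic rotation of the neighbours of v (identity on non-neighbours);
   - reflex u v : tag of the angle (corner) at v that follows the dart (u,v) in the
                  face traversal, i.e. the corner at v between edges vu and v(succ v u);
                  canonically [false] on non-darts. *)
Record emb (n : nat) := Emb {
  adj : rel 'I_n;
  succ : 'I_n -> 'I_n -> 'I_n;
  reflex : 'I_n -> 'I_n -> bool }.

Section Emb.
Variable n : nat.
Implicit Types (T : emb n) (d : 'I_n * 'I_n).

Definition dart T d : bool := adj T d.1 d.2.

Definition phi T d : 'I_n * 'I_n :=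
  if adj T d.1 d.2 then (d.2, succ T d.2 d.1) else d.

(* d and d' lie on the same face (angles of a face = its darts) *)
Definition same_face T d d' : bool := fconnect (phi T) d d'.
Definition face_size T d : nat := order (phi T) d.

Definition wf_rot T : Prop :=
  [/\ (forall u, ~~ adj T u u) /\ (forall u v, adj T u v = adj T v u),
      forall v u, ~~ adj T v u -> succ T v u = u,
      forall v, injective (succ T v),
      forall v u w, adj T v u -> adj T v w -> fconnect (succ T v) u w
    & forall u v, ~~ adj T u v -> reflex T u v = false].

Definition connected_g T : Prop := forall u v, connect (adj T) u v.

Definition ndarts T : nat := #|[set d | adj T d.1 d.2]|.
Definition nfaces T : nat := fcard (phi T) [pred d | adj T d.1 d.2].

(* connected graph with a rotation system of genus 0 (Euler: V - E + F = 2,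
   with E = ndarts/2), i.e. a combinatorial embedding in the plane *)
Definition plane_emb T : Prop :=
  [/\ wf_rot T, connected_g T & (2 * n + 2 * nfaces T = ndarts T + 4)%N].

Definition outer_tri T (a b c : 'I_n) : Prop :=
  [/\ adj T a b, phi T (a, b) = (b, c), phi T (b, c) = (c, a) & phi T (c, a) = (a, b)].

Definition on_outer T (a b : 'I_n) d : bool := same_face T (a, b) d.

Definition is_4ppt T (a b c : 'I_n) : Prop :=
  [/\ plane_emb T, outer_tri T a b c,
      forall d, dart T d -> on_outer T a b d -> reflex T d.1 d.2,
      forall d, dart T d -> ~~ on_outer T a b d ->
        ((face_size T d == 3) || (face_size T d == 4)) &&
        (#|[set d' | same_face T d d' & ~~ reflex T d'.1 d'.2]| == 3)
    &
      forall v, #|[set d | [&& adj T d.1 d.2, d.2 == v & reflex T d.1 d.2]]| = 1].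

Definition del T (x y : 'I_n) : emb n :=
  let skip v w u := if u == w then u
                    else if succ T v u == w then succ T v w else succ T v u in
  Emb (fun u v => adj T u v && ~~ (((u == x) && (v == y)) || ((u == y) && (v == x))))
      (fun v u => if v == x then skip v y u else if v == y then skip v x u
                  else succ T v u)
      (reflex T).

Definition same_rot T1 T2 : Prop :=
  (forall u v, adj T1 u v = adj T2 u v) /\ (forall v u, succ T1 v u = succ T2 v u).

(* A flip from T to T' (outer face (a,b,c) fixed):
   delta = face of dart (x,y), a triangle not the outer face; e = xy not on the outer
   face; F = face of (y,x); R = region obtained by deleting e (darts of delta and F
   other than those of e); e' = pq is a new edge (p, q not adjacent in T, so e' <> e)
   such that T' minus e' equals T minus e, the two faces of T' at e' consist of darts
   of R and e' only (e' lies inside R) and are a triangle and a face of the size of F;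
   tags of angles outside R are unchanged; and T' is again a 4-PPT. *)
Definition flip (a b c : 'I_n) T T' : Prop :=
  exists x y p q : 'I_n,
    let inR d := same_face T (x, y) d || same_face T (y, x) d in
    [/\ [/\ adj T x y, ~~ on_outer T a b (x, y), face_size T (x, y) = 3
          & ~~ on_outer T a b (y, x)],
        [/\ adj T' p q, ~~ adj T p q & same_rot (del T' p q) (del T x y)],
        (forall d, adj T' d.1 d.2 ->
          same_face T' (p, q) d || same_face T' (q, p) d ->
          [|| inR d, d == (p, q) | d == (q, p)]) /\
        (face_size T' (p, q) = 3 /\ face_size T' (q, p) = face_size T (y, x)) \/
        (face_size T' (q, p) = 3 /\ face_size T' (p, q) = face_size T (y, x)),
        forall d, adj T d.1 d.2 -> ~~ inR d -> reflex T' d.1 d.2 = reflex T d.1 d.2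
      & is_4ppt T a b c /\ is_4ppt T' a b c].

Inductive flip_seq (a b c : 'I_n) : emb n -> emb n -> nat -> Prop :=
  | flip_seq0 T : flip_seq a b c T T 0
  | flip_seqS T T' T'' k :
      flip a b c T T' -> flip_seq a b c T' T'' k -> flip_seq a b c T T'' k.+1.

End Emb.

(* Main.v *)
(* By Euler's formula and the count of reflex angles, a 4-PPT with triangular outer
   face has exactly one inner triangle, and each inner vertex is the reflex vertex of exactly one
   quadrilateral. Hence a 4-PPT is encoded by its inner triangle and the list of its quadrilaterals,
   and a flip recuts the pentagon formed by the triangle and a neighbouring quadrilateral.

   Flipping repeatedly turns the triangle about one of its vertices p, across all edges at p, as far
   as the reflex angle at p. A flip is blocked only if its new edge would join two adjacent
   vertices, which closes a 3-cycle. Comparing Euler characteristic with the number of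
   quadrilaterals inside (homology mod 2 supplies the inside) shows that no vertex of a 3-cycle has
   its reflex angle inside; so the next flip goes through. Walking along a path of the graph, the
   triangle reaches the outer vertex c after O(n^2) flips, and O(n) further flips about c reduce
   the degree of c to 2. Then the outer triangle and the quadrilateral (v; a, c, b) are peeled off and the
   remaining 4-PPT has outer face a, b, v. Iterating gives a nested state determined by the
   order in which the inner vertices are peeled, and a cyclic move of k + 1 consecutive labels takes
   2k + 8 flips, so insertion sort brings all 4-PPTs to the same state in O(n^2) flips. *)

Require Import Defs.
From mathcomp Require Import all_boot all_algebra zify.
From Stdlib Require Import ArithRing FunctionalExtensionality.
Set Implicit Arguments. Unset Strict Implicit. Unset Printing Implicit Defensive.

(** The obstacle is topological: whether a flip is blocked depends on what lies inside a 3-cycle.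
    The topology is reduced to counting. The format of a state with q quadrilaterals forces 3 + q
    vertices, 3 + 2q edges and 1 + q inner faces, and these numbers make every mod 2 cycle a
    boundary. A blocked flip is no dead end, because the triangle has another flip that also moves
    it on about p. That flip does not reduce the number of neighbours of p still ahead and behind,
    but it leaves a position in which the following flip cannot be blocked; this is the origin of
    the factor 2 in the reduction to nested states. Embeddings are lists of corners up to
    permutation, so that a flip is the deletion of one chord and the insertion of another, and a
    claim about the clockwise direction follows by reflection. With n labels, the walk costs at most
    n^2 flips, the nesting n(2n + 1) and the sorting n(2n + 8), in total at most 14n^2. Flips are
    reversible, so two embeddings are joined through the common sorted state, and C = 28. *)

Ltac perm_list := apply/permP => ? /=; rewrite ?count_cat /=; repeat match goal with
  | |- context [nat_of_bool ?b] => move: (nat_of_bool b) => ?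
  end; rewrite -!plusE; ring.

Ltac in_list := by rewrite !inE ?eqxx ?orbT.

Notation tri V := (V * V * V)%type.
Notation quad V := (V * V * V * V)%type.
Notation pent V := (V * V * V * V * V)%type.
Notation state V := (tri V * seq (quad V))%type.

(** * Rotation systems as lists of corners *)

Section Corners.
Variable V : finType.
Implicit Types (C R : seq (V * V * V)) (u v w : V) (P : pred V).

Definition out_dart (c : V * V * V) : V * V := (c.1.2, c.2).

(** Read as a map on darts, a corner sends [(u, v)] to [(v, w)]; the first two fields make this a
    permutation of the darts. [valid_rot] (the neighbours of [v] form one cycle) and [valid_conn]
    are stated through invariant predicates: these pass through a surgery by extending the
    predicate, where explicit paths would have to be rerouted. Planarity enters later, with the
    vertex count in [ppt]. *)
Record valid C : Prop := Valid {
  valid_uniq : uniq (map fst C);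
  valid_out : perm_eq (map out_dart C) (map fst C);
  valid_sym : forall u v, (u, v) \in map fst C -> (v, u) \in map fst C;
  valid_irr : forall u, (u, u) \notin map fst C;
  valid_rot : forall v P, (forall u w, (u, v, w) \in C -> P u = P w) ->
    forall u u', (u, v) \in map fst C -> (u', v) \in map fst C -> P u = P u';
  valid_conn : forall P, (forall u v, (u, v) \in map fst C -> P u = P v) ->
    forall u v u' v', (u, v) \in map fst C -> (u', v') \in map fst C -> P u = P u' }.

Lemma valid_perm C1 C2 : perm_eq C1 C2 -> valid C1 -> valid C2.
Proof.
move=> e12 [h1 h2 h3 h4 h5 h6].
have ef : perm_eq (map fst C1) (map fst C2) by apply: perm_map.
have mf := perm_mem ef; have mC := perm_mem e12.
split.
- by rewrite -(perm_uniq ef).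
- by rewrite -(permPl (perm_map out_dart e12)) (permPl h2).
- by move=> u v; rewrite -!mf; apply: h3.
- by move=> u; rewrite -mf.
- move=> v P hP u u'; rewrite -!mf; apply: h5 => x y; rewrite mC; apply: hP.
- move=> P hP u v u' v'; rewrite -!mf; apply: h6 => x y; rewrite mf; apply: hP.
Qed.

(* A chord p0p2 cutting off the corner p0,p1,p2 of a face with boundary m,p0,p1,p2,k. *)
Lemma valid_add_chord m p0 p1 p2 k R :
  (p0, p2) \notin map fst [:: (m, p0, p1), (p0, p1, p2), (p1, p2, k) & R] ->
  p0 != p2 -> valid [:: (m, p0, p1), (p0, p1, p2), (p1, p2, k) & R] ->
  valid [:: (m, p0, p2), (p2, p0, p1), (p0, p1, p2), (p1, p2, p0), (p0, p2, k) & R].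
Proof.
set C0 := _ :: _; set C1 := _ :: _ => nD nE vC.
have [h1 h2 h3 h4 h5 h6] := vC.
have nD' : (p2, p0) \notin map fst C0 by apply: contra nD; apply: h3.
have ef : perm_eq (map fst C1) [:: (p0, p2), (p2, p0) & map fst C0].
  by perm_list.
have mf := perm_mem ef.
have mf2 x : (x \in map fst C1) = [|| x == (p0, p2), x == (p2, p0) | x \in map fst C0] by rewrite mf.
split.
- rewrite (perm_uniq ef) [uniq _]/= in_cons negb_or xpair_eqE (negbTE nE) nD /= nD'; exact: h1.
- rewrite (permPr ef).
  have e2 : perm_eq (map out_dart C1) [:: (p0, p2), (p2, p0) & map out_dart C0] by perm_list.
  by rewrite (permPl e2) !perm_cons.
- move=> u v; rewrite !mf2.
  by case/or3P => [/eqP[-> ->]|/eqP[-> ->]|/h3 ->]; rewrite ?eqxx ?orbT.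
- move=> u; rewrite mf2 !xpair_eqE (negbTE (h4 u)) orbF; apply/negP; case/orP => /andP[/eqP-> /eqP e]; by rewrite e eqxx in nE.
- move=> v P hP.
  have hP0 u w : (u, v, w) \in C0 -> P u = P w.
    rewrite !inE !xpair_eqE -!andbA; case/or4P.
    + case/and3P => /eqP-> /eqP e /eqP->; rewrite e in hP.
      by rewrite (hP m p2) ?(hP p2 p1) // !inE !eqxx ?orbT.
    + case/and3P => /eqP-> /eqP e /eqP->; rewrite e in hP.
      by rewrite (hP p0 p2) // !inE !eqxx ?orbT.
    + case/and3P => /eqP-> /eqP e /eqP->; rewrite e in hP.
      by rewrite (hP p1 p0) ?(hP p0 k) // !inE !eqxx ?orbT.
    + by move=> i; apply: hP; rewrite !inE i !orbT.
  have /= cst := h5 v P hP0.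
  have aux u : (u, v) \in map fst C1 -> exists2 u', P u = P u' & (u', v) \in map fst C0.
    rewrite mf2 !xpair_eqE; case/or3P.
    + move=> /andP[/eqP-> /eqP e]; rewrite e in hP *; exists p1; last in_list.
      by rewrite (hP p1 p0) // !inE eqxx !orbT.
    + move=> /andP[/eqP-> /eqP e]; rewrite e in hP *; exists m; last in_list.
      by rewrite (hP m p2) // !inE eqxx.
    + by exists u.
  move=> u u' /aux[x -> hx] /aux[y -> hy]; exact: cst.
- move=> P hP.
  have cst : forall u v u' v', (u, v) \in map fst C0 -> (u', v') \in map fst C0 -> P u = P u'.
    by apply: h6 => u v i; apply: (hP u v); rewrite mf2 i !orbT.
  have hp0 : P p0 = P p1 by apply: hP; in_list.
  have hp2 : P p2 = P p0 by apply: hP; in_list.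
  have aux u v : (u, v) \in map fst C1 -> P u = P p0.
    rewrite mf2 !xpair_eqE; case/or3P => [/andP[/eqP-> _]|/andP[/eqP-> _]|i] //.
    by apply: (cst u v p0 p1) => //; in_list.
  by move=> u v u' v' /aux -> /aux ->.
Qed.

Lemma valid_del_chord m p0 p1 p2 k R :
  valid [:: (m, p0, p2), (p2, p0, p1), (p0, p1, p2), (p1, p2, p0), (p0, p2, k) & R] ->
  valid [:: (m, p0, p1), (p0, p1, p2), (p1, p2, k) & R].
Proof.
set C1 := _ :: _; set C0 := _ :: _ => vC.
have [h1 h2 h3 h4 h5 h6] := vC.
have ef : perm_eq (map fst C1) [:: (p0, p2), (p2, p0) & map fst C0].
  by perm_list.
have mf := perm_mem ef.
have mf2 x : (x \in map fst C1) = [|| x == (p0, p2), x == (p2, p0) | x \in map fst C0] by rewrite mf.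
have e2 : perm_eq (map out_dart C1) [:: (p0, p2), (p2, p0) & map out_dart C0].
  by perm_list.
have : uniq [:: (p0, p2), (p2, p0) & map fst C0] by rewrite -(perm_uniq ef).
rewrite [uniq _]/= in_cons negb_or => /and3P[/andP[nE nD] nD' u0].
have : uniq [:: (p0, p2), (p2, p0) & map out_dart C0].
  by rewrite -(perm_uniq e2) (perm_uniq h2).
rewrite [uniq _]/= in_cons negb_or => /and3P[/andP[_ nO] nO' _].
have p02 : p0 != p2 by apply: contra nE => /eqP->.
have dP a c : (a, c) \in map fst C0 -> (a, c) != (p0, p2) /\ (a, c) != (p2, p0).
  by move=> i; split; apply/eqP => e; [move: nD|move: nD']; rewrite -e i.
split.
- by [].
- have : perm_eq [:: (p0, p2), (p2, p0) & map out_dart C0] [:: (p0, p2), (p2, p0) & map fst C0].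
    by rewrite -(permPl e2) (permPl h2).
  by rewrite !perm_cons.
- move=> u v i; have := h3 u v; rewrite !mf2 i !orbT => /(_ isT).
  case/or3P => // /eqP [e1 e3]; subst; [by rewrite i in nD'|by rewrite i in nD].
- move=> u; apply: contra (h4 u); by rewrite mf2 => ->; rewrite !orbT.
- move=> v P hP.
  (* In the rotation at [p0] the vertex [p2] follows [m], and at [p2] the vertex [p0] precedes [k].
     Giving the deleted neighbour the value of that survivor turns a predicate invariant without the
     chord into one invariant with it. *)
  pose P' u := if (v == p0) && (u == p2) then P m else if (v == p2) && (u == p0) then P k else P u.
  have P'E u : (u, v) \in map fst C0 -> P' u = P u.
    move=> /dP[]; rewrite !xpair_eqE /P' !(andbC (v == _)).
    by move=> /negbTE-> /negbTE->.
  have P'E2 u : (v, u) \in map out_dart C0 -> P' u = P u.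
    move=> i; rewrite /P'.
    case: ifP => [/andP[/eqP e1 /eqP e3]|_]; first by rewrite e1 e3 in i; rewrite i in nO.
    by case: ifP => [/andP[/eqP e1 /eqP e3]|_] //; rewrite e1 e3 in i; rewrite i in nO'.
  have hP' u w : (u, v, w) \in C1 -> P' u = P' w.
    rewrite in_cons => /orP[/eqP[e1 e3 e4]|].
      subst u v w; rewrite P'E; last in_list.
      by rewrite /P' !eqxx.
    rewrite in_cons => /orP[/eqP[e1 e3 e4]|].
      subst u v w; rewrite (P'E2 p1); last in_list.
      by rewrite /P' !eqxx /=; apply: hP; in_list.
    rewrite in_cons => /orP[/eqP[e1 e3 e4]|].
      subst u v w; rewrite P'E ?P'E2; [|by rewrite !inE eqxx ?orbT ..].
      by apply: hP; in_list.
    rewrite in_cons => /orP[/eqP[e1 e3 e4]|].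
      subst u v w; rewrite P'E; last in_list.
      rewrite /P' eq_sym (negbTE p02) !eqxx /=.
      by apply: hP; in_list.
    rewrite in_cons => /orP[/eqP[e1 e3 e4]|i].
      subst u v w; rewrite (P'E2 k); last in_list.
      by rewrite /P' eq_sym (negbTE p02) !eqxx /=.
    rewrite P'E; last by apply/mapP; exists (u, v, w) => //; rewrite !inE i !orbT.
    rewrite P'E2; last by apply/mapP; exists (u, v, w) => //; rewrite !inE i !orbT.
    by apply: hP; rewrite !inE i !orbT.
  move=> u u' i i'; rewrite -(P'E u i) -(P'E u' i'); apply: (h5 v P' hP').
    by rewrite mf2 i !orbT.
  by rewrite mf2 i' !orbT.
- move=> P hP u v u' v' i i'; apply: (h6 P _ u v u' v'); [|by rewrite mf2 ?i ?i' !orbT..].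
  have hp0 : P p0 = P p1 by apply: hP; in_list.
  have hp2 : P p1 = P p2 by apply: hP; in_list.
  move=> x y; rewrite mf2; case/or3P => [/eqP[-> ->]|/eqP[-> ->]|/hP //]; by rewrite hp0 hp2.
Qed.

Lemma valid_del_pendant k a c b R : valid [:: (k, a, c), (a, c, a), (c, a, b) & R] ->
  valid ((k, a, b) :: R) /\ forall x, (c, x) \notin map fst ((k, a, b) :: R).
Proof.
set C1 := _ :: _; set C0 := _ :: _ => vC; have [h1 h2 h3 h4 h5 h6] := vC.
have ef : perm_eq (map fst C1) [:: (a, c), (c, a) & map fst C0] by perm_list.
have eo : perm_eq (map out_dart C1) [:: (a, c), (c, a) & map out_dart C0] by perm_list.
have mf x : (x \in map fst C1) = [|| x == (a, c), x == (c, a) | x \in map fst C0] by rewrite (perm_mem ef).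
have := h1; rewrite (perm_uniq ef) [uniq _]/= in_cons negb_or => /and3P[/andP[_ nac] nca u0].
have pO : perm_eq (map out_dart C0) (map fst C0) by move: h2; rewrite (permPl eo) (permPr ef) !perm_cons.
have ncc : c != a by apply: contra (h4 a) => /eqP e; rewrite mf e eqxx.
have only x : (x, c) \in map fst C1 -> x = a.
  move=> hx; apply/eqP; have /= := h5 c (pred1 a) _ a x; rewrite eqxx => <- //; last by rewrite mf eqxx.
  move=> u w.
  rewrite !in_cons => /or4P[/eqP[_ e _]|/eqP[-> ->] //|/eqP[_ e _]|hR].
  - by rewrite e eqxx in ncc.
  - by rewrite e eqxx in ncc.
  apply/eqP/eqP => e; exfalso; subst.
    by case/negP: nac; rewrite inE; apply/orP; right; exact: (map_f fst hR).
  by case/negP: nca; rewrite -(perm_mem pO) inE; apply/orP; right; exact: (map_f out_dart hR).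
have nxc x : (x, c) \notin map fst C0.
  apply/negP => h; have := only x; rewrite mf h !orbT => /(_ isT) e; by case/negP: nac; rewrite -[X in (X, _)]e; exact: h.
have ncx x : (c, x) \notin map fst C0.
  apply/negP => h; have := h3 c x; rewrite mf h !orbT => /(_ isT)/only e; by case/negP: nca; rewrite -[X in (_, X)]e; exact: h.
split=> //; split=> //.
- move=> u v h; have := h3 u v; rewrite !mf h !orbT => /(_ isT) /or3P[/eqP[_ e]|/eqP[e _]|//].
    by have := ncx v; rewrite -e h.
  by have := nxc u; rewrite -e h.
- by move=> u; apply: contra (h4 u); rewrite mf => ->; rewrite !orbT.
- move=> v P hP u u' hu hu'; pose P' x := if x == c then P b else P x.
  have P'E x y : (x, y) \in map fst C0 -> P' x = P x.
    by rewrite /P'; case: eqP => // -> h; rewrite (negbTE (ncx _)) in h.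
  have P'o x y : (x, y) \in map out_dart C0 -> P' y = P y.
    by rewrite (perm_mem pO) /P'; case: eqP => // -> h; rewrite (negbTE (nxc _)) in h.
  rewrite -(P'E _ _ hu) -(P'E _ _ hu'); apply: (h5 v); rewrite ?mf ?hu ?hu' ?orbT // => x y.
  have P'c : P' c = P b by rewrite /P' eqxx.
  rewrite !in_cons => /or4P[/eqP[-> e ->]|/eqP[-> _ ->] //|/eqP[-> e ->]|hR].
  - by rewrite P'c (P'E k a) ?mem_head // (hP k b) // e mem_head.
  - by rewrite P'c (P'o a b) // mem_head.
  have hR' : (x, v, y) \in C0 by rewrite inE hR orbT.
  by rewrite (P'E x v) ?(P'o v y) ?(hP x y) //; [exact: (map_f out_dart hR')|exact: (map_f fst hR')].
- move=> P hP u v u' v' hu hu'; pose P' x := if x == c then P a else P x.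
  have P'E x y : (x, y) \in map fst C0 -> P' x = P x.
    by rewrite /P'; case: eqP => // -> h; rewrite (negbTE (ncx _)) in h.
  have P'n x : x != c -> P' x = P x by rewrite /P' => /negbTE->.
  rewrite -(P'E _ _ hu) -(P'E _ _ hu'); apply: (h6 P' _ u v u' v'); rewrite ?mf ?hu ?hu' ?orbT // => x y.
  have e : P' c = P' a by rewrite [RHS]P'n ?[a == c]eq_sym // /P' eqxx.
  rewrite mf => /or3P[/eqP[-> ->]|/eqP[-> ->]|h] //.
  rewrite (P'E _ _ h) P'n ?(hP _ _ h) //; apply: contraTneq h => ->; exact: nxc.
Qed.

End Corners.

(** * States and steps *)

Section States.
Variable V : finType.
Implicit Types (o t : tri V) (q : quad V) (s : state V) (P : pent V) (R : seq (quad V)) (u v w : V) (d : V * V).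

(* A corner (u, v, w) is the angle at v between vu and vw of the face traversed u -> v -> w; its first two entries form its dart. *)
Definition tri_corners t : seq (tri V) :=
  let: (x, y, z) := t in [:: (x, y, z); (y, z, x); (z, x, y)].
(* The quadrilateral (r, s, o, t) has its reflex angle at r. *)
Definition quad_convex q : seq (tri V) :=
  let: (r, s, o, t) := q in [:: (r, s, o); (s, o, t); (o, t, r)].
Definition quad_reflex q : tri V := let: (r, s, o, t) := q in (t, r, s).
Definition quad_corners q := quad_reflex q :: quad_convex q.
Definition head_of q : V := q.1.1.1.
Definition swap d : V * V := (d.2, d.1).

Definition quads_corners (qs : seq (quad V)) := flatten (map quad_corners qs).
Definition corners o s := tri_corners o ++ tri_corners s.1 ++ quads_corners s.2.
Definition darts o s := map fst (corners o s).

Definition verts o (s : state V) := [:: o.1.1; o.1.2; o.2] ++ map head_of s.2.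

(** Pointedness and genus 0 are built into the format: every vertex is an outer vertex or the reflex
    vertex of exactly one quadrilateral. So q quadrilaterals mean 3 + q vertices, and with 3 + 2q
    edges and 2 + q faces Euler's formula holds. *)
Record ppt o s : Prop := Ppt {
  ppt_valid : valid (corners o s);
  ppt_uniq : uniq (verts o s);
  ppt_verts : forall u v, (u, v) \in darts o s -> u \in verts o s }.

Definition pent_corners P : seq (tri V) :=
  let: (p0, p1, p2, p3, p4) := P in
  [:: (p4, p0, p1); (p0, p1, p2); (p1, p2, p3); (p2, p3, p4); (p3, p4, p0)].

(* The four ways of cutting an ear off a pentagon with reflex corner p0: the ear tip is p1, p2, p3 or p4. *)
Definition tip_tri P (i : nat) : tri V :=
  let: (p0, p1, p2, p3, p4) := P in
  match i with 0 => (p0, p1, p2) | 1 => (p1, p2, p3) | 2 => (p2, p3, p4) | _ => (p3, p4, p0) end.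
Definition tip_quad P (i : nat) : quad V :=
  let: (p0, p1, p2, p3, p4) := P in
  match i with 0 => (p0, p2, p3, p4) | 1 => (p0, p1, p3, p4)
             | 2 => (p0, p1, p2, p4) | _ => (p0, p1, p2, p3) end.
Definition tip_edge P (i : nat) : V * V :=
  let: (p0, p1, p2, p3, p4) := P in
  match i with 0 => (p0, p2) | 1 => (p1, p3) | 2 => (p2, p4) | _ => (p3, p0) end.

Definition nonadj o s d := [&& d.1 != d.2, d \notin darts o s & swap d \notin darts o s].

(** States are compared up to rotating the triangle and permuting the quadrilaterals. [i] and [j]
    differ, since the edge of tip [i] is a dart of [s] and that of tip [j] is not. The last
    condition makes the relation visibly symmetric. *)
Definition step o s s' := exists P i j R,
  [/\ s.1 \in tri_corners (tip_tri P i) /\ perm_eq s.2 (tip_quad P i :: R),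
      s'.1 \in tri_corners (tip_tri P j) /\ perm_eq s'.2 (tip_quad P j :: R),
      nonadj o s (tip_edge P j) & nonadj o s' (tip_edge P i)].

Lemma step_sym o s s' : step o s s' -> step o s' s.
Proof. by case=> P [i] [j] [R] [h1 h2 h3 h4]; exists P, j, i, R. Qed.

Lemma tri_corners_sym t t' : t \in tri_corners t' -> t' \in tri_corners t.
Proof.
by case: t t' => [[x y] z] [[x' y'] z']; rewrite !inE; case/or3P => /eqP[-> -> ->]; rewrite eqxx ?orbT.
Qed.

Lemma tri_corners_trans t1 t2 t3 :
  t1 \in tri_corners t2 -> t2 \in tri_corners t3 -> t1 \in tri_corners t3.
Proof.
case: t1 t2 t3 => [[x y] z] [[x' y'] z'] [[x2 y2] z2]; rewrite !inE.
by case/or3P => /eqP[-> -> ->]; case/or3P => /eqP[-> -> ->]; rewrite eqxx ?orbT.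
Qed.

Lemma tri_corners_refl t : t \in tri_corners t.
Proof. by case: t => [[x y] z]; in_list. Qed.

Lemma perm_tri_corners t t' : t \in tri_corners t' -> perm_eq (tri_corners t) (tri_corners t').
Proof.
case: t t' => [[x y] z] [[x' y'] z']; rewrite !inE; case/or3P => /eqP[-> -> ->] //; perm_list.
Qed.

Lemma perm_quads_corners qs qs' :
  perm_eq qs qs' -> perm_eq (quads_corners qs) (quads_corners qs').
Proof. by move=> h; apply: perm_flatten; apply: perm_map. Qed.

Lemma corners_perm o s t qs : s.1 \in tri_corners t -> perm_eq s.2 qs ->
  perm_eq (corners o s) (tri_corners o ++ tri_corners t ++ quads_corners qs).
Proof.
move=> h1 h2; rewrite /corners perm_cat2l; apply: perm_cat; first exact: perm_tri_corners.
exact: perm_quads_corners.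
Qed.

Lemma tip_darts P i : perm_eq
  (map fst (tri_corners (tip_tri P i) ++ quad_corners (tip_quad P i)))
  [:: tip_edge P i, swap (tip_edge P i) & map fst (pent_corners P)].
Proof.
by case: P => [[[[p0 p1] p2] p3] p4]; case: i => [|[|[|i]]]; rewrite /swap /=; perm_list.
Qed.

(** All four tips are the same chord surgery, read from different corners of the pentagon. *)
Lemma valid_del_tip P i C :
  valid (tri_corners (tip_tri P i) ++ quad_corners (tip_quad P i) ++ C) ->
  valid (pent_corners P ++ C).
Proof.
case: P => [[[[p0 p1] p2] p3] p4] vC.
have H m x0 x1 x2 k (R : seq (tri V)) :
  perm_eq (tri_corners (tip_tri (p0, p1, p2, p3, p4) i) ++ quad_corners (tip_quad (p0, p1, p2, p3, p4) i) ++ C)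
    [:: (m, x0, x2), (x2, x0, x1), (x0, x1, x2), (x1, x2, x0), (x0, x2, k) & R] ->
  perm_eq [:: (m, x0, x1), (x0, x1, x2), (x1, x2, k) & R] (pent_corners (p0, p1, p2, p3, p4) ++ C) ->
  valid (pent_corners (p0, p1, p2, p3, p4) ++ C).
  by move=> h1 h2; apply: (valid_perm h2); apply: valid_del_chord; apply: valid_perm vC.
case: i vC H => [|[|[|i]]] vC H.
- by apply: (H p4 p0 p1 p2 p3 [:: (p2, p3, p4), (p3, p4, p0) & C]) => /=; perm_list.
- by apply: (H p0 p1 p2 p3 p4 [:: (p4, p0, p1), (p3, p4, p0) & C]) => /=; perm_list.
- by apply: (H p1 p2 p3 p4 p0 [:: (p4, p0, p1), (p0, p1, p2) & C]) => /=; perm_list.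
- by apply: (H p2 p3 p4 p0 p1 [:: (p0, p1, p2), (p1, p2, p3) & C]) => /=; perm_list.
Qed.

Lemma valid_add_tip P i C :
  tip_edge P i \notin map fst (pent_corners P ++ C) -> (tip_edge P i).1 != (tip_edge P i).2 ->
  valid (pent_corners P ++ C) ->
  valid (tri_corners (tip_tri P i) ++ quad_corners (tip_quad P i) ++ C).
Proof.
case: P => [[[[p0 p1] p2] p3] p4] nD nE vC.
have H m x0 x1 x2 k (R : seq (tri V)) : tip_edge (p0, p1, p2, p3, p4) i = (x0, x2) ->
  perm_eq [:: (m, x0, x2), (x2, x0, x1), (x0, x1, x2), (x1, x2, x0), (x0, x2, k) & R]
  (tri_corners (tip_tri (p0, p1, p2, p3, p4) i) ++ quad_corners (tip_quad (p0, p1, p2, p3, p4) i) ++ C)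
     ->
  perm_eq (pent_corners (p0, p1, p2, p3, p4) ++ C) [:: (m, x0, x1), (x0, x1, x2), (x1, x2, k) & R] ->
  valid (tri_corners (tip_tri (p0, p1, p2, p3, p4) i) ++ quad_corners (tip_quad (p0, p1, p2, p3, p4) i) ++ C).
  move=> he h1 h2; apply: (valid_perm h1); rewrite he in nD nE; apply: valid_add_chord => //.
    by rewrite -(perm_mem (perm_map fst h2)).
  exact: valid_perm vC.
case: i {nD nE} vC H => [|[|[|i]]] vC H.
- by apply: (H p4 p0 p1 p2 p3 [:: (p2, p3, p4), (p3, p4, p0) & C]) => //=; perm_list.
- by apply: (H p0 p1 p2 p3 p4 [:: (p4, p0, p1), (p3, p4, p0) & C]) => //=; perm_list.
- by apply: (H p1 p2 p3 p4 p0 [:: (p4, p0, p1), (p0, p1, p2) & C]) => //=; perm_list.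
- by apply: (H p2 p3 p4 p0 p1 [:: (p0, p1, p2), (p1, p2, p3) & C]) => //=; perm_list.
Qed.

Definition frame_corners o R := tri_corners o ++ quads_corners R.

Lemma corners_tip o s P i R :
  s.1 \in tri_corners (tip_tri P i) -> perm_eq s.2 (tip_quad P i :: R) ->
  perm_eq (corners o s)
    (tri_corners (tip_tri P i) ++ quad_corners (tip_quad P i) ++ frame_corners o R).
Proof.
move=> h1 h2; rewrite (permPl (corners_perm o h1 h2)) /frame_corners.
have -> : quads_corners (tip_quad P i :: R) = quad_corners (tip_quad P i) ++ quads_corners R by [].
by apply/permP => a; rewrite !count_cat -!plusE; ring.
Qed.

Lemma darts_tip o s P i R :
  s.1 \in tri_corners (tip_tri P i) -> perm_eq s.2 (tip_quad P i :: R) ->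
  perm_eq (darts o s) [:: tip_edge P i, swap (tip_edge P i) &
    map fst (pent_corners P ++ frame_corners o R)].
Proof.
move=> h1 h2; rewrite /darts (permPl (perm_map fst (corners_tip o h1 h2))).
rewrite [_ ++ _]catA [X in perm_eq X _]map_cat [X in perm_eq _ [:: _, _ & X]]map_cat -!cat_cons.
by rewrite perm_cat2r; exact: tip_darts.
Qed.

Lemma valid_step o s s' : step o s s' -> valid (corners o s) -> valid (corners o s').
Proof.
case=> P [i] [j] [R] [[h1 h2] [h3 h4] /and3P[n1 n2 _] _] vC.
have p := corners_tip o h3 h4; rewrite perm_sym in p; apply: (valid_perm p).
apply: valid_add_tip => //.
  apply: contra n2 => i2; by rewrite (perm_mem (darts_tip o h1 h2)) !in_cons i2 !orbT.
apply: (@valid_del_tip _ i); exact: valid_perm (corners_tip o h1 h2) vC.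
Qed.

(** The reflex corner of the pentagon stays reflex in every quadrilateral cut from it. Hence flips
    keep the list of reflex vertices, and pointedness with it. *)
Lemma head_tip P i : head_of (tip_quad P i) = P.1.1.1.1.
Proof. by case: P => [[[[p0 p1] p2] p3] p4]; case: i => [|[|[|i]]]. Qed.

Lemma perm_verts_step o s s' : step o s s' -> perm_eq (verts o s') (verts o s).
Proof.
case=> P [i] [j] [R] [[_ h2] [_ h4] _ _]; rewrite /verts perm_cat2l.
rewrite (permPl (perm_map head_of h4)) perm_sym (permPl (perm_map head_of h2)) /=.
by rewrite !head_tip.
Qed.

Lemma tip_edge_pent P i : exists w w',
  ((tip_edge P i).1, w) \in map fst (pent_corners P) /\
  ((tip_edge P i).2, w') \in map fst (pent_corners P).
Proof.
case: P => [[[[p0 p1] p2] p3] p4]; case: i => [|[|[|i]]] /=;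
  [exists p1, p3|exists p2, p4|exists p3, p0|exists p4, p1]; in_list.
Qed.

Lemma ppt_step o s s' : step o s s' -> ppt o s -> ppt o s'.
Proof.
move=> st [v1 u1 w1]; have pv := perm_verts_step st; split.
- exact: valid_step st v1.
- by rewrite (perm_uniq pv).
- have [P [i] [j] [R] [[h1 h2] [h3 h4] _ _]] := st.
  have aux u v : (u, v) \in map fst (pent_corners P ++ frame_corners o R) -> u \in verts o s'.
    by move=> iu; rewrite (perm_mem pv); apply: (w1 u v); rewrite (perm_mem (darts_tip o h1 h2)) !in_cons iu !orbT.
  have [w [w' [iw iw']]] := tip_edge_pent P j.
  have sub d : d \in map fst (pent_corners P) -> d \in map fst (pent_corners P ++ frame_corners o R).
    by move=> id; rewrite map_cat mem_cat id.
  move=> u v; rewrite (perm_mem (darts_tip o h3 h4)) !in_cons; case/or3P.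
  + by move=> /eqP e; move: (aux _ _ (sub _ iw)); rewrite -e.
  + by move=> /eqP[-> _]; apply: aux (sub _ iw').
  + exact: aux.
Qed.

(** A dart occurs only once in a valid state, so the removed edge is absent afterwards and the
    reverse flip is legal. The description of the new darts is used later to tell which edges
    survive. *)
Lemma tip_step o s P i j R :
  valid (corners o s) ->
  s.1 \in tri_corners (tip_tri P i) -> perm_eq s.2 (tip_quad P i :: R) ->
  nonadj o s (tip_edge P j) ->
  let s' := (tip_tri P j, tip_quad P j :: R) in
  step o s s' /\
  forall d, (d \in darts o s') =
    [|| d == tip_edge P j, d == swap (tip_edge P j) |
        [&& d \in darts o s, d != tip_edge P i & d != swap (tip_edge P i)]].
Proof.
move=> vC h1 h2 na s'.
have D1 := darts_tip o h1 h2.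
have h3 : s'.1 \in tri_corners (tip_tri P j) by exact: tri_corners_refl.
have h4 : perm_eq s'.2 (tip_quad P j :: R) by [].
have D2 := darts_tip o h3 h4.
have := valid_uniq vC; rewrite -/(darts _ _) (perm_uniq D1) [uniq _]/= in_cons negb_or.
case/and3P => /andP[nE nD] nD' _.
have [n1 n2 n3] := and3P na.
have Em : forall d, (d \in darts o s') =
    [|| d == tip_edge P j, d == swap (tip_edge P j) |
        [&& d \in darts o s, d != tip_edge P i & d != swap (tip_edge P i)]].
  move=> d; rewrite (perm_mem D1) (perm_mem D2) !in_cons; congr [|| _ , _ | _].
  case: eqP => [->|_] /=; first by rewrite (negbTE nD).
  by case: eqP => [->|_] /=; rewrite ?andbT // (negbTE nD').
split=> //; exists P, i, j, R; split=> //; apply/and3P; split.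
- by apply: contra (nE) => /eqP e; rewrite /swap [tip_edge P i]surjective_pairing /= e.
- rewrite Em eqxx andbF !orbF /=; apply/norP; split; apply/eqP => e.
    by rewrite -e (perm_mem D1) in_cons eqxx in n2.
  by rewrite -e (perm_mem D1) in_cons eqxx in n3.
- rewrite Em eqxx !andbF !orbF /=; apply/norP; split; apply/eqP => e.
    by rewrite -e (perm_mem D1) !in_cons eqxx orbT in n2.
  by rewrite -e (perm_mem D1) !in_cons eqxx orbT in n3.
Qed.

End States.

Arguments tri_corners {V} t.
Arguments quad_corners {V} q.
Arguments quad_convex {V} q.
Arguments quad_reflex {V} q.
Arguments head_of {V} q.
Notation tri_darts t := (map fst (tri_corners t)).
Notation quad_darts q := (map fst (quad_corners q)).

Lemma map_uniq_inj (T1 T2 : eqType) (f : T1 -> T2) (l : seq T1) :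
  uniq (map f l) -> {in l &, injective f}.
Proof.
elim: l => //= x l IH /andP[nx ul] y z; rewrite !inE.
case/predU1P => [->|iy] /predU1P[->|iz] e //; last exact: IH.
  by case/negP: nx; rewrite e map_f.
by case/negP: nx; rewrite -e map_f.
Qed.

(** * Consequences of validity: corners, faces, primal and dual connectivity *)

Section Facts.
Variable V : finType.
Implicit Types (o : tri V) (q : quad V) (s : state V) (u v w : V) (d : V * V).

Definition outer_darts o := map fst (tri_corners o).

Lemma mem_corners o s c : (c \in corners o s) =
  [|| c \in tri_corners o, c \in tri_corners s.1 | has (fun q => c \in quad_corners q) s.2].
Proof.
rewrite /corners !mem_cat; congr [|| _, _ | _].
apply/flattenP/hasP => [[l /mapP[q iq ->] ic]|[q iq ic]]; first by exists q.
by exists (quad_corners q) => //; apply: map_f.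
Qed.

Lemma mem_darts o s d : (d \in darts o s) =
  [|| d \in outer_darts o, d \in tri_darts s.1
    | has (fun q => d \in quad_darts q) s.2].
Proof.
apply/mapP/or3P.
- case=> c; rewrite mem_corners => /or3P[ic|ic|/hasP[q iq ic]] ->.
  + by constructor 1; apply: map_f.
  + by constructor 2; apply: map_f.
  + by constructor 3; apply/hasP; exists q => //; apply: map_f.
- case=> [/mapP[c ic ->]|/mapP[c ic ->]|/hasP[q iq /mapP[c ic ->]]]; exists c => //; rewrite mem_corners ?ic ?orbT //.
  by apply/or3P; constructor 3; apply/hasP; exists q.
Qed.

Section Ppt.
Variables (o : tri V) (s : state V).
Hypothesis hs : ppt o s.
Let vC := ppt_valid hs.

Lemma uniq_darts : uniq (darts o s). Proof. exact: valid_uniq vC. Qed.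

Lemma dart_sym u v : ((u, v) \in darts o s) = ((v, u) \in darts o s).
Proof. by apply/idP/idP; apply: valid_sym vC _ _. Qed.

Lemma dart_neq u v : (u, v) \in darts o s -> u != v.
Proof. by apply: contraTneq => ->; apply: valid_irr vC _. Qed.

Lemma corner_dart c : c \in corners o s -> c.1 \in darts o s.
Proof. exact: map_f. Qed.

Lemma corner_out c : c \in corners o s -> (c.1.2, c.2) \in darts o s.
Proof. by move=> h; rewrite /darts -(perm_mem (valid_out vC)); exact: (map_f (@out_dart V)). Qed.

Lemma corner_inj c c' : c \in corners o s -> c' \in corners o s -> c.1 = c'.1 -> c = c'.
Proof. by move=> ic ic' e; apply: (map_uniq_inj uniq_darts). Qed.

Lemma corner_out_inj c c' : c \in corners o s -> c' \in corners o s ->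
  out_dart c = out_dart c' -> c = c'.
Proof.
move=> ic ic' e; apply: (map_uniq_inj _ ic ic' e).
by rewrite (perm_uniq (valid_out vC)) uniq_darts.
Qed.

Lemma corner_succ u v w w' : (u, v, w) \in corners o s -> (u, v, w') \in corners o s -> w = w'.
Proof. by move=> h h'; have [] := corner_inj h h' erefl. Qed.

Lemma corner_pred u u' v w : (u, v, w) \in corners o s -> (u', v, w) \in corners o s -> u = u'.
Proof. by move=> h h'; have [] := corner_out_inj h h' erefl. Qed.

Lemma dart_corner u v : (u, v) \in darts o s -> exists w, (u, v, w) \in corners o s.
Proof. by case/mapP => -[[u' v'] w] ic [-> ->]; exists w. Qed.

(** Inner faces only: leaving out the outer face makes the face boundaries linearly independent. *)
Definition faces := tri_corners s.1 :: map quad_corners s.2.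

Lemma corners_faces : corners o s = tri_corners o ++ flatten faces.
Proof. by []. Qed.

Lemma face_closed f : f \in faces -> perm_eq (map (@out_dart V) f) (map fst f).
Proof.
rewrite inE => /orP[/eqP->|/mapP[q _ ->]].
  by case: s.1 => [[x y] z]; rewrite /out_dart /=; perm_list.
by case: q => [[[r x] y] z]; rewrite /out_dart /=; perm_list.
Qed.

Lemma face_sub f : f \in faces -> {subset f <= corners o s}.
Proof.
move=> hf c ic; rewrite corners_faces mem_cat; apply/orP; right.
by apply/flattenP; exists f.
Qed.

Lemma face_corner f u v w : f \in faces -> (u, v, w) \in corners o s ->
  ((u, v) \in map fst f) = ((v, w) \in map fst f).
Proof.
move=> hf hc; apply/idP/idP.
  case/mapP => c ic e; have ec := corner_inj hc (face_sub hf ic) e.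
  by rewrite -(perm_mem (face_closed hf)); apply/mapP; exists c => //; rewrite -ec.
rewrite -(perm_mem (face_closed hf)); case/mapP => c ic e.
have ec := corner_out_inj hc (face_sub hf ic) e.
by apply/mapP; exists c => //; rewrite -ec.
Qed.

Lemma uniq_faces : uniq (flatten (map (map fst) faces)).
Proof.
have := uniq_darts; rewrite /darts corners_faces map_cat cat_uniq map_flatten.
by case/and3P.
Qed.

Lemma uniq_face f : f \in faces -> uniq (map fst f).
Proof.
have := uniq_faces; elim: faces => // g l IH; rewrite [flatten _]/= cat_uniq inE.
by case/and3P => ug _ ul /predU1P[->//|]; exact: IH.
Qed.

Lemma outer_notin_face f d : f \in faces -> d \in map fst f -> d \notin outer_darts o.
Proof.
move=> hf id; have := uniq_darts; rewrite /darts corners_faces map_cat cat_uniq.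
case/and3P => _ /hasPn h _; apply: h.
case/mapP: id => c ic ->; apply: map_f; apply/flattenP; by exists f.
Qed.

Lemma face_disjoint d i j : i < size faces -> j < size faces ->
  d \in map fst (nth [::] faces i) -> d \in map fst (nth [::] faces j) -> i = j.
Proof.
move=> li lj; have := uniq_faces.
elim: faces i j li lj => // f l IH i j.
rewrite [flatten _]/= cat_uniq; case: i j => [|i] [|j] //= li lj /and3P[_ /hasPn h u].
- move=> h0 hj; have := h d; rewrite h0; move=> hh.
  suff: d \in flatten (map (map fst) l) by move/hh.
  by apply/flattenP; exists (map fst (nth [::] l j)) => //; rewrite map_f // mem_nth.
- move=> hi h0; have := h d; rewrite h0; move=> hh.
  suff: d \in flatten (map (map fst) l) by move/hh.
  by apply/flattenP; exists (map fst (nth [::] l i)) => //; rewrite map_f // mem_nth.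
- by move=> hi hj; rewrite (IH i j).
Qed.

Lemma vert_dart v : v \in verts o s -> exists u, (u, v) \in darts o s.
Proof.
have aux u w : (w, v, u) \in corners o s -> exists u, (u, v) \in darts o s.
  by move=> /corner_dart h; exists w.
rewrite /verts mem_cat; case/orP.
  case: o aux => [[a b] c] aux; rewrite !inE; case/or3P => /eqP e; subst v.
  - by apply: (aux b c); rewrite mem_corners !inE eqxx ?orbT.
  - by apply: (aux c a); rewrite mem_corners !inE eqxx ?orbT.
  - by apply: (aux a b); rewrite mem_corners !inE eqxx ?orbT.
case/mapP => q iq e; case: q iq e => [[[r x] y] z] iq /= e; subst v.
apply: (aux x z); rewrite mem_corners; apply/or3P; constructor 3.
by apply/hasP; exists (r, x, y, z); rewrite // inE eqxx.
Qed.

(* Invariance across every corner and every edge forces a constant: primal and dual connectivity. *)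
Lemma ppt_const (T : eqType) (G : V -> T) :
  (forall u v, (u, v) \in darts o s -> G u = G v) ->
  forall x y, x \in verts o s -> y \in verts o s -> G x = G y.
Proof.
move=> h x y /vert_dart[x' hx] /vert_dart[y' hy].
rewrite dart_sym in hx; rewrite dart_sym in hy.
have := valid_conn vC (P := fun v => G v == G x) _ hx hy.
rewrite eqxx => H; apply/eqP; rewrite eq_sym -H //.
by move=> u v /h ->.
Qed.

(** A rotation step is a face step followed by an edge reversal. So [G] is constant on the darts
    entering a vertex and descends to a function on vertices, to which [ppt_const] applies. *)
Lemma ppt_dual_const (T : eqType) (G : V -> V -> T) :
  (forall u v w, (u, v, w) \in corners o s -> G u v = G v w) ->
  (forall u v, (u, v) \in darts o s -> G u v = G v u) ->
  forall u v u' v', (u, v) \in darts o s -> (u', v') \in darts o s -> G u v = G u' v'.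
Proof.
move=> hc hd u v u' v' huv huv'.
have around x y y' : (y, x) \in darts o s -> (y', x) \in darts o s -> G y x = G y' x.
  move=> h1 h2; have := valid_rot vC (P := fun z => G z x == G y x) _ h1 h2.
  rewrite eqxx => H; apply/eqP; rewrite eq_sym -H // => a b h.
  by rewrite (hc _ _ _ h) hd //; exact: (corner_out h).
pose g v0 := if [pick z | (z, v0) \in darts o s] is Some z then Some (G z v0) else None.
have gE a b : (a, b) \in darts o s -> g b = Some (G a b).
  move=> h; rewrite /g; case: pickP => [z hz|/(_ a)]; last by rewrite h.
  by rewrite (around _ _ _ hz h).
have hv : v \in verts o s by apply: (ppt_verts hs (v := u)); rewrite dart_sym.
have hv' : v' \in verts o s by apply: (ppt_verts hs (v := u')); rewrite dart_sym.
have := ppt_const (G := g) _ hv hv'; rewrite (gE _ _ huv) (gE _ _ huv') => H.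
suff /H[] : forall a b, (a, b) \in darts o s -> g a = g b by [].
move=> a b hab; rewrite (gE _ _ hab) (hd _ _ hab) (gE b a) //.
by rewrite dart_sym.
Qed.

End Ppt.
End Facts.

(** * Homology modulo 2 *)

Section Homology.
Import GRing.Theory.
Local Open Scope ring_scope.
Variable V : finType.
Notation F2 := 'F_2.
Implicit Types (u v w : V) (d e : V * V) (E : {set V * V}).

Lemma F2_addxx (x : F2) : x + x = 0.
Proof. by apply: addrr_pchar2; rewrite pchar_Fp. Qed.

Lemma F2_addr_eq0 (x y : F2) : x + y = 0 -> x = y.
Proof. by move/eqP; rewrite addr_eq0 oppr_pchar2 ?pchar_Fp // => /eqP. Qed.

Lemma edge_sum E (h : V -> V -> F2) v :
  (forall u w, h u w = h w u) ->
  (forall u w, h u w != 0 -> ((u, w) \in E) || ((w, u) \in E)) ->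
  (forall u w, (u, w) \in E -> (w, u) \notin E) ->
  \sum_(e in E) h e.1 e.2 * ((e.1 == v)%:R + (e.2 == v)%:R) = \sum_u h u v.
Proof.
move=> hsym hsup hE.
have H1 (F : V -> V -> F2) : \sum_(e in E) F e.1 e.2 = \sum_x \sum_y (if (x, y) \in E then F x y else 0).
  by rewrite pair_bigA big_mkcond; apply: eq_bigr => -[x y] _.
rewrite (H1 (fun x y => h x y * ((x == v)%:R + (y == v)%:R))).
transitivity (\sum_x \sum_y (if (x, y) \in E then h x y * (x == v)%:R else 0) +
  \sum_y \sum_x (if (x, y) \in E then h x y * (y == v)%:R else 0)).
  rewrite [X in _ + X]exchange_big -big_split; apply: eq_bigr => x _.
  rewrite -big_split; apply: eq_bigr => y _ /=.
  by case: ifP => _; rewrite ?addr0 // mulrDr.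
have H2 (F : V -> V -> F2) : (forall x y, x != v -> F x y = 0) -> \sum_x \sum_y F x y = \sum_y F v y.
  move=> hF; rewrite (bigD1 v) //= [X in _ + X]big1 ?addr0 // => x nx.
  by rewrite big1 // => y _; rewrite hF.
rewrite !H2 => [|x y /negbTE nx|x y /negbTE nx]; [|by rewrite nx mulr0 if_same..].
rewrite -big_split; apply: eq_bigr => u _ /=; rewrite eqxx !mulr1 (hsym v u).
case: (boolP ((v, u) \in E)) => i1.
  by rewrite (negbTE (hE _ _ i1)) addr0.
case: (boolP ((u, v) \in E)) => i2; first by rewrite add0r.
rewrite addr0; apply/eqP; rewrite eq_sym; apply: contraNT i1 => /hsup.
by rewrite (negbTE i2).
Qed.

(** For an incidence matrix [A] the left kernel is the cycle space, and the rows of [B] are face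
    boundaries. If all cycles are boundaries, the dimension of the cycle space, which is at least e
    - v, is at most f. *)
Lemma ker_bound (e v f : nat) (A : 'M[F2]_(e, v)) (B : 'M[F2]_(f, e)) :
  (kermx A <= B)%MS -> (e <= v + f)%N.
Proof.
move=> /mxrankS; rewrite mxrank_ker => h.
have := rank_leq_col A; have := rank_leq_row B; lia.
Qed.

(** Boundaries are cycles, and with full ranks the equation e = v + f says that both spaces have the
    same dimension. *)
Lemma ker_exact (e v f : nat) (A : 'M[F2]_(e, v)) (B : 'M[F2]_(f, e)) :
  B *m A = 0 -> row_free B -> row_free A^T -> e = (v + f)%N -> (kermx A <= B)%MS.
Proof.
move=> hBA; rewrite /row_free mxrank_tr => /eqP rB /eqP rA he.
have hBk : (B <= kermx A)%MS by apply/sub_kermxP.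
have := mxrank_leqif_sup hBk; rewrite mxrank_ker rA rB => -[_].
by move=> <-; apply/eqP; lia.
Qed.

Lemma sum_mem_snd (l : seq (V * V)) v : uniq l ->
  \sum_u ((u, v) \in l)%:R = (count (fun d => d.2 == v) l)%:R :> F2.
Proof.
elim: l => [_|[x y] l IH /= /andP[nx ul]]; first by rewrite big1.
rewrite natrD -IH //.
rewrite (eq_bigr (fun u => ((u, v) == (x, y))%:R + ((u, v) \in l)%:R)); last first.
  move=> u _; rewrite inE; case: eqP => [->|_] /=; last by rewrite add0r.
  by rewrite (negbTE nx) addr0.
rewrite big_split /=; congr (_ + _).
rewrite (bigD1 x) //= big1 ?addr0 => [|u nu].
  by rewrite xpair_eqE eqxx eq_sym.
by rewrite xpair_eqE (negbTE nu).
Qed.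

Lemma sum_mem_fst (l : seq (V * V)) v : uniq l ->
  \sum_u ((v, u) \in l)%:R = (count (fun d => d.1 == v) l)%:R :> F2.
Proof.
elim: l => [_|[x y] l IH /= /andP[nx ul]]; first by rewrite big1.
rewrite natrD -IH //.
rewrite (eq_bigr (fun u => ((v, u) == (x, y))%:R + ((v, u) \in l)%:R)); last first.
  move=> u _; rewrite inE; case: eqP => [->|_] /=; last by rewrite add0r.
  by rewrite (negbTE nx) addr0.
rewrite big_split /=; congr (_ + _).
rewrite (bigD1 y) //= big1 ?addr0 => [|u nu].
  by rewrite xpair_eqE eqxx andbT eq_sym.
by rewrite xpair_eqE (negbTE nu) andbF.
Qed.

Section Ppt.
Variables (o : tri V) (s : state V).
Hypothesis hs : ppt o s.
Let D := darts o s.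

Definition edges := [set d in darts o s | (enum_rank d.1 < enum_rank d.2)%N].

Lemma edges_asym u w : (u, w) \in edges -> (w, u) \notin edges.
Proof. by rewrite !inE /= => /andP[_ h]; rewrite negb_and -leqNgt (ltnW h) orbT. Qed.

Lemma dart_edges u w : (u, w) \in darts o s -> ((u, w) \in edges) || ((w, u) \in edges).
Proof.
move=> h; rewrite !inE /= -(dart_sym hs u w) h /=.
by rewrite -neq_ltn; apply: contra (dart_neq hs h) => /eqP/val_inj/enum_rank_inj->.
Qed.

Lemma card_symmetric_darts (Z : {set V * V}) :
  (forall u w, (u, w) \in Z -> (w, u) \in Z) -> Z \subset darts o s ->
  #|Z| = (2 * #|Z :&: edges|)%N.
Proof.
move=> hsym hsub.
rewrite -(cardsID edges Z) mul2n -addnn; congr (_ + _)%N.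
have inj : injective (@swap V) by move=> [x y] [x' y'] [-> ->].
rewrite -(card_imset _ inj); apply: eq_card => -[x y]; apply/imsetP/setIP.
- case=> -[x' y']; rewrite in_setD => /andP[ne iz] [-> ->]; split; first exact: hsym.
  by have := dart_edges (subsetP hsub _ iz); rewrite (negbTE ne).
- case=> iz ie; exists (y, x) => //; rewrite in_setD edges_asym //=; exact: hsym.
Qed.

Lemma size_darts : size (darts o s) = (6 + 4 * size s.2)%N.
Proof.
rewrite /darts size_map /corners !size_cat.
have -> : size (quads_corners s.2) = (4 * size s.2)%N.
  rewrite /quads_corners; elim: s.2 => //= -[[[r x] y] z] l IH.
  by rewrite /= -[size (flatten _)]/(size (flatten [seq quad_corners i | i <- l])) IH; lia.
by case: o => [[a b] c]; case: s.1 => [[x y] z].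
Qed.

Lemma card_edges : #|edges| = (3 + 2 * size s.2)%N.
Proof.
have := @card_symmetric_darts [set d in D] _ _.
rewrite (_ : [set d in D] :&: edges = edges); last first.
  by apply/setP => d; rewrite !inE andbA andbb.
rewrite cardsE (card_uniqP (uniq_darts hs)) size_darts => H.
suff : (6 + 4 * size s.2 = 2 * #|edges|)%N by lia.
apply: H; last by apply/subsetP => d; rewrite inE.
by move=> u w; rewrite !inE (dart_sym hs).
Qed.

Let ev (i : 'I_#|edges|) : V * V := enum_val i.

Lemma edge_sum_ord (h : V -> V -> F2) v :
  (forall u w, h u w = h w u) -> (forall u w, h u w != 0 -> (u, w) \in darts o s) ->
  \sum_i h (ev i).1 (ev i).2 * (((ev i).1 == v)%:R + ((ev i).2 == v)%:R) = \sum_u h u v.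
Proof.
move=> hsym hsup; rewrite -(edge_sum (E := edges)) //; last exact: edges_asym.
  by rewrite [RHS]big_enum_val.
by move=> u w /hsup; apply: dart_edges.
Qed.

Definition in_face (i : 'I_(size (faces s))) d : F2 :=
  (d \in map fst (nth [::] (faces s) i))%:R.

Definition face_sum (t : 'rV[F2]_(size (faces s))) u v : F2 :=
  \sum_i t 0 i * in_face i (u, v).

Lemma face_sum_corner t u v w : (u, v, w) \in corners o s -> face_sum t u v = face_sum t v w.
Proof.
move=> hc; apply: eq_bigr => i _; rewrite /in_face (face_corner hs _ hc) //.
exact: mem_nth.
Qed.

Lemma face_sum_outer t u v : (u, v) \in outer_darts o -> face_sum t u v = 0.
Proof.
move=> h; rewrite /face_sum big1 // => i _; rewrite /in_face.
case: (boolP (_ \in _)) => [hi|_]; last by rewrite mulr0.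
by have := outer_notin_face hs (mem_nth [::] (ltn_ord i)) hi; rewrite h.
Qed.

Lemma face_sum_in t (i : 'I_(size (faces s))) u v : (u, v) \in map fst (nth [::] (faces s) i) -> face_sum t u v = t 0 i.
Proof.
move=> h; rewrite /face_sum (bigD1 i) //= big1 ?addr0 => [|j nj].
  by rewrite /in_face h mulr1.
rewrite /in_face; case: (boolP (_ \in _)) => [hj|_]; last by rewrite mulr0.
case/eqP: nj; apply: val_inj; exact: (face_disjoint hs _ _ hj h).
Qed.

(** One outer vertex is dropped as a root, because the columns of the full incidence matrix sum to
    zero modulo 2. *)
Let vs := behead (verts o s).

Let A : 'M[F2]_(#|edges|, size vs) :=
  \matrix_(i, j) (((ev i).1 == tnth (in_tuple vs) j)%:R + ((ev i).2 == tnth (in_tuple vs) j)%:R).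

Let B : 'M[F2]_(size (faces s), #|edges|) :=
  \matrix_(f, i) (in_face f (ev i) + in_face f (swap (ev i))).

(** A dependency is a vertex potential that agrees across every edge and vanishes at the root
    [o.1.1]; connectivity makes it zero. *)
Lemma row_free_incidence : row_free A^T.
Proof.
apply: inj_row_free => g hg.
pose G x := \sum_j g 0 j * (x == tnth (in_tuple vs) j)%:R.
have Ge e : e \in edges -> G e.1 = G e.2.
  move=> he; apply: F2_addr_eq0.
  have := congr1 (fun M : 'rV_ _ => M 0 (enum_rank_in he e)) hg; rewrite !mxE => <-.
  rewrite -big_split; apply: eq_bigr => j _; rewrite !mxE /ev enum_rankK_in //=.
  by rewrite mulrDr.
have Gd u v : (u, v) \in darts o s -> G u = G v.
  by move/dart_edges => /orP[/Ge|/Ge].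
have Gc := ppt_const hs Gd.
have /andP[na uvs] : uniq (o.1.1 :: vs) := ppt_uniq hs.
have Ga : G o.1.1 = 0.
  rewrite /G big1 // => j _; case: eqP => [e|_]; last by rewrite mulr0.
  by case/negP: na; rewrite e; exact: (mem_tnth j (in_tuple vs)).
apply/rowP => j; rewrite mxE.
have iv : tnth (in_tuple vs) j \in verts o s by rewrite inE; apply/orP; right; exact: (mem_tnth j (in_tuple vs)).
have := Gc _ _ iv (mem_head _ _); rewrite Ga => <-.
rewrite /G (bigD1 j) //= eqxx mulr1 big1 ?addr0 // => i ni.
case: eqP => [/eqP e|_]; last by rewrite mulr0.
by move: e ni; rewrite !(tnth_nth o.1.1) /= nth_uniq // ?ltn_ord // => /eqP/val_inj->; rewrite eqxx.
Qed.

Lemma face_sum_row t i : (t *m B) 0 i = face_sum t (ev i).1 (ev i).2 + face_sum t (ev i).2 (ev i).1.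
Proof.
rewrite !mxE -big_split; apply: eq_bigr => j _; rewrite !mxE /swap.
by rewrite mulrDr -surjective_pairing.
Qed.

(** Dually, a dependency is a face labelling that agrees across every edge and vanishes on the outer
    face. *)
Lemma row_free_boundary : row_free B.
Proof.
apply: inj_row_free => t ht.
have Se u v : (u, v) \in edges -> face_sum t u v = face_sum t v u.
  move=> he; apply: F2_addr_eq0.
  have := congr1 (fun M : 'rV_ _ => M 0 (enum_rank_in he (u, v))) ht.
  by rewrite face_sum_row /ev enum_rankK_in //= mxE.
have Sd u v : (u, v) \in darts o s -> face_sum t u v = face_sum t v u.
  by case/dart_edges/orP => /Se.
have Sc := ppt_dual_const hs (face_sum_corner t) Sd.
apply/rowP => i; rewrite mxE.
have hi : nth [::] (faces s) i \in faces s by apply: mem_nth.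
have : exists d, d \in map fst (nth [::] (faces s) i).
  move: hi; rewrite inE => /orP[/eqP->|/mapP[q _ ->]].
    by case: s.1 => [[x y] z]; exists (x, y); in_list.
  by case: q => [[[r x] y] z]; exists (z, r); in_list.
case=> -[u v] hd; rewrite -(face_sum_in _ hd).
have hd' : (u, v) \in darts o s.
  case/mapP: hd => c ic e; rewrite e; exact: (corner_dart (face_sub o hi ic)).
have ho : (o.1.1, o.1.2) \in outer_darts o.
  by case: o => [[a b] c]; in_list.
rewrite (Sc _ _ o.1.1 o.1.2 hd') ?face_sum_outer //.
by rewrite mem_darts ho.
Qed.

(** A face enters each vertex as often as it leaves it, so its boundary has even degree there. *)
Lemma boundary_incidence : B *m A = 0.
Proof.
apply/matrixP => f j; rewrite !mxE.
set v := tnth (in_tuple vs) j.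
have hf : nth [::] (faces s) f \in faces s by apply: mem_nth.
have fd d : d \in map fst (nth [::] (faces s) f) -> d \in darts o s.
  by case/mapP => c ic ->; exact: (corner_dart (face_sub o hf ic)).
transitivity (\sum_u (in_face f (u, v) + in_face f (v, u))).
  rewrite -(@edge_sum_ord (fun u w => in_face f (u, w) + in_face f (w, u))).
  - by apply: eq_bigr => i _; rewrite !mxE /swap -surjective_pairing.
  - by move=> u w; rewrite addrC.
  - move=> u w; rewrite /in_face; case: (boolP (_ \in _)) => [/fd//|_].
    by case: (boolP (_ \in _)) => [/fd|_]; rewrite ?addr0 ?eqxx // (dart_sym hs).
have uf := uniq_face hs hf.
rewrite big_split /= /in_face sum_mem_snd // sum_mem_fst //.
suff -> : count (fun d => d.2 == v) (map fst (nth [::] (faces s) f)) =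
  count (fun d => d.1 == v) (map fst (nth [::] (faces s) f)) by rewrite F2_addxx.
by rewrite -[RHS](permP (face_closed hf)) !count_map; apply: eq_count.
Qed.

(* Every mod 2 cycle bounds: the cycle space and the face boundaries have the same dimension by Euler's formula. *)
Lemma ppt_boundary (h : V -> V -> F2) :
  (forall u v, h u v = h v u) -> (forall u v, h u v != 0 -> (u, v) \in darts o s) ->
  (forall v, \sum_u h u v = 0) ->
  exists S : V -> V -> F2,
  [/\ forall u v w, (u, v, w) \in corners o s -> S u v = S v w,
      forall u v, (u, v) \in darts o s -> S u v + S v u = h u v &
      forall u v, (u, v) \in outer_darts o -> S u v = 0].
Proof.
move=> hsym hsup heven.
have hk : (kermx A <= B)%MS.
  apply: ker_exact boundary_incidence row_free_boundary row_free_incidence _.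
  (* The count is 3 + 2q edges against 2 + q vertices other than the root and 1 + q inner faces. *)
  by rewrite card_edges /vs /= !size_map; lia.
pose r : 'rV[F2]_#|edges| := \row_i h (ev i).1 (ev i).2.
have /submxP[t ht] : (r <= B)%MS.
  apply: submx_trans hk; apply/sub_kermxP/rowP => j; rewrite !mxE.
  rewrite -[RHS](heven (tnth (in_tuple vs) j)) -edge_sum_ord //.
  by apply: eq_bigr => i _; rewrite !mxE.
exists (face_sum t); split; [exact: face_sum_corner| |exact: face_sum_outer].
have he u v : (u, v) \in edges -> face_sum t u v + face_sum t v u = h u v.
  move=> huv; have := congr1 (fun M : 'rV_ _ => M 0 (enum_rank_in huv (u, v))) ht.
  by rewrite face_sum_row !mxE /ev enum_rankK_in.
by move=> u v /dart_edges /orP[/he//|/he]; rewrite addrC hsym.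
Qed.

End Ppt.
End Homology.

(** * Three-cycles *)

Section Cycles.
Import GRing.Theory.
Local Open Scope ring_scope.
Variable V : finType.
Notation F2 := 'F_2.
Implicit Types (u v w x y : V) (d e : V * V) (q : quad V).

Definition cycle_darts u v w : seq (V * V) := [:: (u, v); (v, u); (v, w); (w, v); (w, u); (u, w)].

Section Ppt.
Variables (o : tri V) (s : state V).
Hypothesis hs : ppt o s.

Lemma outer_vert_dart p : p \in [:: o.1.1; o.1.2; o.2] -> exists z, (z, p) \in outer_darts o.
Proof.
case: o => [[a b] c]; rewrite !inE.
by case/or3P => /eqP->; [exists c|exists a|exists b]; in_list.
Qed.

Lemma quad_corner_mem q c : q \in s.2 -> c \in quad_corners q -> c \in corners o s.
Proof. by move=> iq ic; rewrite mem_corners; apply/or3P; constructor 3; apply/hasP; exists q. Qed.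

Lemma tri_corner_mem c : c \in tri_corners s.1 -> c \in corners o s.
Proof. by move=> ic; rewrite mem_corners ic orbT. Qed.

Lemma outer_corner_mem c : c \in tri_corners o -> c \in corners o s.
Proof. by move=> ic; rewrite mem_corners ic. Qed.

Lemma quad_dart_mem q d : q \in s.2 -> d \in quad_darts q -> d \in darts o s.
Proof. by move=> iq /mapP[c ic ->]; apply: corner_dart; apply: quad_corner_mem ic. Qed.

Lemma tri_dart_mem d : d \in tri_darts s.1 -> d \in darts o s.
Proof. by case/mapP=> c ic ->; apply: corner_dart; apply: tri_corner_mem. Qed.

Lemma outer_dart_mem d : d \in outer_darts o -> d \in darts o s.
Proof. by case/mapP=> c ic ->; apply: corner_dart; apply: outer_corner_mem. Qed.

Lemma quad_dart_inj q q' d : q \in s.2 -> q' \in s.2 ->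
  d \in quad_darts q -> d \in quad_darts q' -> q = q'.
Proof.
move=> iq iq' id id'.
have aux p : p \in s.2 -> d \in quad_darts p ->
    ((index p s.2).+1 < size (faces s))%N /\ d \in map fst (nth [::] (faces s) (index p s.2).+1).
  move=> ip idp; rewrite /faces /= size_map ltnS index_mem; split=> //.
  by rewrite (nth_map p) ?index_mem // nth_index.
have [l1 m1] := aux q iq id; have [l2 m2] := aux q' iq' id'.
have [e] := face_disjoint hs l1 l2 m1 m2.
by rewrite -(nth_index q iq) e nth_index.
Qed.

Lemma tri_quad_disjoint q d : q \in s.2 -> d \in quad_darts q ->
  d \notin tri_darts s.1.
Proof.
move=> iq id; apply/negP => it.
have l2 : ((index q s.2).+1 < size (faces s))%N by rewrite /faces /= size_map ltnS index_mem.
have := @face_disjoint _ _ _ hs d 0%N (index q s.2).+1 isT l2 it.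
by rewrite /= (nth_map q) ?index_mem // nth_index // => /(_ id).
Qed.

Lemma outer_quad_disjoint q d : q \in s.2 -> d \in quad_darts q -> d \notin outer_darts o.
Proof. by move=> iq; apply: (outer_notin_face hs); rewrite inE map_f ?orbT. Qed.

Lemma outer_tri_disjoint d : d \in tri_darts s.1 -> d \notin outer_darts o.
Proof. by apply: (outer_notin_face hs); in_list. Qed.

Lemma quad_const (T : Type) (S : V -> V -> T) q x y :
  (forall u v w, (u, v, w) \in corners o s -> S u v = S v w) ->
  q \in s.2 -> (x, y) \in quad_darts q ->
  S x y = S (quad_reflex q).1.1 (quad_reflex q).1.2.
Proof.
move=> hS iq; have := quad_corner_mem iq; case: q {iq} => [[[r a] b] c] /= hc.
have h1 : S c r = S r a by apply: hS; apply: hc; in_list.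
have h2 : S r a = S a b by apply: hS; apply: hc; in_list.
have h3 : S a b = S b c by apply: hS; apply: hc; in_list.
by rewrite !inE => /or4P[] /eqP[-> ->]; congruence.
Qed.

Lemma tri_const (T : Type) (S : V -> V -> T) x y x' y' :
  (forall u v w, (u, v, w) \in corners o s -> S u v = S v w) ->
  (x, y) \in tri_darts s.1 -> (x', y') \in tri_darts s.1 ->
  S x y = S x' y'.
Proof.
move=> hS; have := tri_corner_mem; case: s.1 => [[a b] c] /= hc.
have h1 : S a b = S b c by apply: hS; apply: hc; in_list.
have h2 : S b c = S c a by apply: hS; apply: hc; in_list.
by rewrite !inE => /or3P[] /eqP[-> ->] /or3P[] /eqP[-> ->]; congruence.
Qed.

(** Modulo 2 the four equal terms of a quadrilateral cancel and the three of the triangle leave one;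
    the outer face contributes nothing. *)
Lemma sum_darts (S : V -> V -> F2) :
  (forall u v w, (u, v, w) \in corners o s -> S u v = S v w) ->
  (forall u v, (u, v) \in outer_darts o -> S u v = 0) ->
  \sum_(d in [set d in darts o s]) S d.1 d.2 = S s.1.1.1 s.1.1.2.
Proof.
move=> hS hO.
rewrite (eq_bigl (fun d => d \in darts o s)); last by move=> d; rewrite inE.
rewrite -big_uniq ?(uniq_darts hs) //.
have tc x y : (x, y) \in tri_darts s.1 -> S x y = S s.1.1.1 s.1.1.2.
  move=> h; apply: tri_const => //.
  by case: s.1 => [[a b] c]; in_list.
rewrite /darts big_map /corners !big_cat /=.
rewrite [X in X + _]big_seq big1 ?add0r; last first.
  by move=> c hc; apply: hO; rewrite -surjective_pairing; apply: map_f.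
rewrite [X in _ + X](_ : _ = 0); last first.
  rewrite /quads_corners big_flatten /= big_map big_seq big1 // => q iq.
  have hq x y : (x, y) \in quad_darts q -> S x y = S (quad_reflex q).1.1 (quad_reflex q).1.2.
    by move=> h; apply: quad_const.
  rewrite big_seq (eq_bigr (fun=> S (quad_reflex q).1.1 (quad_reflex q).1.2)); last first.
    by move=> c hc; apply: hq; rewrite -surjective_pairing; apply: map_f.
  rewrite -big_seq; case: q {hq iq} => [[[r a] b] c].
  by rewrite !big_cons big_nil addr0 addrA F2_addxx.
rewrite addr0 big_seq (eq_bigr (fun=> S s.1.1.1 s.1.1.2)); last first.
  by move=> c hc; apply: tc; rewrite -surjective_pairing; apply: map_f.
rewrite -big_seq; case: s.1 => [[a b] c].
by rewrite !big_cons big_nil addr0 addrA F2_addxx add0r.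
Qed.

Lemma sum_darts_edges (F : V -> V -> F2) :
  \sum_(d in [set d in darts o s]) F d.1 d.2 = \sum_(e in edges o s) (F e.1 e.2 + F e.2 e.1).
Proof.
have inj : injective (@swap V) by move=> [x y] [x' y'] [-> ->].
rewrite (bigID (fun d => d \in edges o s)) /= big_split /=; congr (_ + _).
  by apply: eq_bigl => d; rewrite !inE; case: (d \in _).
rewrite (reindex_inj inj) /=; apply: eq_bigl => -[x y]; rewrite inE /swap /=.
rewrite -(dart_sym hs x y); apply/andP/idP => [[h1 h2]|h].
  by have := dart_edges hs h1; rewrite (negbTE h2) orbF.
by rewrite (edges_asym h); move: h; rewrite inE => /andP[].
Qed.

Lemma cycle_darts_uniq u v w : (u, v) \in darts o s -> (v, w) \in darts o s -> (w, u) \in darts o s ->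
  uniq (cycle_darts u v w).
Proof.
move=> /(dart_neq hs) h1 /(dart_neq hs) h2 /(dart_neq hs) h3.
rewrite /= !inE !xpair_eqE !negb_or; move: h1 h2 h3; do !case: eqP => //=; congruence.
Qed.

Lemma cycle_darts_sub u v w : (u, v) \in darts o s -> (v, w) \in darts o s ->
  (w, u) \in darts o s -> {subset cycle_darts u v w <= darts o s}.
Proof.
by move=> h1 h2 h3 d; rewrite !inE; do 5?[case/orP]; move/eqP->; rewrite // (dart_sym hs).
Qed.

(* A 3-cycle has an inner side S (a set of faces); as the number of triangles in S is odd, it contains the inner triangle. *)
Lemma cycle_inside u v w :
  (u, v) \in darts o s -> (v, w) \in darts o s -> (w, u) \in darts o s ->
  exists S : V -> V -> bool,
  [/\ forall x y z, (x, y, z) \in corners o s -> S x y = S y z,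
      forall x y, (x, y) \in darts o s -> S y x = S x y (+) ((x, y) \in cycle_darts u v w),
      forall x y, (x, y) \in outer_darts o -> S x y = false &
      forall x y, (x, y) \in tri_darts s.1 -> S x y].
Proof.
move=> huv hvw hwu; have un := cycle_darts_uniq huv hvw hwu.
have sub := cycle_darts_sub huv hvw hwu.
pose h x y : F2 := ((x, y) \in cycle_darts u v w)%:R.
have csym x y : ((x, y) \in cycle_darts u v w) = ((y, x) \in cycle_darts u v w).
  by rewrite !inE !xpair_eqE; do !case: eqP.
have [] := @ppt_boundary _ _ _ hs h.
- by move=> x y; rewrite /h csym.
- by move=> x y; rewrite /h; case: (boolP (_ \in _)) => [/sub//|]; rewrite eqxx.
- move=> y; rewrite /h sum_mem_snd //= addn0.
  set a := nat_of_bool _; set b := nat_of_bool _; set c := nat_of_bool _.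
  rewrite (_ : (_ + _)%N = ((a + b + c) + (a + b + c))%N); last lia.
  by rewrite natrD F2_addxx.
move=> S [hS hB hO].
have F2c (x : F2) : x = 0 \/ x = 1.
  by case: x => [[|[|]]] // i; [left|right]; apply: val_inj.
(* Summed over all darts, [S] gives its value on the inner triangle; grouped by edges, the same sum
   counts the three edges of the cycle. *)
have tri1 : S s.1.1.1 s.1.1.2 = 1.
  rewrite -sum_darts // sum_darts_edges.
  rewrite (eq_bigr (fun e => h e.1 e.2)); last by move=> [x y]; rewrite inE => /andP[/hB].
  pose Z := [set d in cycle_darts u v w].
  have := @card_symmetric_darts _ _ _ hs Z.
  rewrite {1}/Z cardsE (card_uniqP un) => H.
  have {}H : #|Z :&: edges o s| = 3%N.
    suff : (6 = 2 * #|Z :&: edges o s|)%N by lia.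
    apply: H; first by move=> x y; rewrite [(x, y) \in Z]inE [(y, x) \in Z]inE csym.
    by apply/subsetP => d; rewrite inE => /sub.
  have : \sum_(e in Z :&: edges o s) (1 : F2) = 1.
    rewrite sumr_const H; exact: val_inj.
  move=> <-; rewrite [RHS]big_mkcond [LHS]big_mkcond; apply: eq_bigr => -[x y] _.
  rewrite in_setI /h; case: (_ \in edges o s); rewrite ?andbF // andbT in_set.
  by case: (_ \in cycle_darts u v w).
exists (fun x y => S x y == 1); split.
- by move=> x y z /hS ->.
- move=> x y /hB; rewrite /h.
  by case: (F2c (S x y)) => ->; case: (F2c (S y x)) => ->; case: (_ \in _).
- by move=> x y /hO ->.
- move=> x y hxy; rewrite (@tri_const _ S x y s.1.1.1 s.1.1.2) ?tri1 //.
  by case: s.1 => [[a b] c]; in_list.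
Qed.

End Ppt.
End Cycles.

(** * Counting vertices, edges and quadrilaterals inside a 3-cycle *)

Section Reflex.
Import GRing.Theory.
Local Open Scope ring_scope.
Variable V : finType.
Notation F2 := 'F_2.
Implicit Types (u v w x y : V) (d e : V * V) (q : quad V).

Variables (o : tri V) (s : state V) (u v w : V) (S : V -> V -> bool).
Hypothesis hs : ppt o s.
Hypothesis huv : (u, v) \in darts o s.
Hypothesis hvw : (v, w) \in darts o s.
Hypothesis hwu : (w, u) \in darts o s.
Hypothesis hS : forall x y z, (x, y, z) \in corners o s -> S x y = S y z.
Hypothesis hB : forall x y, (x, y) \in darts o s -> S y x = S x y (+) ((x, y) \in cycle_darts u v w).
Hypothesis hO : forall x y, (x, y) \in outer_darts o -> S x y = false.
Hypothesis hT : forall x y, (x, y) \in tri_darts s.1 -> S x y.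

(** Only edges of the cycle separate the two sides, and none of them ends at [x]. *)
Lemma side_around x y y' : x \notin [:: u; v; w] ->
  (y, x) \in darts o s -> (y', x) \in darts o s -> S y x = S y' x.
Proof.
move=> nx h1 h2; apply: (valid_rot (ppt_valid hs) (P := fun z => S z x)) h1 h2 => a b h.
have hd : (b, x) \in darts o s by rewrite (dart_sym hs); exact: (corner_out hs h).
rewrite (hS h) (hB hd).
suff -> : (b, x) \in cycle_darts u v w = false by rewrite addbF.
apply: contraNF nx; rewrite !inE !xpair_eqE.
by do 5?[case/orP]; case/andP => _ ->; rewrite ?orbT.
Qed.

Lemma side_out x y : x \notin [:: u; v; w] -> (x, y) \in darts o s -> S x y = S y x.
Proof.
move=> nx h; rewrite (hB h); suff -> : (x, y) \in cycle_darts u v w = false by rewrite addbF.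
apply: contraNF nx; rewrite !inE !xpair_eqE.
by do 5?[case/orP]; case/andP => -> _; rewrite ?orbT.
Qed.

Let side_quad q := S (quad_reflex q).1.1 (quad_reflex q).1.2.
Let Qs := filter side_quad s.2.
Let Ein := [set e in edges o s | S e.1 e.2 && S e.2 e.1].
Let Vin := [set x | (x \notin [:: u; v; w]) && [exists y, ((y, x) \in darts o s) && S y x]].

(** With k quadrilaterals and the triangle inside there are 3 + 4k darts inside. At most three of
    them, one for each edge of the cycle, lack their reverse; the others pair up into inner
    edges. *)
Lemma card_inner_edges : (2 * size Qs <= #|Ein|)%N.
Proof.
pose Z := [set d in darts o s | S d.1 d.2].
have cZ : #|Z| = (3 + 4 * size Qs)%N.
  have -> : #|Z| = count (fun d => S d.1 d.2) (darts o s).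
    rewrite -size_filter -(card_uniqP _); last by rewrite filter_uniq ?(uniq_darts hs).
    by apply: eq_card => d; rewrite inE mem_filter andbC.
  rewrite /darts corners_faces map_cat count_cat /faces /= map_cat count_cat.
  rewrite (@eq_in_count _ _ pred0) ?count_pred0; last first.
    by move=> [x y] /hO.
  rewrite (@eq_in_count _ _ predT (tri_darts s.1)) ?count_predT; last first.
    by move=> [x y] /hT.
  have -> : size (tri_darts s.1) = 3%N by case: s.1 => [[a b] c].
  rewrite add0n; congr (3 + _)%N; rewrite /Qs.
  have : {subset s.2 <= s.2} by [].
  elim: {-2}s.2 => [_|q l IH sub] //.
  rewrite (_ : flatten _ = quad_corners q ++ flatten [seq quad_corners i | i <- l]) //.
  rewrite map_cat count_cat IH; last first.
    by move=> z iz; apply: sub; rewrite inE iz orbT.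
  rewrite (@eq_in_count _ _ (fun=> side_quad q)); last first.
    by move=> [x y] ixy /=; rewrite (quad_const hS _ ixy) //; apply: sub; rewrite mem_head.
  by rewrite [filter _ (q :: l)]/=; case: q {sub} => [[[r a] b] c]; case: (side_quad _) => /=; lia.
pose Z1 := [set d in Z | S d.2 d.1].
have c1 : #|Z1| = (2 * #|Ein|)%N.
  rewrite (@card_symmetric_darts _ _ _ hs Z1).
  - congr (2 * _)%N; apply: eq_card => -[x y].
    rewrite in_setI /Z1 /Z /Ein !in_set /= -!andbA.
    by case: (_ \in darts o s); case: (S x y); case: (S y x); rewrite ?andbF ?andbT.
  - by move=> x y; rewrite !inE /= -andbA -(dart_sym hs) => /and3P[-> -> ->].
  - by apply/subsetP => d; rewrite !inE -andbA => /and3P[].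
have c2 : (#|Z :\: Z1| <= 3)%N.
  pose f x y := if S x y then (x, y) else (y, x).
  apply: (leq_trans _ (card_size [:: f u v; f v w; f w u])); apply: subset_leq_card.
  apply/subsetP => -[x y]; rewrite in_setD /Z1 /Z !in_set /= => /andP[h /andP[hd hxy]].
  have nyx : ~~ S y x by move: h; rewrite hd hxy.
  have : (x, y) \in cycle_darts u v w by move: nyx; rewrite (hB hd) hxy /= negbK.
  rewrite /f !inE; do 5?[case/orP]; move/eqP => [e1 e2]; subst x y;
    by rewrite ?hxy ?(negbTE nyx) eqxx ?orbT.
have := cardsID Z1 Z; rewrite (_ : Z :&: Z1 = Z1); first by lia.
by apply/setP => d; rewrite !inE; case: (d \in _); case: (S _ _).
Qed.

(** All faces around an inner vertex are inside, so it is not an outer vertex and is the reflex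
    vertex of a quadrilateral inside. These quadrilaterals are distinct, and [q], whose reflex
    vertex is on the cycle, is not among them. *)
Lemma card_inner_verts q : q \in s.2 -> side_quad q -> head_of q \in [:: u; v; w] ->
  (#|Vin| < size Qs)%N.
Proof.
move=> iq Sq hq.
have uh : uniq (map head_of Qs).
  have := ppt_uniq hs; rewrite /verts cat_uniq => /and3P[_ _ uh].
  by apply: subseq_uniq uh; apply: map_subseq; apply: filter_subseq.
have iqs : head_of q \in map head_of Qs by apply: map_f; rewrite mem_filter Sq.
suff : (#|Vin| <= #|[set x in map head_of Qs] :\ head_of q|)%N.
  have := cardsD1 (head_of q) [set x in map head_of Qs].
  by rewrite inE iqs cardsE (card_uniqP uh) size_map; lia.
apply: subset_leq_card; apply/subsetP => x; rewrite inE => /andP[nx /existsP[y /andP[hd hyx]]].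
rewrite in_setD1; apply/andP; split.
  by apply: contraNneq nx => ->.
have iv : x \in verts o s by apply: (ppt_verts hs (v := y)); rewrite (dart_sym hs).
move: iv; rewrite inE mem_cat; case/orP.
  by case/outer_vert_dart => z hz; move: hyx; rewrite (side_around nx hd (outer_dart_mem s hz)) (hO hz).
case/mapP => p ip ep; apply/mapP; exists p => //; rewrite mem_filter ip andbT.
rewrite /side_quad.
have e2 : (quad_reflex p).1.2 = x by rewrite ep; case: p {ip ep} => [[[r a] b] c].
rewrite e2 (side_around nx _ hd) // -e2 -surjective_pairing.
by apply: (quad_dart_mem o ip); rewrite map_f // mem_head.
Qed.

Let ev (i : 'I_#|Ein|) : V * V := enum_val i.
Let A : 'M[F2]_(#|Ein|, #|Vin|) :=
  \matrix_(i, j) (((ev i).1 == enum_val j)%:R + ((ev i).2 == enum_val j)%:R).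
Let in_quad (i : 'I_(size Qs)) d : F2 := (d \in quad_darts (tnth (in_tuple Qs) i))%:R.
Let B : 'M[F2]_(size Qs, #|Ein|) :=
  \matrix_(f, i) (in_quad f (ev i) + in_quad f (swap (ev i))).

Lemma Ein_asym x y : (x, y) \in Ein -> (y, x) \notin Ein.
Proof. by rewrite inE => /andP[h _]; rewrite inE negb_and (edges_asym h). Qed.

Lemma Ein_mem x y : (x, y) \in Ein -> [/\ (x, y) \in darts o s, S x y & S y x].
Proof. by rewrite !inE -andbA => /and4P[-> _ -> ->]. Qed.

(** A relative form of [ppt_boundary]: a chain of inner edges with even degree at the inner
    vertices, and any degree at [u], [v], [w], is a sum of boundaries of quadrilaterals inside,
    restricted to inner edges. It is closed up along the cycle, bounded in the whole plane, and then
    cleared of the triangle. *)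
Lemma inner_cycles_bound : (kermx A <= B)%MS.
Proof.
apply/rV_subP => h /sub_kermxP hA.
pose Hf d : F2 := \sum_i h 0 i * (d == ev i)%:R.
pose H x y := Hf (x, y) + Hf (y, x).
have Hf0 d : d \notin Ein -> Hf d = 0.
  move=> nd; rewrite /Hf big1 // => i _; case: eqP => [e|_]; last by rewrite mulr0.
  by move: nd; rewrite e enum_valP.
have HfE i : Hf (ev i) = h 0 i.
  rewrite /Hf (bigD1 i) //= eqxx mulr1 big1 ?addr0 // => j nj.
  by rewrite (inj_eq enum_val_inj) eq_sym (negbTE nj) mulr0.
have Hsym x y : H x y = H y x by rewrite /H addrC.
have Hsup x y : H x y != 0 -> ((x, y) \in Ein) || ((y, x) \in Ein).
  by apply: contraNT; rewrite negb_or => /andP[/Hf0 h1 /Hf0 h2]; rewrite /H h1 h2 addr0.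
have HE x y : H x y != 0 -> [/\ (x, y) \in darts o s, S x y & S y x].
  by move/Hsup => /orP[/Ein_mem//|/Ein_mem[h1 h2 h3]]; rewrite (dart_sym hs).
have Hev i : H (ev i).1 (ev i).2 = h 0 i.
  rewrite /H -surjective_pairing HfE Hf0 ?addr0 //.
  by apply: Ein_asym; rewrite -surjective_pairing enum_valP.
have Hin x : x \notin [:: u; v; w] -> \sum_y H y x = 0.
  move=> nx; case: (boolP (x \in Vin)) => ix; last first.
    rewrite big1 // => y _; apply/eqP; apply: contraNT ix => /HE[h1 h2 h3].
    by rewrite inE nx; apply/existsP; exists y; rewrite h1.
  have := congr1 (fun M : 'rV_ _ => M 0 (enum_rank_in ix x)) hA; rewrite !mxE => hAx; rewrite -[RHS]hAx.
  rewrite -(edge_sum (E := Ein) (h := H)) //; last exact: Ein_asym.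
  rewrite [LHS]big_enum_val; apply: eq_bigr => i _.
  by rewrite Hev !mxE enum_rankK_in.
have [nuv nvw nwu] : [/\ u != v, v != w & w != u].
  by split; [exact: (dart_neq hs huv)|exact: (dart_neq hs hvw)|exact: (dart_neq hs hwu)].
(* The degrees sum to zero modulo 2, so those at [u], [v], [w] are [al + be], [al], [be]. Adding
   [al] times the edge uv and [be] times the edge uw, as [H'] does, makes all degrees even. *)
pose al := \sum_y H y v; pose be := \sum_y H y w.
have tot : \sum_y H y u = al + be.
  have [dg dgE] : exists dg, forall x, \sum_y H y x = dg x by exists (fun x => \sum_y H y x).
  have : \sum_x dg x = 0.
    rewrite (eq_bigr (fun x => \sum_y Hf (y, x) + \sum_y Hf (x, y))); last first.
      by move=> x _; rewrite -dgE -big_split.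
    by rewrite big_split /= [X in _ + X]exchange_big /= F2_addxx.
  have nvu : v != u by rewrite eq_sym.
  have nwv : w != v by rewrite eq_sym.
  rewrite /al /be !dgE (bigD1 u) //= (bigD1 v) //= (bigD1 w) ?nwu //=.
  rewrite [X in _ + (_ + (_ + X))]big1 ?addr0; first exact: F2_addr_eq0.
  by move=> x /andP[/andP[n1 n2] n3]; rewrite -dgE Hin // !inE !negb_or n1 n2 n3.
clearbody H.
pose H' x y := H x y + al * ((x, y) \in [:: (u, v); (v, u)])%:R + be * ((x, y) \in [:: (u, w); (w, u)])%:R.
have [] := @ppt_boundary _ _ _ hs H'.
- move=> x y; rewrite /H' Hsym; congr (_ + _ * _%:R + _ * _%:R); rewrite !inE !xpair_eqE;
  by do !case: eqP.
- move=> x y; apply: contraNT => nd; rewrite /H'.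
  have -> : H x y = 0 by apply/eqP; apply: contraNT nd => /HE[].
  have sub := cycle_darts_sub hs huv hvw hwu.
  case: (boolP (_ \in _)) => [i1|_].
    case/negP: nd; apply: sub; move: i1; rewrite !inE; by case/orP => ->; rewrite ?orbT.
  case: (boolP (_ \in _)) => [i1|_]; last by rewrite !mulr0 !addr0.
  case/negP: nd; apply: sub; move: i1; rewrite !inE; by case/orP => ->; rewrite ?orbT.
- move=> x; rewrite /H' !big_split /= -!mulr_sumr.
  have u1 : uniq [:: (u, v); (v, u)] by rewrite /= inE xpair_eqE (negbTE nuv).
  have u2 : uniq [:: (u, w); (w, u)] by rewrite /= inE xpair_eqE eq_sym (negbTE nwu).
  rewrite !sum_mem_snd //.
  rewrite /= !addn0.
  case: (boolP (x \in [:: u; v; w])) => [|nx]; last first.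
    rewrite Hin //; move: nx; rewrite !inE !negb_or => /and3P[n1 n2 n3].
    by rewrite !(eq_sym _ x) (negbTE n1) (negbTE n2) (negbTE n3) !mulr0 !addr0.
  rewrite !inE; case/or3P => /eqP->.
  + rewrite tot !eqxx (negbTE nwu) (eq_sym v) (negbTE nuv) /= add0n !mulr1.
    by rewrite -addrA addrC -!addrA (addrCA be) !addrA F2_addxx add0r F2_addxx.
  + rewrite -/al eqxx (negbTE nuv) (eq_sym w) (negbTE nvw) /= addn0 mulr1 mulr0 addr0.
    exact: F2_addxx.
  + rewrite -/be eqxx (negbTE nvw) (eq_sym u) (negbTE nwu) /= addn0 mulr1 mulr0 addr0.
    exact: F2_addxx.
move=> S' [hS' hB' hO'].
pose ta := S' s.1.1.1 s.1.1.2.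
(* The boundary of [S] is the 3-cycle, so adding [S] changes nothing on inner edges. It serves to
   make the value on the inner triangle zero, since [B] has rows for quadrilaterals only. *)
pose S2 x y := S' x y + ta * (S x y)%:R.
have hS2 x y z : (x, y, z) \in corners o s -> S2 x y = S2 y z.
  by move=> hc; rewrite /S2 (hS hc) (hS' _ _ _ hc).
have S2T x y : (x, y) \in tri_darts s.1 -> S2 x y = 0.
  move=> hxy; rewrite /S2 hT // mulr1 (@tri_const _ o s _ S' _ _ s.1.1.1 s.1.1.2 hS' hxy) ?F2_addxx //.
  by case: s.1 => [[a b] c]; in_list.
pose t : 'rV[F2]_(size Qs) :=
  \row_i S2 (quad_reflex (tnth (in_tuple Qs) i)).1.1 (quad_reflex (tnth (in_tuple Qs) i)).1.2.
have Qmem i : tnth (in_tuple Qs) i \in s.2.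
  by have := mem_tnth i (in_tuple Qs); rewrite mem_filter => /andP[].
have uQ : uniq Qs.
  apply: filter_uniq; have := ppt_uniq hs; rewrite /verts cat_uniq => /and3P[_ _].
  exact: map_uniq.
have S2E x y : (x, y) \in darts o s -> S x y -> S2 x y = \sum_i t 0 i * in_quad i (x, y).
  move=> hd hxy; move: (hd); rewrite mem_darts; case/or3P.
  - by move/hO; rewrite hxy.
  - move=> hxyT; rewrite (S2T _ _ hxyT) big1 // => i _; rewrite /in_quad.
    case: (boolP (_ \in _)) => [hi|_]; last by rewrite mulr0.
    by have := tri_quad_disjoint hs (Qmem i) hi; rewrite hxyT.
  - case/hasP => q iq hq.
    have iQ : q \in Qs by rewrite mem_filter iq andbT /side_quad -(quad_const hS iq hq).
    have [i ei] : exists i, tnth (in_tuple Qs) i = q by have/tnthP[i ->] : q \in in_tuple Qs by []; exists i.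
    rewrite (bigD1 i) //= big1 ?addr0.
      by rewrite /in_quad ei hq mulr1 mxE ei (quad_const hS2 iq hq).
    move=> j nj; rewrite /in_quad; case: (boolP (_ \in _)) => [hj|_]; last by rewrite mulr0.
    have := quad_dart_inj hs (Qmem j) iq hj hq; rewrite -ei => /tuple_uniqP e.
    by case/eqP: nj; apply: e.
suff -> : h = t *m B by exact: submxMl.
apply/rowP => i; rewrite mxE -Hev.
have [hd h1 h2] : [/\ (ev i) \in darts o s, S (ev i).1 (ev i).2 & S (ev i).2 (ev i).1].
  by rewrite [X in X \in _]surjective_pairing; apply: Ein_mem; rewrite -surjective_pairing enum_valP.
rewrite (eq_bigr (fun j => t 0 j * in_quad j (ev i) + t 0 j * in_quad j (swap (ev i)))); last first.
  by move=> j _; rewrite !mxE mulrDr.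
rewrite big_split; move: hd h1 h2; case: (ev i) => x y.
rewrite /swap ![(x, y).1]/= ![(x, y).2]/= => hd h1 h2.
have nc : (x, y) \in cycle_darts u v w = false by move: (hB hd); rewrite h1 h2; case: (_ \in _).
have hd' : (y, x) \in darts o s by rewrite (dart_sym hs).
transitivity (S2 x y + S2 y x); last by rewrite (S2E _ _ hd h1) (S2E _ _ hd' h2).
rewrite /S2 h1 h2 addrACA F2_addxx addr0 hB' // /H'.
move: nc; rewrite !inE => /norP[/negbTE-> /norP[/negbTE-> /norP[_ /norP[_ /norP[]]]]].
by move=> /negbTE-> /negbTE->; rewrite !mulr0 !addr0.
Qed.

(* Inside the cycle there are at least as many vertices as quadrilaterals, so all reflex angles inside sit at inside vertices. *)
Lemma no_inner_reflex q : q \in s.2 -> side_quad q -> head_of q \notin [:: u; v; w].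
Proof.
move=> iq Sq; apply/negP => hq.
have := ker_bound inner_cycles_bound; have := card_inner_edges; have := card_inner_verts iq Sq hq.
by lia.
Qed.

End Reflex.

(** * Turning the triangle about a vertex *)

Section Flip.
Variable V : finType.
Implicit Types (o : tri V) (s : state V) (R : seq (quad V)) (u v w x y z p : V) (d e : V * V) (q : quad V).

(** One face with each choice of its reflex vertex, which is the first entry. *)
Definition qrot (v0 v1 v2 v3 : V) : seq (quad V) :=
  [:: (v0, v1, v2, v3); (v1, v2, v3, v0); (v2, v3, v0, v1); (v3, v0, v1, v2)].

Definition convex (qs : seq (quad V)) : seq (tri V) := flatten (map quad_convex qs).

Definition reflex_darts o s : seq (V * V) := outer_darts o ++ map (fun q => (quad_reflex q).1) s.2.

Lemma convexP qs c : reflect (exists2 q, q \in qs & c \in quad_convex q) (c \in convex qs).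
Proof.
apply: (iffP flattenP) => [[l /mapP[q iq ->] ic]|[q iq ic]]; first by exists q.
by exists (quad_convex q) => //; apply: map_f.
Qed.

Lemma convex_corner o s c : c \in convex s.2 -> c \in corners o s.
Proof. by case/convexP => q iq ic; apply: (quad_corner_mem o iq); rewrite inE ic orbT. Qed.

Section Ppt.
Variables (o : tri V) (s : state V).
Hypothesis hs : ppt o s.
Let vC := ppt_valid hs.

Lemma reflex_dart p : p \in verts o s -> exists t, (t, p) \in reflex_darts o s.
Proof.
rewrite mem_cat => /orP[].
  by case/outer_vert_dart => z hz; exists z; rewrite mem_cat hz.
case/mapP => -[[[r a] b] c] iq e; rewrite e; exists c; rewrite mem_cat; apply/orP; right.
by apply/mapP; exists (r, a, b, c).
Qed.

Lemma reflex_dart_mem d : d \in reflex_darts o s -> d \in darts o s.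
Proof.
rewrite mem_cat => /orP[|/mapP[q iq ->]]; first exact: outer_dart_mem.
by apply: (quad_dart_mem o iq); rewrite map_f // mem_head.
Qed.

Lemma tri_not_reflex c : c \in tri_corners s.1 -> c.1 \notin reflex_darts o s.
Proof.
move=> ic; have ic' : c.1 \in tri_darts s.1 by apply: map_f.
rewrite mem_cat negb_or (outer_tri_disjoint hs ic') /=; apply/negP => /mapP[q iq e].
have := @tri_quad_disjoint _ _ _ hs q c.1 iq; rewrite {1}e map_f ?mem_head // => /(_ isT).
by rewrite ic'.
Qed.

Lemma convex_not_reflex c : c \in convex s.2 -> c.1 \notin reflex_darts o s.
Proof.
case/convexP => q iq ic; have ic' : c.1 \in quad_darts q by apply: map_f; rewrite inE ic orbT.
rewrite mem_cat negb_or (outer_quad_disjoint hs iq ic') /=; apply/negP => /mapP[q' iq' e].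
have e2 : q = q'.
  by apply: (quad_dart_inj hs iq iq' ic'); rewrite e map_f // mem_head.
have := uniq_face hs (f := quad_corners q); rewrite inE map_f // orbT => /(_ isT).
by rewrite /= {1}e2 -e map_f.
Qed.

(** Two corners inverse to each other close the rotation at [x]. *)
Lemma degree_two k l x y : (k, x, l) \in corners o s -> (l, x, k) \in corners o s ->
  (y, x) \in darts o s -> (y == k) || (y == l).
Proof.
move=> h1 h2 hy; have := valid_rot vC (v := x) (P := fun y => (y == k) || (y == l)) _ hy (corner_dart h1).
rewrite /= eqxx => -> // a b hab; apply/idP/idP; case/orP => /eqP e; subst.
- by rewrite (corner_succ hs hab h1) eqxx orbT.
- by rewrite (corner_succ hs hab h2) eqxx.
- by rewrite (corner_pred hs hab h2) eqxx orbT.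
- by rewrite (corner_pred hs hab h1) eqxx.
Qed.

Lemma degree_two_reflex k l x : (k, x, l) \in corners o s -> (l, x, k) \in corners o s ->
  ((k, x) \in reflex_darts o s) || ((l, x) \in reflex_darts o s).
Proof.
move=> h1 h2; have hx := ppt_verts hs (corner_out hs h1 : (x, l) \in _).
have [t ht] := reflex_dart hx.
by case/orP: (degree_two h1 h2 (reflex_dart_mem ht)) => /eqP <-; rewrite ht ?orbT.
Qed.

(** Every vertex has a reflex angle, and a vertex of degree one has just one angle. *)
Lemma convex_deg1 u v : (u, v, u) \notin convex s.2.
Proof.
apply/negP => h; have hc := convex_corner o h; have := convex_not_reflex h.
by have := degree_two_reflex hc hc; rewrite orbb => ->.
Qed.

(** If two opposite vertices coincided, a vertex between them with a convex angle would have degree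
    one. *)
Lemma quad_distinct q : q \in s.2 -> let: (r, a, b, c) := q in uniq [:: r; a; b; c].
Proof.
case: q => [[[r a] b] c] iq.
have hd d : d \in quad_darts (r, a, b, c) -> d \in darts o s by exact: quad_dart_mem.
have n1 : r != a by apply: (dart_neq hs (hd _ _)); in_list.
have n2 : a != b by apply: (dart_neq hs (hd _ _)); in_list.
have n3 : b != c by apply: (dart_neq hs (hd _ _)); in_list.
have n4 : c != r by apply: (dart_neq hs (hd _ _)); in_list.
have n5 : r != b.
  apply/eqP => e; have := convex_deg1 r a; case/negP; apply/convexP.
  by exists (r, a, b, c) => //; rewrite !inE e eqxx.
have n6 : a != c.
  apply/eqP => e; have := convex_deg1 a b; case/negP; apply/convexP.
  by exists (r, a, b, c) => //; rewrite !inE e eqxx orbT.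
by rewrite /= !inE !negb_or n1 n2 n3 n5 n6 eq_sym n4.
Qed.

Lemma convex_qrot v0 v1 v2 : (v0, v1, v2) \in convex s.2 -> exists q u,
  [/\ q \in s.2, q \in qrot v0 v1 v2 u, (v0, v1, v2) \in quad_convex q, head_of q != v1 & uniq [:: v0; v1; v2; u]].
Proof.
case/convexP => q iq hq; have := quad_distinct iq; move: iq hq.
case: q => [[[r a] b] d] iq hq /[dup] ud /and4P[]; rewrite !inE !negb_or => /and3P[n1 n2 n3] /andP[n4 n5] n6 _.
have := hq; rewrite !inE => /or3P[] /eqP[e0 e1 e2]; subst v0 v1 v2.
- by exists (r, a, b, d), d; split; rewrite ?inE ?eqxx.
- exists (r, a, b, d), r; split=> //; first in_list.
  by move: ud; rewrite -(rot_uniq 1).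
- exists (r, a, b, d), a; split=> //; first in_list.
  by move: ud; rewrite -(rot_uniq 2).
Qed.

Lemma convex_at q y p w u v : q \in s.2 -> (y, p, w) \in quad_corners q -> (u, p, v) \in quad_corners q -> u = y.
Proof.
move=> iq; have := quad_distinct iq; case: q {iq} => [[[r a] b] d] /and4P[].
rewrite !inE !negb_or => /and3P[/eqP n1 /eqP n2 /eqP n3] /andP[/eqP n4 /eqP n5] /eqP n6 _.
by case/or4P => /eqP[e1 e2 _]; case/or4P => /eqP[e3 e4 _]; congruence.
Qed.

End Ppt.

(* Flips across the edge py between the triangle p,y,z and the quadrilateral y,p,w,u. *)
Section Flips.
Variables (o : tri V) (s : state V) (p y z w u : V) (q : quad V) (R : seq (quad V)).
Hypothesis hs : ppt o s.
Hypothesis ht : s.1 \in tri_corners (p, y, z).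
Hypothesis hq : q \in qrot y p w u.
Hypothesis hR : perm_eq s.2 (q :: R).

Definition flip_result (t : tri V) (rots : seq (quad V)) e :=
  exists2 q', q' \in rots & head_of q' = head_of q /\
  (step o s (t, q' :: R) /\
   forall d, (d \in darts o (t, q' :: R)) =
     [|| d == e, d == swap e | [&& d \in darts o s, d != (p, y) & d != (y, p)]]).

Lemma flip_pent P i j t rots e :
  tri_corners (tip_tri P i) =i tri_corners (p, y, z) -> tip_quad P i = q -> tip_tri P j = t ->
  tip_quad P j \in rots -> tip_edge P i \in [:: (p, y); (y, p)] ->
  tip_edge P j \in [:: e; swap e] -> nonadj o s e -> flip_result t rots e.
Proof.
move=> h1 h2 h3 h4 h5 h6 h7.
exists (tip_quad P j); first by [].
split; first by rewrite -h2 !head_tip.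
have h7' : nonadj o s (tip_edge P j).
  move: h6; rewrite !inE => /orP[/eqP->//|/eqP->].
  by case/and3P: h7 => n1 n2 n3; by rewrite /nonadj eq_sym n1 n3 /swap -surjective_pairing.
have := @tip_step _ o s P i j R (ppt_valid hs); rewrite h1 h2 h3 => /(_ ht hR h7').
case=> st hd; split=> // d; rewrite hd.
have e1 : (d == tip_edge P j) || (d == swap (tip_edge P j)) = (d == e) || (d == swap e).
  by move: h6; rewrite !inE => /orP[/eqP->//|/eqP->]; rewrite orbC; case: (e).
have e2 : (d != tip_edge P i) && (d != swap (tip_edge P i)) = (d != (p, y)) && (d != (y, p)).
  by move: h5; rewrite !inE => /orP[/eqP->//|/eqP->]; rewrite andbC.
by rewrite !orbA e1 e2.
Qed.

Ltac flip_with P i j e := apply: (@flip_pent P i j); rewrite ?e //= ?inE ?eqxx ?orbT //;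
  by move=> c; rewrite !inE; do !case: eqP.

(** Without [py] the region is the pentagon p, w, u, y, z. Each of the next four lemmas is named
    after the tip of the new ear, which may not be the reflex vertex; the ear at [z] is the old
    triangle. The case analysis locates the reflex vertex, at which the listing of the pentagon has
    to start. *)
Lemma flip_p : head_of q != p -> nonadj o s (w, z) -> flip_result (z, p, w) (qrot w u y z) (w, z).
Proof.
move=> hh hn; move: hq hh; rewrite !inE => /or4P[] /eqP e hh;
  [flip_with (y, z, p, w, u) 0 1 e|by rewrite e /= eqxx in hh|flip_with (w, u, y, z, p) 2 3 e|flip_with (u, y, z, p, w) 1 2 e].
Qed.

Lemma flip_w : head_of q != w -> nonadj o s (p, u) -> flip_result (p, w, u) (qrot p u y z) (p, u).
Proof.
move=> hh hn; move: hq hh; rewrite !inE => /or4P[] /eqP e hh;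
  [flip_with (y, z, p, w, u) 0 2 e|flip_with (p, w, u, y, z) 3 0 e|by rewrite e /= eqxx in hh|flip_with (u, y, z, p, w) 1 3 e].
Qed.

Lemma flip_u : head_of q != u -> nonadj o s (w, y) -> flip_result (w, u, y) (qrot p w y z) (w, y).
Proof.
move=> hh hn; move: hq hh; rewrite !inE => /or4P[] /eqP e hh;
  [flip_with (y, z, p, w, u) 0 3 e|flip_with (p, w, u, y, z) 3 1 e|flip_with (w, u, y, z, p) 2 0 e|by rewrite e /= eqxx in hh].
Qed.

Lemma flip_y : head_of q != y -> nonadj o s (u, z) -> flip_result (u, y, z) (qrot p w u z) (u, z).
Proof.
move=> hh hn; move: hq hh; rewrite !inE => /or4P[] /eqP e hh;
  [by rewrite e /= eqxx in hh|flip_with (p, w, u, y, z) 3 2 e|flip_with (w, u, y, z, p) 2 1 e|flip_with (u, y, z, p, w) 1 0 e].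
Qed.

End Flips.
End Flip.

(** * The 3-cycle behind a blocked flip *)

Section Blocking.
Variable V : finType.
Implicit Types (o : tri V) (s : state V) (u v w x y z p : V) (e : V * V) (q : quad V).

Section Blocked.
Variables (o : tri V) (s : state V) (p y z w : V) (q : quad V).
Hypothesis hs : ppt o s.
Hypothesis ht : s.1 \in tri_corners (p, y, z).
Hypothesis iq : q \in s.2.
Hypothesis hc : (y, p, w) \in quad_convex q.

Lemma triE : tri_corners s.1 =i tri_corners (p, y, z).
Proof. exact: perm_mem (perm_tri_corners ht). Qed.

Lemma tri_pyz : [/\ (p, y, z) \in tri_corners s.1, (y, z, p) \in tri_corners s.1 & (z, p, y) \in tri_corners s.1].
Proof. by rewrite !triE !inE !eqxx ?orbT. Qed.

Lemma tri_pyz_corners : [/\ (p, y, z) \in corners o s, (y, z, p) \in corners o s & (z, p, y) \in corners o s].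
Proof. by have [h1 h2 h3] := tri_pyz; split; apply: tri_corner_mem. Qed.

Lemma tri_pyz_neq : [/\ p != y, y != z & z != p].
Proof.
have [/corner_dart h1 /corner_dart h2 /corner_dart h3] := tri_pyz_corners.
by split; [exact: (dart_neq hs h1)|exact: (dart_neq hs h2)|exact: (dart_neq hs h3)].
Qed.

Lemma ypw_convex : (y, p, w) \in convex s.2.
Proof. by apply/convexP; exists q. Qed.

Lemma ypw_corner : (y, p, w) \in corners o s.
Proof. exact: convex_corner ypw_convex. Qed.

Lemma ypw_neq : [/\ y != p, p != w & y != w].
Proof.
have h := ypw_corner; split; [exact: (dart_neq hs (corner_dart h))|exact: (dart_neq hs (corner_out hs h))|].
by apply/eqP => e; have := convex_deg1 hs y p; rewrite {2}e ypw_convex.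
Qed.

(** Otherwise [p] would have degree two, with neither of its two angles reflex. *)
Lemma next_neq : w != z.
Proof.
apply/eqP => e; have [_ _ t3] := tri_pyz; have [c1 c2 c3] := tri_pyz_corners.
have h := ypw_corner; rewrite e in h.
have := degree_two_reflex hs h c3; case/orP; apply/negP; first exact: (convex_not_reflex hs ypw_convex).
exact: (tri_not_reflex hs t3).
Qed.

(* When w and z are adjacent, y and u lie inside the 3-cycle p,z,w while p has no other neighbour inside. *)
Lemma blocked : (w, z) \in darts o s ->
  head_of q \notin [:: p; z; w] /\
  forall x x', (x', x) \in quad_darts q -> x \notin [:: p; z; w] ->
    ((x, p) \in darts o s -> x = y) /\
    forall x2, (x2, p) \in darts o s -> x2 \notin [:: y; z; w] -> (x, x2) \notin darts o s.
Proof.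
move=> hwz; have [n1 n2 n3] := ypw_neq; have nz := next_neq.
have [m1 m2 m3] := tri_pyz_neq.
have [t1 t2 t3] := tri_pyz; have [c1 c2 c3] := tri_pyz_corners; have h := ypw_corner.
have hpz : (p, z) \in darts o s by rewrite (dart_sym hs); exact: (corner_dart c3).
have hzw : (z, w) \in darts o s by rewrite (dart_sym hs).
have hwp : (w, p) \in darts o s by rewrite (dart_sym hs); exact: (corner_out hs h).
have [S [hS hB hO hT]] := cycle_inside hs hpz hzw hwp.
have cpE x : (p, x) \in cycle_darts p z w = (x \in [:: z; w]).
  by rewrite !inE !xpair_eqE !eqxx (eq_sym p z) (negbTE m3) (negbTE n2) /= ?orbF.
have Syp : S y p.
  rewrite (hB p y); last exact: (corner_dart c1).
  rewrite cpE !inE (negbTE m2) (negbTE n3) addbF; apply: hT.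
  by apply: (map_f fst t1).
have qy : (y, p) \in quad_darts q by apply: (map_f fst (x := (y, p, w))); rewrite inE hc orbT.
have Sq x x' : (x', x) \in quad_darts q -> S x' x.
  by move=> hx; rewrite (quad_const hS iq hx) -(quad_const hS iq qy).
split.
  apply: (no_inner_reflex hs hpz hzw hwp hS hB hO hT iq).
  by rewrite -(quad_const hS iq qy).
(* Going round [p], the side changes only at the edges pz and pw, so of the darts entering [p] only
   those from [y] and [z] are inside. Formally, the side added to membership in [[:: y; z]] is
   invariant under the rotation. *)
have So x2 : (x2, p) \in darts o s -> x2 \notin [:: y; z] -> S x2 p = false.
  move=> hx2 nx2.
  have := valid_rot (ppt_valid hs) (v := p) (P := fun u => S u p (+) (u \in [:: y; z])) _ hx2 (corner_dart c3).
  rewrite (negbTE nx2) addbF !inE eqxx orbT (hT z p) ?addbT; last exact: (map_f fst t3).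
  apply=> a b hab; rewrite (hS _ _ _ hab) (hB p b); last exact: (corner_out hs hab).
  rewrite cpE -addbA; congr (_ (+) _); rewrite !inE.
  have -> : (a == y) = (b == w).
    by apply/eqP/eqP => e; subst; [exact: (corner_succ hs hab h)|exact: (corner_pred hs hab h)].
  have -> : (a == z) = (b == y).
    by apply/eqP/eqP => e; subst; [exact: (corner_succ hs hab c3)|exact: (corner_pred hs hab c3)].
  have [->|_] := eqVneq b z; first by rewrite eq_sym (negbTE nz) eq_sym (negbTE m2).
  have [->|_] := eqVneq b w; first by rewrite eq_sym (negbTE n3).
  by rewrite /= orbF.
move=> x x' /[dup] /Sq Sx' /(quad_dart_mem o iq) hx' nx; split.
  move=> hxp; apply/eqP; apply: contraT => nxy.
  have : S x p = false.
    by apply: So => //; move: nx; rewrite !inE !negb_or nxy => /and3P[].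
  rewrite (side_out hB nx hxp) -(side_around hs hS hB nx hx') ?Sx' //.
  by rewrite (dart_sym hs).
move=> x2 hx2; rewrite !inE !negb_or => /and3P[k1 k2 k3].
have nx2 : x2 \notin [:: p; z; w].
  by rewrite !inE !negb_or k2 k3 (dart_neq hs hx2).
have S2 : S x2 p = false by apply: So => //; rewrite !inE negb_or k1.
apply/negP => hxx2.
have : S x x2 = false.
  rewrite -S2 (side_out hB nx2 hx2); apply: (side_around hs hS hB nx2 hxx2).
  by rewrite (dart_sym hs).
rewrite (side_out hB nx hxx2) -(side_around hs hS hB nx hx') ?Sx' //.
by rewrite (dart_sym hs).
Qed.

End Blocked.
End Blocking.

(** * One move of the triangle about p *)

Section Advance.
Variable V : finType.
Implicit Types (o : tri V) (s : state V) (R : seq (quad V)) (u v w y z p : V) (d e : V * V) (q : quad V).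

Lemma nonadjI o s u v : ppt o s -> u != v -> (u, v) \notin darts o s -> nonadj o s (u, v).
Proof. by move=> hs n h; rewrite /nonadj /= n h /swap /= (dart_sym hs). Qed.

Lemma qrot_convex q v0 v1 v2 v3 : q \in qrot v0 v1 v2 v3 -> head_of q != v1 ->
  (v0, v1, v2) \in quad_convex q.
Proof.
rewrite !inE => /or4P[] /eqP-> /=; rewrite !inE ?eqxx ?orbT //.
Qed.

Lemma qrot_rot q v0 v1 v2 v3 : q \in qrot v0 v1 v2 v3 -> q \in qrot v3 v0 v1 v2.
Proof. by rewrite !inE => /or4P[] ->; rewrite ?orbT. Qed.

Lemma qrot_corners q v0 v1 v2 v3 : q \in qrot v0 v1 v2 v3 ->
  quad_corners q =i [:: (v0, v1, v2); (v1, v2, v3); (v2, v3, v0); (v3, v0, v1)].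
Proof.
move=> hq c; move: hq; rewrite !inE => /or4P[] /eqP-> /=; rewrite !inE;
 case: (c == _); case: (c == _); case: (c == _); case: (c == _); done.
Qed.

(** If wz is free, the ear is cut at [p] and [p] loses the neighbour [y]. If not, [blocked] shows
    that another flip is free, after which the triangle is p, w, u. The next flip about [p] would
    insert the edge from [u] to the neighbour following [w]; the last clause says that this edge is
    free. *)
Lemma advance o s p y z w : ppt o s -> s.1 \in tri_corners (p, y, z) -> (y, p, w) \in convex s.2 ->
  exists s', [/\ step o s s',
    forall d, d \in darts o s -> d.1 \notin [:: p; y; z] -> d \in darts o s',
    forall u v, (u, p, v) \in convex s.2 -> u != y -> (u, p, v) \in convex s'.2 &
    ((w, z) \notin darts o s /\ s'.1 \in tri_corners (p, w, z)) \/
    ((w, z) \in darts o s /\ exists u, [/\ s'.1 \in tri_corners (p, w, u), (z, p, u) \in convex s'.2,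
      (u, p) \in darts o s -> u = y &
      forall w', (w', p) \in darts o s -> w' \notin [:: y; z; w] -> (u, w') \notin darts o s'])].
Proof.
move=> hs ht hc; have [q [u [iq hqr hcq hh un]]] := convex_qrot hs hc.
have hR := perm_to_rem iq; set R := rem q s.2 in hR.
have keep q' u0 v0 : (u0, p, v0) \in convex s.2 -> u0 != y -> (u0, p, v0) \in convex (q' :: R).
  case/convexP => q0 iq0 ic0 n0; apply/convexP; exists q0 => //.
  move: iq0; rewrite (perm_mem hR) !in_cons => /orP[/eqP e|->]; last by rewrite orbT.
  case/negP: n0; rewrite (convex_at hs iq (y := y) (p := p) (w := w) (u := u0) (v := v0)) //.
    by rewrite inE hcq orbT.
  by rewrite inE -e ic0 orbT.
have [nyp npw nyw] := ypw_neq hs iq hcq.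
have nz := next_neq hs ht iq hcq.
have keepd (rots : seq (quad V)) t e q' : (forall d, d \in darts o (t, q' :: R) =
     [|| d == e, d == swap e | [&& d \in darts o s, d != (p, y) & d != (y, p)]]) ->
   forall d, d \in darts o s -> d.1 \notin [:: p; y; z] -> d \in darts o (t, q' :: R).
  move=> H d hd; rewrite !inE !negb_or H hd => /and3P[k1 k2 k3].
  apply/or3P; constructor 3; apply/andP; split=> //=; apply/andP.
  by split; [apply: contra k1|apply: contra k2] => /eqP->.
have [hwz|hwz] := boolP ((w, z) \in darts o s); last first.
  have [q' hq' [hh' [st hd]]] := flip_p hs ht hqr hR hh (nonadjI hs nz hwz).
  exists ((z, p, w), q' :: R); split=> //.
  - exact: keepd hd.
  - by move=> u0 v0; apply: keep.
  - by left; split=> //; in_list.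
have [hb1 hb2] := blocked hs ht iq hcq hwz.
(* If u = z, then [y] has degree two, with neighbours [p] and [z]. In that case the flip crosses yz
   instead of py and inserts yw, so that [y] itself becomes the third vertex of the new triangle.
   Otherwise the ear is cut at [w] and pu is inserted. *)
have [euz|nuz] := eqVneq u z.
  subst u.
  have ht' : s.1 \in tri_corners (y, z, p).
    by move: ht; rewrite !inE => /or3P[] ->; rewrite ?orbT.
  have [c1 c2 c3] := tri_pyz_corners o ht.
  have czyp : (z, y, p) \in corners o s.
    by apply: (quad_corner_mem o iq); rewrite (qrot_corners hqr) !inE eqxx !orbT.
  have only a : (a, y) \in darts o s -> a \in [:: p; z].
    by move=> ha; rewrite !inE (degree_two hs c1 czyp ha).
  have nwy : (y, w) \notin darts o s.
    by rewrite (dart_sym hs); apply/negP => /only; rewrite !inE (eq_sym w p) (negbTE npw) (negbTE nz).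
  have [q' hq' [hh' [st hd]]] := flip_w hs ht' (qrot_rot hqr) hR hh (nonadjI hs nyw nwy).
  exists ((y, p, w), q' :: R); split=> //.
  - move=> d hdd; rewrite !inE !negb_or hd hdd => /and3P[k1 k2 k3].
    apply/or3P; constructor 3; apply/andP; split=> //=; apply/andP.
    by split; [apply: contra k2|apply: contra k3] => /eqP->.
  - by move=> u0 v0; apply: keep.
  right; split=> //; exists y; split=> //.
  - in_list.
  - apply/convexP; exists q'; first by rewrite mem_head.
    apply: (qrot_convex (v3 := w)); last by rewrite hh'.
    by apply: qrot_rot; apply: qrot_rot.
  - move=> w' hw'; rewrite !inE !negb_or hd => /and3P[k1 k2 k3].
    rewrite /swap /= !xpair_eqE eqxx (negbTE nyw) (negbTE k3) /=.
    apply/negP => /and3P[]; rewrite (dart_sym hs) => /only; rewrite !inE (negbTE k2) orbF => /eqP e.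
    by have := dart_neq hs hw'; rewrite e eqxx.
move: (un) => /and4P[]; rewrite !inE !negb_or => /and3P[k1 k2 k3] /andP[k4 k5] k6 _.
have nu : u \notin [:: p; z; w] by rewrite !inE !negb_or eq_sym k5 nuz eq_sym k6.
have ux : (w, u) \in quad_darts q.
  by apply/mapP; exists (w, u, y) => //; rewrite (qrot_corners hqr) !inE eqxx !orbT.
have [hb3 hb4] := hb2 u w ux nu.
have npu : (p, u) \notin darts o s.
  by rewrite (dart_sym hs); apply/negP => /hb3 e; rewrite e eqxx in k3.
have hhw : head_of q != w by move: hb1; rewrite !inE !negb_or => /and3P[].
have [q' hq' [hh' [st hd]]] := flip_w hs ht hqr hR hhw (nonadjI hs k5 npu).
exists ((p, w, u), q' :: R); split=> //.
- exact: keepd hd.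
- by move=> u0 v0; apply: keep.
right; split=> //; exists u; split=> //.
- in_list.
- apply/convexP; exists q'; first by rewrite mem_head.
  apply: (qrot_convex (v3 := y)); last by rewrite hh'.
  exact: qrot_rot.
- move=> w' hw' nw'; rewrite hd /swap /= !xpair_eqE (negbTE (hb4 w' hw' nw')) /= orbF.
  by rewrite (eq_sym u p) (negbTE k5) /= eqxx /= (negbTE (dart_neq hs hw')).
Qed.

End Advance.

(** * Reflection and step sequences *)

Section Mirror.
Variable V : finType.
Implicit Types (o t : tri V) (s : state V) (R : seq (quad V)) (u v w x y z p : V) (d e : V * V) (q : quad V).

(** Exchanging the first two entries reverses the orientation and keeps the third, so an outer face
    [(a, b, c)] becomes [(b, a, c)] with [c] still last. *)
Definition mirror_tri t : tri V := (t.1.2, t.1.1, t.2).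
Definition mirror_quad q : quad V := let: (r, x, y, z) := q in (r, z, y, x).
Definition mirror s : state V := (mirror_tri s.1, map mirror_quad s.2).
Definition mirror_corner t : tri V := (t.2, t.1.2, t.1.1).

Lemma mirror_triK : involutive mirror_tri. Proof. by case=> [[a b] c]. Qed.
Lemma mirror_quadK : involutive mirror_quad. Proof. by case=> [[[a b] c] d]. Qed.
Lemma mirrorK : involutive mirror.
Proof. by case=> t qs; rewrite /mirror mirror_triK (mapK mirror_quadK). Qed.

Lemma mirror_head qs : map head_of (map mirror_quad qs) = map head_of qs.
Proof. by rewrite -map_comp; apply: eq_map => -[[[r x] y] z]. Qed.

Lemma perm_mirror_tri t : perm_eq (tri_corners (mirror_tri t)) (map mirror_corner (tri_corners t)).
Proof. by case: t => [[a b] c]; rewrite /mirror_tri /mirror_corner /=; perm_list. Qed.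

Lemma perm_mirror_quad q : perm_eq (quad_corners (mirror_quad q)) (map mirror_corner (quad_corners q)).
Proof. by case: q => [[[r x] y] z]; rewrite /mirror_corner /=; perm_list. Qed.

Lemma perm_mirror o s :
  perm_eq (corners (mirror_tri o) (mirror s)) (map mirror_corner (corners o s)).
Proof.
rewrite /corners !map_cat; apply: perm_cat; first exact: perm_mirror_tri.
apply: perm_cat; first exact: perm_mirror_tri.
change (perm_eq (quads_corners (map mirror_quad s.2)) (map mirror_corner (quads_corners s.2))).
elim: s.2 => // q l IH.
change (perm_eq (quad_corners (mirror_quad q) ++ quads_corners (map mirror_quad l))
  (map mirror_corner (quad_corners q ++ quads_corners l))).
by rewrite map_cat; apply: perm_cat IH; exact: perm_mirror_quad.
Qed.

Lemma perm_out_darts o s : perm_eq (map (@out_dart V) (corners o s)) (darts o s).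
Proof.
rewrite /darts /corners !map_cat.
have T t : perm_eq (map (@out_dart V) (tri_corners t)) (tri_darts t).
  by case: t => [[a b] c]; rewrite /out_dart /=; perm_list.
apply: perm_cat => //; apply: perm_cat => //.
rewrite /quads_corners; elim: s.2 => // q l IH.
change (perm_eq (map (@out_dart V) (quad_corners q ++ quads_corners l))
  (map fst (quad_corners q ++ quads_corners l))).
rewrite !map_cat; apply: perm_cat IH.
by case: q => [[[r x] y] z]; rewrite /out_dart /=; perm_list.
Qed.

Lemma darts_mirror o s u v :
  ((u, v) \in darts (mirror_tri o) (mirror s)) = ((v, u) \in darts o s).
Proof.
rewrite -(perm_mem (perm_out_darts o s)) /darts (perm_mem (perm_map fst (perm_mirror o s))).
rewrite -map_comp; apply/mapP/mapP => -[[[a b] c] h [-> ->]]; by exists (a, b, c).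
Qed.

Lemma valid_mirror o s : valid (corners o s) -> valid (corners (mirror_tri o) (mirror s)).
Proof.
move=> vC; have p := perm_mirror o s; rewrite perm_sym in p; apply: (valid_perm p).
have injs : injective (@swap V) by move=> [x y] [x' y'] [-> ->].
have e1 : map fst (map mirror_corner (corners o s)) = map (@swap V) (map (@out_dart V) (corners o s)).
  by rewrite -!map_comp; apply: eq_map => -[[a b] c].
have e2 : map (@out_dart V) (map mirror_corner (corners o s)) = map (@swap V) (darts o s).
  by rewrite -!map_comp; apply: eq_map => -[[a b] c].
have p1 : perm_eq (map fst (map mirror_corner (corners o s))) (map (@swap V) (darts o s)).
  by rewrite e1; apply: perm_map; exact: perm_out_darts.
have m1 u v : ((u, v) \in map fst (map mirror_corner (corners o s))) = ((u, v) \in darts o s).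
  rewrite (perm_mem p1) -[(u, v)]/(swap (v, u)) (mem_map injs).
  by apply/idP/idP => /(valid_sym vC).
have mC a b c : ((a, b, c) \in map mirror_corner (corners o s)) = ((c, b, a) \in corners o s).
  apply/mapP/idP => [[[[x y] z] h [-> -> ->]] //|h]; by exists (c, b, a).
split.
- by rewrite (perm_uniq p1) (map_inj_uniq injs) (valid_uniq vC).
- by rewrite e2 perm_sym.
- by move=> u v; rewrite !m1; apply: valid_sym vC _ _.
- by move=> u; rewrite m1; apply: valid_irr vC _.
- move=> v P hP u u'; rewrite !m1; apply: (valid_rot vC) => a b hab.
  by apply/esym/hP; rewrite mC.
- move=> P hP u v u' v'; rewrite !m1; apply: (valid_conn vC) => a b hab.
  by apply: hP; rewrite m1.
Qed.

Lemma perm_verts_mirror o s : perm_eq (verts (mirror_tri o) (mirror s)) (verts o s).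
Proof.
rewrite /verts (mirror_head s.2) perm_cat2r.
by case: o => [[a b] c]; rewrite /mirror_tri; perm_list.
Qed.

Lemma ppt_mirror o s : ppt o s -> ppt (mirror_tri o) (mirror s).
Proof.
move=> hs; have p := perm_verts_mirror o s; split.
- exact: valid_mirror (ppt_valid hs).
- by rewrite (perm_uniq p) (ppt_uniq hs).
- move=> u v; rewrite darts_mirror -(dart_sym hs) => h.
  by rewrite (perm_mem p); exact: ppt_verts h.
Qed.

Lemma tri_mirror t t' : t \in tri_corners t' -> mirror_tri t \in tri_corners (mirror_tri t').
Proof.
by case: t' => [[a b] c]; rewrite !inE => /or3P[] /eqP->; rewrite /mirror_tri /= eqxx ?orbT.
Qed.

Lemma step_mirror o s s' : step o s s' -> step (mirror_tri o) (mirror s) (mirror s').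
Proof.
case=> -[[[[p0 p1] p2] p3] p4] [i] [j] [R] [[h1 h2] [h3 h4] h5 h6].
pose P' := (p0, p4, p3, p2, p1).
pose m i := match i with 0 => 3 | 1 => 2 | 2 => 1 | _ => 0 end.
have mt k : mirror_tri (tip_tri (p0, p1, p2, p3, p4) k) \in tri_corners (tip_tri P' (m k)).
  by case: k => [|[|[|k]]]; rewrite /mirror_tri !inE /= eqxx ?orbT.
have mq k : mirror_quad (tip_quad (p0, p1, p2, p3, p4) k) = tip_quad P' (m k).
  by case: k => [|[|[|k]]].
have me k : tip_edge P' (m k) = swap (tip_edge (p0, p1, p2, p3, p4) k).
  by case: k => [|[|[|k]]].
have na r e : nonadj o r e -> nonadj (mirror_tri o) (mirror r) (swap e).
  by case: e => a b /and3P[k1 k2 k3]; rewrite /nonadj /swap /= !darts_mirror eq_sym k1 k2.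
exists P', (m i), (m j), (map mirror_quad R); split.
- split; first exact: tri_corners_trans (tri_mirror h1) (mt _).
  by rewrite -mq; exact: (perm_map mirror_quad h2).
- split; first exact: tri_corners_trans (tri_mirror h3) (mt _).
  by rewrite -mq; exact: (perm_map mirror_quad h4).
- by rewrite me; exact: na.
- by rewrite me; exact: na.
Qed.

Lemma convex_mirror s u v w : ((u, v, w) \in convex (mirror s).2) = ((w, v, u) \in convex s.2).
Proof.
apply/convexP/convexP => -[q iq ic].
  case/mapP: iq ic => q' iq' -> ic; exists q' => //.
  by case: q' ic {iq'} => [[[r a] b] c]; rewrite !inE => /or3P[] /eqP[-> -> ->]; rewrite eqxx ?orbT.
exists (mirror_quad q); first exact: map_f.
by case: q ic {iq} => [[[r a] b] c]; rewrite !inE => /or3P[] /eqP[-> -> ->]; rewrite eqxx ?orbT.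
Qed.

(** Length 0 allows another listing of the same state: the triangle rotated and the quadrilaterals
    permuted. *)
Inductive reach o : nat -> state V -> state V -> Prop :=
  | reach0 s s' : s'.1 \in tri_corners s.1 -> perm_eq s.2 s'.2 -> reach o 0 s s'
  | reachS k s1 s2 s3 : step o s1 s2 -> reach o k s2 s3 -> reach o k.+1 s1 s3.

Lemma nonadj_eqv o s s' d : s'.1 \in tri_corners s.1 -> perm_eq s.2 s'.2 -> nonadj o s' d = nonadj o s d.
Proof.
move=> h1 h2; have p : perm_eq (darts o s') (darts o s).
  by apply: perm_map; rewrite perm_sym in h2; apply: corners_perm.
by rewrite /nonadj !(perm_mem p).
Qed.

Lemma step_eqv o s s' s2 : s'.1 \in tri_corners s.1 -> perm_eq s.2 s'.2 -> step o s' s2 -> step o s s2.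
Proof.
move=> h1 h2 [P [i] [j] [R] [[k1 k2] [k3 k4] k5 k6]]; exists P, i, j, R; split=> //.
- split; last by rewrite (permPl h2).
  exact: tri_corners_trans (tri_corners_sym h1) k1.
- by rewrite -(nonadj_eqv _ _ h1 h2).
Qed.

Lemma reach_refl o s : reach o 0 s s.
Proof. by apply: reach0; rewrite ?tri_corners_refl. Qed.

Lemma reach_trans o k k' s1 s2 s3 : reach o k s1 s2 -> reach o k' s2 s3 -> reach o (k + k') s1 s3.
Proof.
elim=> [s s' h1 h2|k0 a b c st _ IH] h; last by rewrite addSn; apply: reachS st (IH h).
case: h h1 h2 => [a b h3 h4|k0 a b c st hr] h1 h2; rewrite add0n.
  apply: reach0; first exact: tri_corners_trans h3 h1.
  by rewrite (permPl h2).
exact: reachS (step_eqv h1 h2 st) hr.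
Qed.

Lemma reach_sym o k s s' : reach o k s s' -> reach o k s' s.
Proof.
elim=> [a b h1 h2|k0 a b c st _ IH].
  by apply: reach0; [exact: tri_corners_sym|rewrite perm_sym].
rewrite -addn1; apply: reach_trans IH _; apply: reachS (reach_refl _ _).
exact: step_sym.
Qed.

Lemma reach_ppt o k s s' : reach o k s s' -> ppt o s -> ppt o s'.
Proof.
elim=> [a b h1 h2 [v1 u1 w1]|k0 a b c st _ IH]; last by move/(ppt_step st).
have p : perm_eq (corners o b) (corners o a) by rewrite perm_sym in h2; apply: corners_perm.
have pv : perm_eq (verts o b) (verts o a) by rewrite perm_cat2l; apply: perm_map; rewrite perm_sym.
split.
- by rewrite perm_sym in p; apply: valid_perm p v1.
- by rewrite (perm_uniq pv).
- move=> u v; rewrite (perm_mem pv) (perm_mem (perm_map fst p)); exact: w1.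
Qed.

Lemma reach_verts o k s s' : reach o k s s' -> perm_eq (verts o s') (verts o s).
Proof.
elim=> [a b h1 h2|k0 a b c st _ IH].
  by rewrite perm_cat2l; apply: perm_map; rewrite perm_sym.
by rewrite (permPl IH); apply: perm_verts_step.
Qed.

Lemma reach_mirror o k s s' : reach o k s s' -> reach (mirror_tri o) k (mirror s) (mirror s').
Proof.
elim=> [a b h1 h2|k0 a b c st _ IH]; last by apply: reachS IH; apply: step_mirror.
by apply: reach0; [exact: tri_mirror|exact: perm_map].
Qed.

Definition within o m s s' := exists2 k, k <= m & reach o k s s'.

Lemma within_refl o m s : within o m s s.
Proof. by exists 0 => //; apply: reach_refl. Qed.

Lemma within_step o s s' : step o s s' -> within o 1 s s'.
Proof. by move=> st; exists 1 => //; apply: reachS st (reach_refl _ _). Qed.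

Lemma within_trans o m m' s1 s2 s3 : within o m s1 s2 -> within o m' s2 s3 -> within o (m + m') s1 s3.
Proof. by case=> k hk r [k' hk' r']; exists (k + k'); [apply: leq_add|apply: reach_trans r r']. Qed.

Lemma within_leq o m m' s s' : m <= m' -> within o m s s' -> within o m' s s'.
Proof. by move=> h [k hk r]; exists k => //; apply: leq_trans h. Qed.

Lemma within_mirror o m s s' : within o m s s' -> within (mirror_tri o) m (mirror s) (mirror s').
Proof. by case=> k hk r; exists k => //; apply: reach_mirror. Qed.

Lemma within_sym o m s s' : within o m s s' -> within o m s' s.
Proof. by case=> k hk r; exists k => //; apply: reach_sym. Qed.

Lemma within_ppt o m s s' : within o m s s' -> ppt o s -> ppt o s'.
Proof. by case=> k _; apply: reach_ppt. Qed.

Lemma within_verts o m s s' : within o m s s' -> perm_eq (verts o s') (verts o s).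
Proof. by case=> k _; apply: reach_verts. Qed.

End Mirror.

(** * Moving the triangle *)

Section Fans.
Variable V : finType.
Implicit Types (o t : tri V) (s : state V) (u v w x y z p c : V) (d e : V * V) (Lb Lf : seq V).

Definition fwd s p : rel V := fun u v => (u, p, v) \in convex s.2.
Definition bwd s p : rel V := fun u v => (v, p, u) \in convex s.2.

(* The neighbours of p around the triangle p,y,z, clockwise (Lb) and counterclockwise (Lf), without passing the reflex angle at p. *)
Definition fan s p z y Lb Lf := [/\ s.1 \in tri_corners (p, y, z),
  path (fwd s p) y Lf, path (bwd s p) z Lb & uniq (z :: y :: Lb ++ Lf)].

Definition tri_verts t : seq V := [:: t.1.1; t.1.2; t.2].

Lemma tri_verts_corners t t' : t \in tri_corners t' -> tri_verts t =i tri_verts t'.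
Proof.
by case: t t' => [[x y] z] [[x' y'] z']; rewrite !inE => /or3P[] /eqP[-> -> ->] v;
  rewrite !inE; do !case: eqP.
Qed.

Lemma fan_mirror s p z y Lb Lf : fan s p z y Lb Lf -> fan (mirror s) p y z Lf Lb.
Proof.
case=> h1 h2 h3 h4; split.
- by apply: tri_corners_trans (tri_mirror h1) _; rewrite /mirror_tri !inE eqxx ?orbT.
- by rewrite (eq_path (e' := bwd s p)) // => u v; rewrite /fwd convex_mirror.
- by rewrite (eq_path (e' := fwd s p)) // => u v; rewrite /bwd convex_mirror.
- move: h4; rewrite -(perm_uniq (s1 := [:: z, y & Lb ++ Lf])) //.
  by perm_list.
Qed.

Lemma path_target (T : eqType) (e : rel T) (x : T) l (v : T) : path e x l -> v \in l -> exists k : T, e k v.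
Proof.
elim: l x => // y l IH x /= /andP[h1 h2]; rewrite inE => /predU1P[->|]; last exact: IH h2.
by exists x.
Qed.

Lemma fan_nbr o s p z y Lb Lf u : ppt o s -> fan s p z y Lb Lf ->
  u \in z :: y :: Lb ++ Lf -> (u, p) \in darts o s.
Proof.
move=> hs [h1 h2 h3 h4]; have [c1 c2 c3] := tri_pyz_corners o h1.
rewrite !in_cons mem_cat; case/or4P => [/eqP->|/eqP->|iu|iu].
- exact: corner_dart c3.
- by rewrite (dart_sym hs); exact: corner_dart c1.
- by have [x hx] := path_target h3 iu; apply: corner_dart (convex_corner o hx).
- have [x hx] := path_target h2 iu; rewrite (dart_sym hs).
  exact: (corner_out hs (convex_corner o hx)).
Qed.

(** In the first case the fan loses [y]. In the blocked case [z] joins the neighbours already passed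
    and [u] takes its place, so [Lb] grows as the list ahead shrinks, and the total length is
    unchanged; the last clause frees the next flip. *)
Lemma fan_advance o s p z y Lb w Lf : ppt o s -> fan s p z y Lb (w :: Lf) ->
  exists s', [/\ step o s s',
    forall d, d \in darts o s -> d.1 \notin [:: p; y; z] -> d \in darts o s' &
    ((w, z) \notin darts o s /\ fan s' p z w Lb Lf) \/
    ((w, z) \in darts o s /\ exists u, fan s' p u w (z :: Lb) Lf /\
       forall w' Lf', Lf = w' :: Lf' -> (u, w') \notin darts o s')].
Proof.
move=> hs hf; have nb := fan_nbr hs hf; case: hf => ht /= /andP[hw hp] hb hu.
have [s' [st kd kc H]] := advance hs ht hw.
have {}hu : uniq [:: y, z, w & Lb ++ Lf].
  rewrite -(perm_uniq (s1 := [:: z, y & Lb ++ w :: Lf])) //.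
  by perm_list.
move: (hu); rewrite cons_uniq => /andP[ny hu'].
have hp' : path (fwd s' p) w Lf.
  apply: (sub_in_path (P := fun x => x != y) (e := fwd s p)) hp.
    by move=> u v nu _ huv; apply: kc.
  apply/allP => x ix; apply: contraNneq ny => <-.
  by move: ix; rewrite !inE mem_cat => /orP[] ->; rewrite ?orbT.
have hb' : path (bwd s' p) z Lb.
  apply: (sub_in_path (P := fun x => (x != y)) (e := bwd s p)) hb.
    by move=> u v _ nv huv; apply: kc.
  apply/allP => x ix; apply: contraNneq ny => <-.
  by move: ix; rewrite !inE mem_cat => /orP[] ->; rewrite ?orbT.
exists s'; split=> //; case: H => [[h1 h2]|[h1 [u [h2 h3 h4 h5]]]]; [left|right]; split=> //.
exists u; split; last first.
  move=> w' Lf' e; apply: h5.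
    by apply: nb; rewrite e !inE mem_cat !inE eqxx !orbT.
  have : uniq [:: w', y, z, w & Lb ++ Lf'].
    rewrite -(perm_uniq (s1 := [:: y, z, w & Lb ++ Lf])) // e.
    by perm_list.
  by case/andP; rewrite !inE !negb_or => /and4P[-> -> -> _] _.
have pz : perm_eq [:: w, z & Lb ++ Lf] [:: z, w & Lb ++ Lf] by perm_list.
split=> //; first by rewrite /= hb' andbT.
rewrite cons_uniq (perm_uniq pz) hu' andbT (perm_mem pz); apply/negP => iu.
have uy : u = y.
  apply: h4; apply: nb; move: iu; rewrite !in_cons !mem_cat in_cons.
  by case/or4P => ->; rewrite ?orbT.
by move: ny; rewrite -uy iu.
Qed.

End Fans.

(** * The rotation at a vertex, cut at its reflex angle *)

Section FullFan.
Variable V : finType.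
Implicit Types (o t : tri V) (s : state V) (u v w x y z p a b c : V) (e : V * V) (q : quad V) (Lb Lf : seq V).

Lemma reflex_unique o s p x x' : ppt o s ->
  (x, p) \in reflex_darts o s -> (x', p) \in reflex_darts o s -> x = x'.
Proof.
move=> hs; have := ppt_uniq hs; rewrite /verts cat_uniq => /and3P[uo /hasPn dis uh].
have mo y : (y, p) \in outer_darts o -> p \in [:: o.1.1; o.1.2; o.2].
  by case: (o) => [[a b] c]; rewrite !inE => /or3P[] /eqP[_ ->]; rewrite eqxx ?orbT.
have mh y q : (y, p) = (quad_reflex q).1 -> p = head_of q.
  by case: q => [[[r a] b] c] [].
have no y q : q \in s.2 -> (y, p) = (quad_reflex q).1 -> p \notin [:: o.1.1; o.1.2; o.2].
  by move=> iq /mh e; apply: dis; rewrite e map_f.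
rewrite !mem_cat => /orP[h1|/mapP[q iq e]] /orP[h2|/mapP[q' iq' e']].
- move: uo h1 h2; case: (o) => [[a b] c] /= /andP[]; rewrite !inE negb_or.
  move=> /andP[/eqP n1 /eqP n2] /andP[/eqP n3 _].
  by case/or3P => /eqP[-> e1]; case/or3P => /eqP[-> e2] //; congruence.
- by have := no _ _ iq' e'; rewrite (mo _ h1).
- by have := no _ _ iq e; rewrite (mo _ h2).
- have eq : q = q' by apply: (map_uniq_inj uh) => //; rewrite -(mh _ _ e) -(mh _ _ e').
  by move: e'; rewrite -eq -e => -[].
Qed.

Lemma corner_cases o s (c : tri V) : c \in corners o s ->
  [\/ c \in convex s.2, c \in tri_corners s.1 | c.1 \in reflex_darts o s].
Proof.
rewrite mem_corners; case/or3P => [h|h|/hasP[q iq]].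
- by constructor 3; rewrite mem_cat; apply/orP; left; apply: map_f.
- by constructor 2.
- rewrite inE => /orP[/eqP->|h]; last by constructor 1; apply/convexP; exists q.
  by constructor 3; rewrite mem_cat; apply/orP; right; apply/mapP; exists q.
Qed.

(** The identity outside the neighbours of [p] makes the rotation injective on all vertices. *)
Definition next o s p u : V := if [pick v | (u, p, v) \in corners o s] is Some v then v else u.

Section Next.
Variables (o : tri V) (s : state V) (p : V).
Hypothesis hs : ppt o s.

Lemma next_corner u v : (u, p, v) \in corners o s -> next o s p u = v.
Proof.
move=> h; rewrite /next; case: pickP => [w hw|/(_ v)]; last by rewrite h.
exact: (corner_succ hs hw h).
Qed.

Lemma next_dart u : (u, p) \in darts o s -> (u, p, next o s p u) \in corners o s.
Proof. by case/dart_corner => w hw; rewrite (next_corner hw). Qed.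

Lemma next_id u : (u, p) \notin darts o s -> next o s p u = u.
Proof. by move=> h; rewrite /next; case: pickP => // w /corner_dart hw; rewrite hw in h. Qed.

Lemma next_inj : injective (next o s p).
Proof.
have aux u v : (u, p) \in darts o s -> next o s p u = next o s p v -> u = v.
  move=> hu e; have hc := next_dart hu.
  case: (boolP ((v, p) \in darts o s)) => hv.
    by have hc' := next_dart hv; rewrite -e in hc'; exact: (corner_pred hs hc hc').
  rewrite (next_id hv) in e; rewrite e in hc; case/negP: hv.
  by rewrite (dart_sym hs); exact: (corner_out hs hc).
move=> u v e; case: (boolP ((u, p) \in darts o s)) => hu; first exact: aux.
case: (boolP ((v, p) \in darts o s)) => hv; first by apply/esym/aux.
by rewrite -(next_id hu) -(next_id hv).
Qed.

Lemma next_connect u v : (u, p) \in darts o s -> (v, p) \in darts o s -> fconnect (next o s p) u v.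
Proof.
move=> hu hv; have := valid_rot (ppt_valid hs) (P := fconnect (next o s p) u) _ hu hv.
by rewrite connect0 => <- // a b /next_corner <-; apply: same_fconnect1_r; exact: next_inj.
Qed.

End Next.

(** Started at [y], the rotation ends at [z], because [(z, p, y)] is an angle of the triangle. All
    other angles at [p] are convex except the unique reflex one, at position [j]; cutting there
    leaves two runs of convex angles. *)
Lemma full_fan o s p y z : ppt o s -> s.1 \in tri_corners (p, y, z) ->
  exists Lb Lf, [/\ fan s p z y Lb Lf, (last y Lf, p) \in reflex_darts o s,
    (last y Lf, p, last z Lb) \in corners o s &
    forall u, (u, p) \in darts o s -> u \in z :: y :: Lb ++ Lf].
Proof.
move=> hs ht; have [c1 c2 c3] := tri_pyz_corners o ht; have [t1 t2 t3] := tri_pyz ht.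
pose f := next o s p; have fc u v : (u, p, v) \in corners o s -> f u = v by exact: next_corner.
have fd := next_dart hs (p := p); rewrite -/f in fd; have finj : injective f := next_inj hs.
have yp : (y, p) \in darts o s by rewrite (dart_sym hs); exact: (corner_dart c1).
have orb u : (u, p) \in darts o s -> fconnect f y u by exact: next_connect.
have itd i : (iter i f y, p) \in darts o s.
  elim: i => //= i IH; rewrite (dart_sym hs); exact: (corner_out hs (fd _ IH)).
have [x hx] : exists x, (x, p) \in reflex_darts o s.
  by apply: reflex_dart; apply: (ppt_verts hs (v := y)); rewrite (dart_sym hs).
set m := order f y; have m_gt0 : 0 < m by exact: order_gt0.
have um : uniq (traject f y m) := orbit_uniq f y.
have fz : f z = y := fc _ _ c3.
have ez : z = iter m.-1 f y.
  by apply: (finj); rewrite fz -iterS prednK // (iter_order finj).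
have xdart := reflex_dart_mem hx.
pose j := findex f y x.
have et : iter j f y = x := iter_findex (orb _ xdart).
have jm : j < m := findex_max (orb _ xdart).
have inj_it i k : i < m -> k < m -> iter i f y = iter k f y -> i = k.
  move=> hi hk e; apply/eqP; rewrite -(nth_uniq y _ _ um) ?size_traject //.
  by rewrite !nth_traject // e.
have conv i : i.+1 < m -> i != j -> (iter i f y, p, iter i.+1 f y) \in convex s.2.
  move=> hi nij; have := fd _ (itd i); rewrite -iterS => /corner_cases[//|h|h].
    have : (iter i f y, p) \in tri_darts s.1 by exact: (map_f fst h).
    rewrite (perm_mem (perm_map fst (perm_tri_corners ht))) !inE !xpair_eqE.
    have [n1 n2 n3] := tri_pyz_neq hs ht.
    rewrite eqxx (negbTE n1) (eq_sym p z) (negbTE n3) !andbF andbT /= => /eqP e.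
    rewrite ez in e; have := inj_it i m.-1 (ltnW hi) _ e; rewrite prednK // leqnn => /(_ isT) ei.
    by move: hi; rewrite ei prednK // ltnn.
  case/negP: nij; apply/eqP; apply: inj_it; rewrite ?(ltnW hi) // et.
  exact: (reflex_unique hs h hx).
have jm1 : j < m.-1.
  rewrite -ltnS prednK // ltn_neqAle jm andbT; apply/negP => /eqP e.
  have et' : x = z by rewrite ez -et; congr iter; rewrite -e.
  by have := tri_not_reflex hs t3; rewrite /= -et' hx.
pose Lf := traject f (f y) j.
(* [M] covers the positions from j + 1 to m - 2, as [z] has position m - 1. It is empty when the
   reflex angle is the one just before [z]. *)
pose M := traject f (iter j.+1 f y) (m.-1 - j.+1).
have lastLf : last y Lf = x by rewrite last_traject.
have eM : rcons M z = traject f (iter j.+1 f y) (m - j.+1).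
  by rewrite -{1}(prednK m_gt0) subSn // trajectSr /M -iterD subnK // -ez.
have split_orbit : traject f y m = y :: Lf ++ rcons M z.
  by rewrite eM -cat_cons -trajectS -trajectD subnKC.
exists (rev M), Lf.
have pz : perm_eq (z :: y :: rev M ++ Lf) (traject f y m).
  rewrite split_orbit -cats1; have /permP hp : perm_eq (rev M) M by rewrite perm_rev.
  apply/permP => a; rewrite /= !count_cat hp /= addn0 -!plusE; ring.
split.
- split=> //.
  + apply/(pathP y) => i; rewrite size_traject => hi.
    have -> : nth y (y :: Lf) i = iter i f y.
      by rewrite -[y :: Lf]trajectS nth_traject // ltnW.
    rewrite (set_nth_default (f y)) ?size_traject // nth_traject // -iterSr; apply: conv; last by rewrite neq_ltn hi.
    exact: leq_ltn_trans hi jm.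
  + have eS : m - j.+1 = (m - j.+2).+1 by rewrite -subSn // -(prednK m_gt0) ltnS.
    have hM : path (fwd s p) (iter j.+1 f y) (behead (rcons M z)).
      rewrite (_ : behead _ = traject f (iter j.+2 f y) (m - j.+2)); last first.
        by rewrite eM eS.
      apply/(pathP y) => i; rewrite size_traject => hi.
      have hi' : i < (m - j.+2).+1 by apply: leqW.
      have -> : nth y (iter j.+1 f y :: traject f (iter j.+2 f y) (m - j.+2)) i = iter (i + j.+1) f y.
        rewrite -[iter j.+1 f y :: _]/(traject f (iter j.+1 f y) (m - j.+2).+1).
        by rewrite (set_nth_default (iter j.+1 f y)) ?size_traject // nth_traject // iterD.
      rewrite (set_nth_default (iter j.+2 f y)) ?size_traject // nth_traject // -iterD (addnS i j.+1); apply: conv; last by rewrite neq_ltn addnS ltnS leq_addl orbT.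
      by move: hi; rewrite ltn_subRL addnC !addnS.
    have eb : rcons M z = iter j.+1 f y :: behead (rcons M z).
      by rewrite eM eS.
    move: (behead (rcons M z)) eb hM => l; rewrite lastI => /rcons_inj[eM' ez'] hl.
    by rewrite eM' {1}ez' rev_path (eq_path (e' := fwd s p)).
  + by rewrite (perm_uniq pz).
- by rewrite lastLf.
- have := fd x xdart; rewrite lastLf => hc.
  suff -> : last z (rev M) = f x by [].
  have eS : m - j.+1 = (m - j.+2).+1 by rewrite -subSn // -(prednK m_gt0) ltnS.
  have h0 k l : rcons M z = k :: l -> last z (rev M) = k.
    by case: (M) => [[->]|k' M' [->]] //; rewrite rev_cons last_rcons.
  by apply: (h0 _ (traject f (iter j.+2 f y) (m - j.+2))); rewrite eM eS trajectS /= et.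
- move=> u /orb hu; rewrite (perm_mem pz); move: hu; rewrite fconnect_orbit.
  by [].
Qed.

End FullFan.

(** * Walking the triangle along a path, and shrinking a fan *)

Section Approach.
Variable V : finType.
Implicit Types (o t : tri V) (s : state V) (u v w x y z p : V) (e : V * V) (q : quad V) (Lb Lf xs : seq V).

Definition adj_in o s : rel V := fun u v => (u, v) \in darts o s.

Lemma tri_vertsP t p : p \in tri_verts t -> exists y z, t \in tri_corners (p, y, z).
Proof.
case: t => [[x y] z]; rewrite !inE /= => /or3P[] /eqP->.
- by exists y, z; in_list.
- by exists z, x; in_list.
- by exists x, y; in_list.
Qed.

Lemma tri_verts_mirror t : tri_verts (mirror_tri t) =i tri_verts t.
Proof. by case: t => [[x y] z] v; rewrite !inE /= orbCA. Qed.

Lemma tri_verts_fan s p y z : s.1 \in tri_corners (p, y, z) -> tri_verts s.1 =i [:: p; y; z].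
Proof. exact: tri_verts_corners. Qed.

Lemma path_suffix (e : rel V) x xs v : v \in x :: xs -> path e x xs ->
  exists xs', [/\ path e v xs', last v xs' = last x xs & size xs' <= size xs].
Proof.
case/splitPl => xs1 xs2 <-; rewrite cat_path => /andP[_ h]; exists xs2.
by rewrite last_cat size_cat leq_addl.
Qed.

(* A path to the target that avoids the triangle survives every flip, as the removed edge belongs to the triangle. *)
Lemma rotate_to_path Lf : forall o s p z y Lb x xs, ppt o s -> fan s p z y Lb Lf ->
  x \in y :: Lf -> path (adj_in o s) x xs ->
  exists s' x' xs', [/\ within o (size Lf) s s', x' \in tri_verts s'.1,
    path (adj_in o s') x' xs', last x' xs' = last x xs & size xs' <= size xs].
Proof.
elim: Lf => [|w Lf IH] o s p z y Lb x xs hs hf hx hp.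
  move: hx; rewrite inE => /eqP ex; subst x; exists s, y, xs; split=> //; first exact: within_refl.
  by case: hf => ht _ _ _; rewrite (tri_verts_fan ht) !inE eqxx orbT.
case: (boolP (has (fun v => v \in tri_verts s.1) (x :: xs))) => [/hasP[v iv hv]|/hasPn hn].
  have [xs' [h1 h2 h3]] := path_suffix iv hp.
  by exists s, v, xs'; split=> //; apply: within_leq (leq0n _) (within_refl _ _ _).
have [s1 [st kd H]] := fan_advance hs hf.
have hs1 := ppt_step st hs.
have ht : s.1 \in tri_corners (p, y, z) by case: hf.
have hp1 : path (adj_in o s1) x xs.
  apply: (sub_in_path (P := fun v => v \notin tri_verts s.1) (e := adj_in o s)) hp; last exact/allP.
  by move=> u v nu _ huv; apply: kd => //=; rewrite -(tri_verts_fan ht).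
have hx1 : x \in w :: Lf.
  move: hx (hn x (mem_head _ _)); rewrite inE => /predU1P[->|//].
  by rewrite (tri_verts_fan ht) !inE eqxx orbT.
have [Lb' [z' hf']] : exists Lb' z', fan s1 p z' w Lb' Lf.
  by case: H => [[_ h]|[_ [u [h _]]]]; [exists Lb, z|exists (z :: Lb), u].
have [s2 [x' [xs' [k1 k2 k3 k4 k5]]]] := IH _ _ _ _ _ _ _ _ hs1 hf' hx1 hp1.
by exists s2, x', xs'; split=> //; exact: (within_trans (within_step st) k1).
Qed.

Lemma size_fan s p z y Lb Lf : fan s p z y Lb Lf -> size Lb + size Lf < #|V|.
Proof.
case=> _ _ _ u; have := card_uniqP u; have := max_card (mem [:: z, y & Lb ++ Lf]).
by rewrite /= size_cat => h1 h2; apply: leq_trans h1; rewrite h2.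
Qed.

(** The next vertex of the path lies in one of the two halves of the fan, which decides the
    direction of the turn. Within fewer than [#|V|] flips the triangle meets the remaining path,
    which may by then have lost an initial part; so the path gets shorter at every turn. *)
Lemma approach n : forall o s x xs, ppt o s -> x \in tri_verts s.1 -> path (adj_in o s) x xs -> size xs <= n ->
  exists2 s', within o (n * #|V|) s s' & last x xs \in tri_verts s'.1.
Proof.
elim: n => [|n IH] o s p xs hs hp hpath hn.
  by case: xs hn hpath => // _ _; exists s => //; apply: within_refl.
case: xs hn hpath => [|x xs] hn; first by exists s => //; apply: within_leq (leq0n _) (within_refl _ _ _).
rewrite [path _ _ _]/= => /andP[hpx hpath].
have [y [z ht]] := tri_vertsP hp.
have [Lb [Lf [hf _ _ all]]] := full_fan hs ht.
have hx : x \in [:: z, y & Lb ++ Lf] by apply: all; rewrite (dart_sym hs).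
have sz := size_fan hf.
suff [s1 [x' [xs' [k1 k2 k3 k4 k5]]]] : exists s1 x' xs', [/\ within o #|V| s s1, x' \in tri_verts s1.1,
    path (adj_in o s1) x' xs', last x' xs' = last x xs & size xs' <= size xs].
  have [s2 h1 h2] := IH _ _ _ _ (within_ppt k1 hs) k2 k3 (leq_trans k5 hn).
  by exists s2; [rewrite mulSn; apply: within_trans k1 h1|rewrite /= -k4].
case: (boolP (x \in y :: Lf)) => hx'.
  have [s1 [x' [xs' [k1 k2 k3 k4 k5]]]] := rotate_to_path hs hf hx' hpath.
  exists s1, x', xs'; split=> //; apply: within_leq k1.
  by apply: leq_trans (ltnW sz); apply: leq_addl.
have hx2 : x \in z :: Lb.
  by move: hx hx'; rewrite !inE mem_cat => /or4P[] ->; rewrite ?orbT.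
have hmpath : path (adj_in (mirror_tri o) (mirror s)) x xs.
  by rewrite (eq_path (e' := adj_in o s)) // => u v; rewrite /adj_in darts_mirror (dart_sym hs).
have [s1 [x' [xs' [k1 k2 k3 k4 k5]]]] := rotate_to_path (ppt_mirror hs) (fan_mirror hf) hx2 hmpath.
have hs1 := within_ppt k1 (ppt_mirror hs).
exists (mirror s1), x', xs'; split=> //.
- have := within_mirror k1; rewrite mirror_triK mirrorK; apply: within_leq.
  by apply: leq_trans (ltnW sz); apply: leq_addr.
- by rewrite tri_verts_mirror.
- rewrite (eq_path (e' := adj_in (mirror_tri o) s1)) // => u v; rewrite /adj_in.
  have := darts_mirror (mirror_tri o) s1; rewrite mirror_triK => ->.
  by rewrite (dart_sym hs1).
Qed.

(** A blocked flip keeps the size of the fan, but the flip after it goes through and reduces it.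
    This second flip needs a further neighbour, hence the alternative in the hypothesis. *)
Lemma fan_shrink o s p z y Lb w Lf : ppt o s -> fan s p z y Lb (w :: Lf) ->
  ((w, z) \notin darts o s \/ Lf <> [::]) ->
  exists s' z' y' Lb' Lf', [/\ within o 2 s s', fan s' p z' y' Lb' Lf',
    size Lb' + size Lf' < size Lb + (size Lf).+1, last y' Lf' = last w Lf & last z' Lb' = last z Lb].
Proof.
move=> hs hf hor; have [s1 [st _ H]] := fan_advance hs hf.
case: H => [[h1 h2]|[h1 [u [h2 h3]]]].
  exists s1, z, w, Lb, Lf; split=> //; last by rewrite addnS.
  by apply: within_leq (within_step st).
case: Lf hf hor h2 h3 => [|w' Lf] hf hor h2 h3; first by case: hor; [rewrite h1|].
have hs1 := ppt_step st hs.
have [s2 [st2 _ H2]] := fan_advance hs1 h2.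
case: H2 => [[k1 k2]|[k1 _]]; last first.
  by have := h3 _ _ erefl; rewrite (dart_sym hs1) k1.
exists s2, u, w', (z :: Lb), Lf; split=> //.
- exact: within_trans (within_step st) (within_step st2).
- by rewrite /= !addnS addSn.
Qed.

(** The 3-cycle p, z, w that blocks the forward flip separates [y] from [w2], so the edge of the
    backward flip is free. *)
Lemma fan_cross o s p z y w2 Lb w Lf : ppt o s -> fan s p z y (w2 :: Lb) (w :: Lf) ->
  (w, z) \in darts o s -> (y, w2) \notin darts o s.
Proof.
move=> hs hf hwz; have nb := fan_nbr hs hf; case: hf => ht /= /andP[hw _] _ hu.
have [q [u [iq hqr hcq hh un]]] := convex_qrot hs hw.
have [_ H] := blocked hs ht iq hcq hwz.
have [n1 n2 n3] := ypw_neq hs iq hcq.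
have [m1 m2 m3] := tri_pyz_neq hs ht.
have uy : (u, y) \in quad_darts q.
  by apply/mapP; exists (u, y, p) => //; rewrite (qrot_corners hqr) !inE eqxx !orbT.
have ny : y \notin [:: p; z; w] by rewrite !inE !negb_or n1 m2 n3.
have [_ H2] := H y u uy ny; apply: H2; first by apply: nb; in_list.
have : uniq [:: w2, y, z, w & Lb ++ Lf].
  rewrite -(perm_uniq (s1 := [:: z, y, w2 & Lb ++ w :: Lf])) //.
  by perm_list.
by case/andP; rewrite !inE !negb_or => /and4P[-> -> -> _] _.
Qed.

End Approach.

(** * Reduction to nested states *)

Section Peel.
Variable V : finType.
Implicit Types (o t : tri V) (s : state V) (R : seq (quad V)) (u v w x y z a b c : V) (d e : V * V) (q : quad V) (Lb Lf : seq V).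

Lemma outer_not_head a b c s q v : ppt (a, b, c) s -> q \in s.2 -> v \in [:: a; b; c] -> head_of q != v.
Proof.
move=> hs iq hv; have := ppt_uniq hs; rewrite /verts cat_uniq => /and3P[_ /hasPn h _].
by apply: contraTneq hv => <-; apply: h; apply: map_f.
Qed.

(** The vertex [c] now has degree two. The triangle has to meet [v] because [v] takes the role of
    [c] once [c] is peeled off. *)
Definition cut a b c s := exists2 v, v \in tri_verts s.1 & (v, a, c, b) \in s.2.

(** Here [c] has the neighbours [a], [y], [b], and the usual flip is blocked by the outer edge ab.
    The reflex vertex of the quadrilateral y, c, b, u is [u] or [y], since [c] and [b] are outer;
    the first case inserts ua, the second by, and either way the face left at [c] is the desired
    one. *)
Lemma cut_last a b c s y : ppt (a, b, c) s -> s.1 \in tri_corners (c, y, a) -> (y, c, b) \in convex s.2 ->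
  exists2 s', step (a, b, c) s s' & cut a b c s'.
Proof.
move=> hs ht hc; have [q [u [iq hqr hcq hh un]]] := convex_qrot hs hc; rewrite /= in un.
have hR := perm_to_rem iq; set R := rem q s.2 in hR.
have [nyc ncb nyb] := ypw_neq hs iq hcq.
have [ncy nya nac] := tri_pyz_neq hs ht.
have [c1 c2 c3] := tri_pyz_corners (a, b, c) ht.
have [t1 t2 t3] := tri_pyz ht.
have hb : head_of q != b by apply: (outer_not_head hs iq); in_list.
have hab : (a, b) \in darts (a, b, c) s by apply: outer_dart_mem; in_list.
have hbc : (b, c) \in outer_darts (a, b, c) by in_list.
have qd d : d \in quad_darts q -> d \in darts (a, b, c) s by exact: quad_dart_mem.
have qm k l m : (k, l, m) \in [:: (y, c, b); (c, b, u); (b, u, y); (u, y, c)] -> (k, l) \in quad_darts q.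
  by rewrite -(qrot_corners hqr) => h; exact: (map_f fst h).
have [hu|hu] := eqVneq (head_of q) u.
  have nua : u != a by rewrite -hu; apply: (outer_not_head hs iq); in_list.
  (* An edge ua would close the 3-cycle a, u, b. Since [c] is off this cycle and on the outer face,
     all faces at [c] would be outside, but the inner triangle is one of them. *)
  have nau : (u, a) \notin darts (a, b, c) s.
    apply/negP => hua.
    have hub : (u, b) \in darts (a, b, c) s by rewrite (dart_sym hs) qd // (qm _ _ y) // !inE eqxx !orbT.
    have hau : (a, u) \in darts (a, b, c) s by rewrite (dart_sym hs).
    have hba : (b, a) \in darts (a, b, c) s by rewrite (dart_sym hs).
    have [S [hS hB hO hT]] := cycle_inside hs hau hub hba.
    have nc : c \notin [:: a; u; b].
      by move: un; rewrite !inE !negb_or (eq_sym c a) nac => /and4P[_ /andP[-> ->]].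
    have hac := corner_dart c3.
    have := side_around hs hS hB nc (outer_dart_mem s hbc) hac.
    rewrite (hO _ _ hbc) hT //; exact: (map_f fst t3).
  have hy : head_of q != y.
    rewrite hu; move: un => /and4P[]; rewrite !inE !negb_or => /and3P[_ _ n _] _ _.
    by rewrite eq_sym.
  have [q' hq' [hh' [st _]]] := flip_y hs ht hqr hR hy (nonadjI hs nua nau).
  exists ((u, y, a), q' :: R) => //; exists u; first in_list.
  suff -> : (u, a, c, b) = q' by rewrite mem_head.
  move: hq' hh'; rewrite hu !inE; case/or4P => /eqP-> //= e.
  - by case/eqP: hh; rewrite hu -e.
  - by case/eqP: hb; rewrite hu -e.
  - by case/eqP: nua; rewrite -e.
(* An edge by would close the 3-cycle c, y, b. Across the outer edge bc the quadrilateral would be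
   inside, and so would the triangle; yet they lie on different sides of the cycle edge cy. *)
have nyb' : (b, y) \notin darts (a, b, c) s.
  apply/negP => hby.
  have hyc : (y, c) \in darts (a, b, c) s by rewrite qd // (qm _ _ b) // !inE eqxx.
  have hcy : (c, y) \in darts (a, b, c) s by rewrite (dart_sym hs).
  have hyb : (y, b) \in darts (a, b, c) s by rewrite (dart_sym hs).
  have hbc' := outer_dart_mem s hbc.
  have [S [hS hB hO hT]] := cycle_inside hs hcy hyb hbc'.
  have Scb : S c b.
    by rewrite (hB _ _ hbc') (hO _ _ hbc) !inE eqxx !orbT.
  have Syc : S y c.
    rewrite (quad_const hS iq (qm _ _ b _)) ?inE ?eqxx //.
    by rewrite -(quad_const hS iq (qm c b u _)) // !inE eqxx orbT.
  have := hT c y (map_f fst t1); rewrite (hB _ _ hyc) Syc !inE eqxx ?orbT //.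
have nby : b != y by rewrite eq_sym.
have [q' hq' [hh' [st _]]] := flip_u hs ht hqr hR hu (nonadjI hs nby nyb').
exists ((b, u, y), q' :: R) => //; exists y; first in_list.
suff -> : (y, a, c, b) = q' by rewrite mem_head.
have hy : head_of q = y.
  by move: hqr; rewrite !inE => /or4P[] /eqP e; move: hh hb hu; rewrite e //= eqxx.
move: hq' hh'; rewrite hy !inE; case/or4P => /eqP-> //= e.
- by case/eqP: ncy.
- by case/eqP: nby.
- by case/eqP: nya.
Qed.

(** Each outer vertex has degree two, so by connectivity there are no other vertices. *)
Lemma no_quads a b c s : ppt (a, b, c) s -> s.1 \in tri_corners (c, b, a) -> s.2 = [::].
Proof.
move=> hs ht; have [c1 c2 c3] := tri_pyz_corners (a, b, c) ht.
have o1 : (a, b, c) \in corners (a, b, c) s by apply: outer_corner_mem; in_list.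
have o2 : (b, c, a) \in corners (a, b, c) s by apply: outer_corner_mem; in_list.
have o3 : (c, a, b) \in corners (a, b, c) s by apply: outer_corner_mem; in_list.
have cl x y : x \in [:: a; b; c] -> (y, x) \in darts (a, b, c) s -> y \in [:: a; b; c].
  rewrite !inE => /or3P[] /eqP-> h.
  - by have := degree_two hs o3 c2 h; case/orP => ->; rewrite ?orbT.
  - by have := degree_two hs o1 c1 h; case/orP => ->; rewrite ?orbT.
  - by have := degree_two hs o2 c3 h; case/orP => ->; rewrite ?orbT.
case E : s.2 => [//|q qs]; exfalso.
have iq : q \in s.2 by rewrite E mem_head.
have nq : head_of q \notin [:: a; b; c].
  by rewrite !inE !negb_or !(outer_not_head hs iq) // !inE eqxx ?orbT.
have hcl x y : (x, y) \in darts (a, b, c) s -> (x \in [:: a; b; c]) = (y \in [:: a; b; c]).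
  move=> h; apply/idP/idP => hx; last exact: cl hx h.
  by apply: cl hx _; rewrite (dart_sym hs).
have hv : head_of q \in verts (a, b, c) s by rewrite /verts mem_cat map_f // orbT.
have := ppt_const hs (G := fun v => v \in [:: a; b; c]) hcl (mem_head _ _) hv.
by rewrite (negbTE nq) mem_head.
Qed.

Lemma cut_mirror a b c s : cut b a c (mirror s) -> cut a b c s.
Proof.
case=> v h1 h2; exists v; first by move: h1; rewrite tri_verts_mirror.
case/mapP: h2 => -[[[r x] y] z] hq [-> -> -> ->] //.
Qed.

(** The fan at [c] runs from [a] to [b] and shrinks from either side, at two flips for each
    neighbour lost. It is stuck only if each of its lists is empty or one blocked neighbour. Both
    empty would leave no quadrilateral, both blocked contradicts [fan_cross], and in the mixed case
    [cut_last] finishes, which accounts for the [+ 1]. *)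
Lemma cut_corner m : forall a b c s z y Lb Lf, ppt (a, b, c) s -> fan s c z y Lb Lf ->
  last y Lf = b -> last z Lb = a -> s.2 <> [::] -> size Lb + size Lf <= m ->
  exists2 s', within (a, b, c) (2 * m + 1) s s' & cut a b c s'.
Proof.
have main a b c s z y Lb Lf n : ppt (a, b, c) s -> fan s c z y Lb Lf ->
    last y Lf = b -> last z Lb = a -> s.2 <> [::] -> size Lb + size Lf <= n ->
    (exists s' z' y' Lb' Lf', [/\ within (a, b, c) 2 s s', fan s' c z' y' Lb' Lf',
      size Lb' + size Lf' < n, last y' Lf' = b & last z' Lb' = a]) \/
    (Lf = [::]) \/ (exists2 w, Lf = [:: w] & (w, z) \in darts (a, b, c) s).
  move=> hs hf lf lb ns hn; case: Lf hf lf hn => [|w Lf] hf lf hn; first by right; left.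
  case: (boolP ((w, z) \in darts (a, b, c) s)) => hwz; last first.
    have [s' [z' [y' [Lb' [Lf' [k1 k2 k3 k4 k5]]]]]] := fan_shrink hs hf (or_introl hwz).
    left; exists s', z', y', Lb', Lf'; split=> //; last by rewrite k5.
    - exact: leq_trans k3 hn.
    - by rewrite k4.
  case: Lf hf lf hn => [|w' Lf] hf lf hn; first by right; right; exists w.
  have hor : (w, z) \notin darts (a, b, c) s \/ w' :: Lf <> [::] by right.
  have [s' [z' [y' [Lb' [Lf' [k1 k2 k3 k4 k5]]]]]] := fan_shrink hs hf hor.
  left; exists s', z', y', Lb', Lf'; split=> //; last by rewrite k5.
  - exact: leq_trans k3 hn.
  - by rewrite k4.
have noq a b c s s' k : within (a, b, c) k s s' -> s.2 <> [::] -> s'.2 <> [::].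
  move/within_verts/perm_size; rewrite /verts /= !size_map => -[e] n e2.
  by apply: n; apply: size0nil; rewrite -e e2.
elim: m => [|m IH] a b c s z y Lb Lf hs hf lf lb ns hm.
  case: Lb Lf lf lb hm hf => [|k Lb] [|k' Lf] //= lf lb _ hf; subst.
  by case: hf => ht _ _ _; case: ns; apply: no_quads ht.
have [[s1 [z' [y' [Lb' [Lf' [k1 k2 k3 k4 k5]]]]]]|H1] := main _ _ _ _ _ _ _ _ _ hs hf lf lb ns hm.
  have [s2 h1 h2] := IH _ _ _ _ _ _ _ _ (within_ppt k1 hs) k2 k4 k5 (noq _ _ _ _ _ _ k1 ns) k3.
  exists s2 => //; rewrite mulnS -addnA; exact: within_trans k1 h1.
have nsm : (mirror s).2 <> [::] by rewrite /mirror /=; case: (s.2) ns.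
have hmm : size Lf + size Lb <= m.+1 by rewrite addnC.
have [[s1 [z' [y' [Lb' [Lf' [k1 k2 k3 k4 k5]]]]]]|H2] :=
  main b a c _ _ _ _ _ _ (ppt_mirror hs) (fan_mirror hf) lb lf nsm hmm.
  have hs1 := within_ppt k1 (ppt_mirror hs).
  have [s2 h1 h2] := IH _ _ _ _ _ _ _ _ hs1 k2 k4 k5 (noq _ _ _ _ _ _ k1 nsm) k3.
  exists (mirror s2); last by apply: cut_mirror; rewrite mirrorK.
  have := within_mirror (within_trans k1 h1); rewrite mirrorK /mirror_tri /=.
  by apply: within_leq; rewrite mulnS addnA.
case: H1 => [e1|[w e1 hw]]; case: H2 => [e2|[w2 e2 hw2]]; subst.
- by case: hf => ht _ _ _; case: ns; apply: no_quads ht.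
- move: (fan_mirror hf) => /= [ht /andP[hc _] _ _].
  have [s1 st hc1] := cut_last (ppt_mirror hs) ht hc.
  exists (mirror s1); last by apply: cut_mirror; rewrite mirrorK.
  have := within_mirror (within_step st); rewrite mirrorK /mirror_tri /=.
  by apply: within_leq; lia.
- case: hf => ht /= /andP[hc _] _ _.
  have [s1 st hc1] := cut_last hs ht hc.
  by exists s1 => //; apply: within_leq (within_step st); lia.
- have := fan_cross hs hf hw; move: hw2.
  by have := darts_mirror (w2, w, c) s w2 y; rewrite /mirror_tri /= => -> ->.
Qed.

End Peel.

(** * Peeling off an outer vertex and lifting flips back *)

Section Inner.
Variable V : finType.
Implicit Types (t : tri V) (s : state V) (R : seq (quad V)) (u v w x y z p a b c : V) (d e : V * V) (q : quad V) (l : seq V).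

Lemma perm_inner_darts a b c v t R : perm_eq (darts (a, b, c) (t, (v, a, c, b) :: R))
  ([:: (c, a); (b, c); (a, c); (c, b)] ++ darts (a, b, v) (t, R)).
Proof.
rewrite /darts /corners /quads_corners [map quad_corners _]/= [flatten _]/= !map_cat; perm_list.
Qed.

Lemma perm_inner_verts a b c v t R :
  perm_eq (verts (a, b, c) (t, (v, a, c, b) :: R)) (c :: verts (a, b, v) (t, R)).
Proof. by rewrite /verts /=; perm_list. Qed.

(* Deleting the edge bc merges the outer face and the quadrilateral; then c is a pendant vertex at a. *)
Lemma ppt_inner a b c v t R : ppt (a, b, c) (t, (v, a, c, b) :: R) -> ppt (a, b, v) (t, R).
Proof.
move=> hs; have hv := perm_inner_verts a b c v t R; set C := tri_corners t ++ quads_corners R.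
have v1 : valid [:: (a, c, b), (b, c, a), (c, a, b), (a, b, c), (c, b, v) & [:: (v, a, c), (b, v, a) & C]].
  apply: valid_perm (ppt_valid hs); rewrite /corners /C /quads_corners [map _ _]/= [flatten _]/=; perm_list.
have v2 : valid [:: (v, a, c), (a, c, a), (c, a, b) & [:: (a, b, v), (b, v, a) & C]].
  by apply: valid_perm (valid_del_chord v1); perm_list.
have [v3 nc] := valid_del_pendant v2.
have p3 : perm_eq [:: (v, a, b), (a, b, v), (b, v, a) & C] (corners (a, b, v) (t, R)).
  by rewrite /corners /C; perm_list.
split; first exact: valid_perm p3 v3.
  by have := ppt_uniq hs; rewrite (perm_uniq hv) cons_uniq => /andP[].
move=> x y hxy; have := @ppt_verts _ _ _ hs x y; rewrite (perm_mem hv) (perm_mem (perm_inner_darts a b c v t R)).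
rewrite mem_cat hxy orbT inE => /(_ isT)/predU1P[e|//]; case/negP: (nc y).
by rewrite (perm_mem (perm_map fst p3)) -e.
Qed.

Lemma inner_notin a b c v t R : ppt (a, b, c) (t, (v, a, c, b) :: R) -> c \notin verts (a, b, v) (t, R).
Proof. by move/ppt_uniq; rewrite (perm_uniq (perm_inner_verts a b c v t R)) => /andP[]. Qed.

Definition add_quad q s : state V := (s.1, q :: s.2).

(** All additional darts meet [c], while both edges of the flip join vertices of the inner state, so
    non-adjacency is preserved. *)
Lemma step_lift a b c v s s' : ppt (a, b, v) s -> c \notin verts (a, b, v) s ->
  step (a, b, v) s s' -> step (a, b, c) (add_quad (v, a, c, b) s) (add_quad (v, a, c, b) s').
Proof.
move=> hs hc st; have hs' := ppt_step st hs.
have hc' : c \notin verts (a, b, v) s' by rewrite (perm_mem (perm_verts_step st)).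
case: st => P [i] [j] [R] [[h1 h2] [h3 h4] h5 h6].
have na r e : ppt (a, b, v) r -> c != e.1 -> c != e.2 ->
   nonadj (a, b, v) r e -> nonadj (a, b, c) (add_quad (v, a, c, b) r) e.
  move=> hr n1 n2 /and3P[k1 k2 k3].
  have md := perm_mem (perm_inner_darts a b c v r.1 r.2); rewrite -surjective_pairing in md.
  have mdd d : d \in darts (a, b, c) (add_quad (v, a, c, b) r) -> d.1 != c -> d.2 != c ->
     d \in darts (a, b, v) r.
    case: r {hr n1 n2 k1 k2 k3 md} => t Q; rewrite /add_quad /= (perm_mem (perm_inner_darts a b c v t Q)) mem_cat.
    by case/orP => //; rewrite !inE => /or4P[] /eqP->; rewrite /= eqxx.
  apply/and3P; split=> //; [apply: contra k2|apply: contra k3] => /mdd; apply; by rewrite //= eq_sym.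
have end_vert r k : ppt (a, b, v) r -> r.1 \in tri_corners (tip_tri P k) -> perm_eq r.2 (tip_quad P k :: R) ->
    forall k', (tip_edge P k').1 \in verts (a, b, v) r /\ (tip_edge P k').2 \in verts (a, b, v) r.
  move=> hr r1 r2 k'; have [w [w' [iw iw']]] := tip_edge_pent P k'.
  have sub d : d \in map fst (pent_corners P) -> d \in darts (a, b, v) r.
    by move=> h; rewrite (perm_mem (darts_tip _ r1 r2)) !in_cons map_cat mem_cat h !orbT.
  by split; [apply: (ppt_verts hr (sub _ iw))|apply: (ppt_verts hr (sub _ iw'))].
have ne k : c != (tip_edge P k).1 /\ c != (tip_edge P k).2.
  have [k1 k2] := end_vert s i hs h1 h2 k.
  by split; apply: contraNneq hc => ->.
exists P, i, j, ((v, a, c, b) :: R); split.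
- split=> //; rewrite /add_quad /=.
  rewrite -(perm_cons (v, a, c, b)) in h2; rewrite (permPl h2); perm_list.
- split=> //; rewrite /add_quad /=.
  rewrite -(perm_cons (v, a, c, b)) in h4; rewrite (permPl h4); perm_list.
- by apply: na => //; have [] := ne j.
- by apply: na => //; have [] := ne i.
Qed.

Lemma within_lift a b c v m s s' : ppt (a, b, v) s -> c \notin verts (a, b, v) s ->
  within (a, b, v) m s s' -> within (a, b, c) m (add_quad (v, a, c, b) s) (add_quad (v, a, c, b) s').
Proof.
move=> hs hc [k hk r]; exists k => //; elim: r hs hc {hk} => [x y h1 h2|k0 x y z st _ IH] hs hc.
  by apply: reach0; rewrite //= perm_cons.
apply: reachS (step_lift hs hc st) (IH (ppt_step st hs) _).
by rewrite (perm_mem (perm_verts_step st)).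
Qed.

(* Quadrilaterals (t_i; a, t_(i+1), b) with all t_i adjacent to a and b, the last one ending at e. *)
Fixpoint chain a b l (e : V) : seq (quad V) :=
  if l is t :: l' then (t, a, head e l', b) :: chain a b l' e else [::].

Definition nested a b c l : state V := ((b, a, head c l), chain a b l c).

Lemma chain_rcons a b l v (e : V) : chain a b (rcons l v) e = rcons (chain a b l v) (v, a, e, b).
Proof.
elim: l => //= x l ->; congr (_ :: _).
by case: l.
Qed.

Lemma chain_heads a b l (e : V) : map head_of (chain a b l e) = l.
Proof. by elim: l => //= x l ->. Qed.

Lemma nested_rcons a b c l v k s : within (a, b, c) k s (add_quad (v, a, c, b) (nested a b v l)) ->
  within (a, b, c) k s (nested a b c (rcons l v)).
Proof.
move=> h; rewrite -(addn0 k); apply: within_trans h _; exists 0 => //; apply: reach0 => /=.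
  by rewrite (_ : head c (rcons l v) = head v l) ?tri_corners_refl //; case: l.
by rewrite chain_rcons perm_sym perm_rcons.
Qed.

Lemma no_quads_tri a b c t : ppt (a, b, c) (t, [::]) -> t \in tri_corners (b, a, c).
Proof.
move=> hs; case: t hs => [[x y] z] hs.
have [n1 n2 n3] := tri_pyz_neq hs (tri_corners_refl (x, y, z)).
have u := uniq_darts hs.
have rv p w : (p, w) \in tri_darts (x, y, z) -> (w, p) \in outer_darts (a, b, c).
  move=> h; have : (w, p) \in darts (a, b, c) ((x, y, z), [::]).
    by rewrite (dart_sym hs); apply: tri_dart_mem.
  rewrite mem_darts => /or3P[//|h2|//]; exfalso; move: n1 n2 n3 => /eqP n1 /eqP n2 /eqP n3.
  by move: h h2; rewrite !inE => /or3P[] /eqP[k1 k2] /or3P[] /eqP[e1 e2]; congruence.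
have r1 := rv x y (mem_head _ _).
have r2 : (z, y) \in outer_darts (a, b, c) by apply: rv; in_list.
have := ppt_uniq hs; rewrite /verts /= !inE !negb_or => /andP[/andP[/eqP m1 /eqP m2] /andP[/eqP m3 _]].
move: r1 r2; rewrite !inE; case/or3P => /eqP[e1 e2]; case/or3P => /eqP[e3 e4]; subst; rewrite ?eqxx ?orbT //; congruence.
Qed.

(** After the peeling, [v] is the third outer vertex and belongs to the triangle, so the hypothesis
    on [c] is restored for the inner state. Each level costs at most one [cut_corner]. *)
Lemma normalize k : forall a b c s, ppt (a, b, c) s -> c \in tri_verts s.1 -> size s.2 = k ->
  exists l, within (a, b, c) (k * (2 * #|V| + 1)) s (nested a b c l).
Proof.
elim: k => [|k IH] a b c s hs hc hk.
  case: s hs {hc} hk => t [|//] hs _; exists [::]; apply: within_leq (leq0n _) _; exists 0 => //.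
  by apply: reach0 => //=; apply: tri_corners_sym; apply: no_quads_tri hs.
have [y [z ht]] := tri_vertsP hc.
have [Lb [Lf [hf h1 h2 _]]] := full_fan hs ht.
have bc : (b, c) \in reflex_darts (a, b, c) s by rewrite mem_cat !inE eqxx orbT.
have lf : last y Lf = b := reflex_unique hs h1 bc.
have lb : last z Lb = a.
  rewrite lf in h2; apply: (corner_succ hs h2).
  by apply: outer_corner_mem; in_list.
have ns : s.2 <> [::] by move=> e; rewrite e in hk.
have [s1 w1 [v v1 v2]] := cut_corner hs hf lf lb ns (ltnW (size_fan hf)).
have hs1 := within_ppt w1 hs.
have hR := perm_to_rem v2; set R := rem _ _ in hR.
pose s2 : state V := (s1.1, (v, a, c, b) :: R).
have w12 : within (a, b, c) 0 s1 s2 by exists 0 => //; apply: reach0; rewrite ?tri_corners_refl.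
have hs2 := within_ppt w12 hs1.
have hs3 := ppt_inner hs2; have nc := inner_notin hs2.
have hk' : size R = k.
  have := perm_size (within_verts w1); rewrite /verts /= !size_map (perm_size hR) /= hk.
  by case.
have [l wl] := IH _ _ _ _ hs3 v1 hk'.
exists (rcons l v); apply: nested_rcons.
have := within_trans w1 (within_trans w12 (within_lift hs3 nc wl)); rewrite add0n -mulSn.
by [].
Qed.

End Inner.

(** * Sorting nested states *)

Section Sorting.
Variable V : finType.
Implicit Types (o t : tri V) (s : state V) (R : seq (quad V)) (u v w x y p a b c e : V) (q : quad V) (l : seq V).

Lemma step_by P i j R o s s' :
  s.1 \in tri_corners (tip_tri P i) -> perm_eq s.2 (tip_quad P i :: R) ->
  s'.1 \in tri_corners (tip_tri P j) -> perm_eq s'.2 (tip_quad P j :: R) ->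
  nonadj o s (tip_edge P j) -> nonadj o s' (tip_edge P i) -> within o 1 s s'.
Proof. by move=> h1 h2 h3 h4 h5 h6; apply: within_step; exists P, i, j, R. Qed.

Lemma chain_darts x y l e u v : has (fun q => (u, v) \in quad_darts q) (chain x y l e) ->
  (u \in [:: x; y]) && (v \in rcons l e) || (v \in [:: x; y]) && (u \in rcons l e).
Proof.
elim: l => //= t l IH; case/orP => [|/IH]; last first.
  by rewrite !in_cons; case/orP => /andP[-> ->]; rewrite ?orbT.
have hh : head e l \in rcons l e by case: l {IH} => [|k l] /=; rewrite ?inE ?eqxx.
by rewrite !inE => /or4P[] /eqP[-> ->]; rewrite !eqxx ?hh ?orbT.
Qed.

Definition in_darts (o : tri V) (t : tri V) (qs : seq (quad V)) u v :=
  [|| (u, v) \in outer_darts o, (u, v) \in tri_darts t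
    | has (fun q => (u, v) \in quad_darts q) qs].

Lemma nonadj_chain o t qs x y l e u v : u != v -> ~~ in_darts o t qs u v -> ~~ in_darts o t qs v u ->
  ~~ ((u \in [:: x; y]) && (v \in rcons l e)) -> ~~ ((v \in [:: x; y]) && (u \in rcons l e)) ->
  nonadj o (t, qs ++ chain x y l e) (u, v).
Proof.
move=> n h1 h2 h3 h4; rewrite /nonadj /= n /swap !mem_darts /= !has_cat.
have -> : has (fun q => (u, v) \in quad_darts q) (chain x y l e) = false.
  by apply/negP => /chain_darts; rewrite (negbTE h3) (negbTE h4).
have -> : has (fun q => (v, u) \in quad_darts q) (chain x y l e) = false.
  by apply/negP => /chain_darts; rewrite (negbTE h3) (negbTE h4).
by rewrite !orbF; apply/andP.
Qed.

Definition frame_avoids (F : seq (quad V)) u v :=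
  ~~ has (fun q => (u, v) \in quad_darts q) F &&
  ~~ has (fun q => (v, u) \in quad_darts q) F.

Lemma nonadj_frame o t q F x y l e u v : u != v ->
  (u, v) \notin outer_darts o ++ tri_darts t ++ quad_darts q ->
  (v, u) \notin outer_darts o ++ tri_darts t ++ quad_darts q ->
  frame_avoids F u v ->
  ~~ ((u \in [:: x; y]) && (v \in rcons l e)) -> ~~ ((v \in [:: x; y]) && (u \in rcons l e)) ->
  nonadj o (t, F ++ q :: chain x y l e) (u, v).
Proof.
move=> n; rewrite !mem_cat => h1 h2 /andP[f1 f2] h3 h4.
have p : perm_eq ((q :: F) ++ chain x y l e) (F ++ q :: chain x y l e) by perm_list.
rewrite (@nonadj_eqv _ o (t, (q :: F) ++ chain x y l e) (t, F ++ q :: chain x y l e) (u, v) (tri_corners_refl _) p).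
by apply: nonadj_chain => //; rewrite /in_darts /= (negbTE f1, negbTE f2) orbF.
Qed.

Lemma neqs (T : eqType) (x y : T) : x != y -> ((x == y) = false) * ((y == x) = false).
Proof. by move=> h; split; [|rewrite eq_sym]; apply: negbTE. Qed.

(** Each flip replaces the edge from [a] to a label by the edge from [x] to the next one, so [x]
    takes over the role of [a] in the chain while the triangle keeps the edge ax. [F] collects the
    rebuilt quadrilaterals. The first label after the triangle is already joined to [x], hence the
    [behead] in the hypothesis on [F]. *)
Lemma chain_fan a b c x e l : forall F, uniq (a :: b :: x :: rcons l e) -> x != c -> a != c -> b != c -> c \notin l ->
  (forall v, v \in behead (rcons l e) -> frame_avoids F x v) ->
  (forall v, v \in l -> frame_avoids F a v) ->
  within (a, b, c) (size l) ((a, head e l, x), F ++ chain a b l e) ((a, e, x), F ++ chain x b l e).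
Proof.
elim: l => [|n l IH] F hu nxc nac nbc nc h1 h2; first exact: within_refl.
rewrite [head _ _]/= [chain a b _ _]/= [chain x b _ _]/=.
have mi : head e l \in rcons l e by case: (l) => [|k k'] /=; rewrite ?inE ?eqxx.
have hd : behead (rcons (n :: l) e) = rcons l e by [].
rewrite hd in h1.
move: (hu); rewrite rcons_cons 4!cons_uniq => /and5P[ua ub ux un ul].
have ne v : v \in n :: rcons l e -> [/\ v != a, v != b & v != x].
  by rewrite in_cons => hv; split; [apply: contraNneq ua|apply: contraNneq ub|apply: contraNneq ux] => <-;
    rewrite !in_cons; case/orP: hv => ->; rewrite ?orbT.
have [na nb nx] := ne n (mem_head _ _).
have [ma mb mx] : [/\ head e l != a, head e l != b & head e l != x] by apply: ne; rewrite inE mi orbT.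
have nm : n != head e l by apply: contraNneq un => ->.
have nac' : n != c by apply: contraNneq nc => <-; rewrite mem_head.
have [ab ax] : a != b /\ a != x by split; apply: contraNneq ua => ->; in_list.
have bx : b != x by apply: contraNneq ub => ->; in_list.
have N := (neqs na, neqs nb, neqs nx, neqs ma, neqs mb, neqs mx, neqs nm, neqs nac', (neqs ab, neqs ax, neqs bx, neqs nxc, neqs nac, neqs nbc)).
have hu' : uniq [:: a, b, x & rcons l e].
  rewrite !cons_uniq ul andbT; apply/and3P; split.
  - by apply: contra ua; rewrite !inE => /or3P[] ->; rewrite ?orbT.
  - by apply: contra ub; rewrite !inE => /orP[] ->; rewrite ?orbT.
  - by apply: contra ux; rewrite !inE => ->; rewrite ?orbT.
have nc' : c \notin l by apply: contra nc; rewrite inE => ->; rewrite orbT.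
have p1 : perm_eq (F ++ (n, a, head e l, b) :: chain a b l e) ((n, a, head e l, b) :: F ++ chain a b l e) by perm_list.
have p2 : perm_eq (F ++ (n, x, head e l, b) :: chain a b l e) ((n, x, head e l, b) :: F ++ chain a b l e) by perm_list.
have st : within (a, b, c) 1 ((a, n, x), F ++ (n, a, head e l, b) :: chain a b l e)
    ((a, head e l, x), F ++ (n, x, head e l, b) :: chain a b l e).
  apply: (@step_by (n, x, a, head e l, b) 0 1 (F ++ chain a b l e)) => //.
  - in_list.
  - in_list.
  - by apply: nonadj_frame; rewrite ?h1 //= ?inE ?xpair_eqE ?N ?andbF // eq_sym.
  - apply: nonadj_frame; rewrite ?(negbTE un) //= ?inE ?xpair_eqE ?N ?andbF //.
    by rewrite /frame_avoids andbC; apply: h2; rewrite mem_head.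
rewrite -[size _]/(1 + size l); apply: within_trans st _.
have w0 k s1 s2 s3 : s1.1 \in tri_corners s2.1 -> perm_eq s1.2 s2.2 -> within (a, b, c) k s2 s3 -> within (a, b, c) k s1 s3.
  move=> k1 k2 h; rewrite -[k]add0n; apply: within_trans h; exists 0 => //; apply: reach0 => //.
  exact: tri_corners_sym.
have := IH ((n, x, head e l, b) :: F) hu' nxc nac nbc nc' _ _ => H.
have H' : within (a, b, c) (size l) (a, head e l, x, ((n, x, head e l, b) :: F) ++ chain a b l e)
   (a, e, x, ((n, x, head e l, b) :: F) ++ chain x b l e).
  apply: H => v hv; rewrite /frame_avoids /= !inE !xpair_eqE.
    have hv' : v \in rcons l e by exact: mem_behead.
    have nv : v != n by apply: contraNneq un => <-.
    have nvm : v != head e l.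
      by move: ul hv; case: (l) => [|k k'] //= /andP[k1 _] hv; apply: contraNneq k1 => <-.
    have [va vb vx] := ne v (mem_behead (s := n :: rcons l e) hv').
    rewrite ?N ?(neqs va) ?(neqs vb) ?(neqs vx) ?(neqs nv) ?(neqs nvm) ?andbF /=.
    exact: h1.
  have hv' : v \in rcons l e by rewrite mem_rcons inE hv orbT.
  have [va vb vx] := ne v (mem_behead (s := n :: rcons l e) hv').
  rewrite ?N ?(neqs va) ?(neqs vb) ?(neqs vx) ?andbF /=.
  by apply: h2; rewrite inE hv orbT.
rewrite -[size l]addn0; apply: within_trans (w0 _ _ _ _ _ _ H') _; rewrite ?tri_corners_refl //.
by exists 0 => //; apply: reach0; rewrite ?tri_corners_refl //; perm_list.
Qed.

Ltac triv N mc mA := rewrite /in_darts /= ?inE ?xpair_eqE ?mc ?mA ?N ?andbF //.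
Ltac stp N mc mA P i j R := apply: (@step_by P i j R);
  [by rewrite !inE ?eqxx ?orbT | by perm_list | by rewrite !inE ?eqxx ?orbT | by perm_list
  | apply: nonadj_chain; triv N mc mA | apply: nonadj_chain; triv N mc mA].

(* The quadrilateral at A, nearest to the edge ab, is moved to the far end next to c. *)
Lemma outermost a b c A B l : uniq ([:: a; b; c; A; B] ++ l) ->
  within (a, b, c) (2 * size l + 8) (nested a b c (A :: B :: l)) (nested a b c (rcons (B :: l) A)).
Proof.
rewrite /= !inE !negb_or -!andbA => /andP[ab /andP[ac /andP[aA /andP[aB /andP[al /andP[bc /andP[bA /andP[bB /andP[bl /andP[cA /andP[cB /andP[cl /andP[AB /andP[Al /andP[Bl ul]]]]]]]]]]]]]]].
(* [h] and [k] follow [B] when the list ends in [c] and in [A], respectively; they differ only if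
   [l] is empty. *)
have [h hh] : exists h, h = head c l by exists (head c l).
have [k hk] : exists k, k = head A l by exists (head A l).
have hl : (h == c) || (h \in l) by rewrite hh; case: (l) => [|? ?] /=; rewrite ?inE eqxx ?orbT.
have kl : (k == A) || (k \in l) by rewrite hk; case: (l) => [|? ?] /=; rewrite ?inE eqxx ?orbT.
have nel v : v \in l -> [/\ a != v, b != v, c != v, A != v & B != v].
  move=> hv; split; [apply: contraNneq al|apply: contraNneq bl|apply: contraNneq cl|apply: contraNneq Al|
    apply: contraNneq Bl] => e; by rewrite e.
have [ha hb hA hB] : [/\ a != h, b != h, A != h & B != h].
  by case/predU1P: hl => [->|/nel[]//]; split; rewrite // eq_sym.
have [ka kb kB kc] : [/\ a != k, b != k, B != k & c != k].
  by case/predU1P: kl => [->|/nel[]//]; split; rewrite // eq_sym.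
have mc v : (v \in rcons l c) = (v == c) || (v \in l) by rewrite mem_rcons inE.
have mA v : (v \in rcons l A) = (v == A) || (v \in l) by rewrite mem_rcons inE.
have N := (neqs ab, neqs ac, neqs aA, neqs aB, neqs bc, neqs bA, neqs bB, neqs cA, neqs cB, neqs AB,
  (neqs ha, neqs hb, neqs hA, neqs hB, neqs ka, neqs kb, neqs kB, neqs kc),
  (negbTE al, negbTE bl, negbTE cl, negbTE Al, negbTE Bl)).
(* From [s0] to [s2] the label [A] is detached from [a] and the triangle moves on to [B]. A pass of
   [chain_fan] hangs the chain on [B] instead of [a] and brings the triangle to [c]. The states [m1]
   to [m5] carry [A] to the far end, and a reversed pass returns the chain to [a]. Two passes over
   [l] and eight single flips give [2 * size l + 8]. *)
pose s0 : state V := ((b, a, A), [:: (A, a, B, b); (B, a, h, b)] ++ chain a b l c).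
pose s1 : state V := ((b, A, B), [:: (A, b, a, B); (B, a, h, b)] ++ chain a b l c).
pose s2 : state V := ((a, h, B), [:: (A, b, a, B); (B, h, b, A)] ++ chain a b l c).
pose g0 : state V := ((a, c, B), [:: (A, b, a, B); (B, h, b, A)] ++ chain B b l c).
pose m1 : state V := ((a, A, b), [:: (A, a, c, B); (B, h, b, A)] ++ chain B b l c).
pose m2 : state V := ((a, A, B), [:: (A, a, c, B); (B, h, b, a)] ++ chain B b l c).
pose m3 : state V := ((c, B, A), [:: (A, B, a, c); (B, h, b, a)] ++ chain B b l c).
pose m4 : state V := ((b, A, c), [:: (A, B, a, c); (B, k, b, a)] ++ chain B b l A).
pose m5 : state V := ((a, A, B), [:: (A, a, c, b); (B, k, b, a)] ++ chain B b l A).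
pose s3 : state V := ((a, k, B), [:: (A, a, c, b); (B, k, b, a)] ++ chain a b l A).
pose s4 : state V := ((b, a, B), [:: (A, a, c, b); (B, a, k, b)] ++ chain a b l A).
have w1 : within (a, b, c) 1 s0 s1.
  stp N mc mA (A, b, a, B, b) 0 3 ((B, a, h, b) :: chain a b l c).
have w2 : within (a, b, c) 1 s1 s2.
  stp N mc mA (B, a, h, b, A) 3 0 ((A, b, a, B) :: chain a b l c).
have w4 : within (a, b, c) 1 g0 m1.
  stp N mc mA (A, b, a, c, B) 2 0 ((B, h, b, A) :: chain B b l c).
have w5 : within (a, b, c) 1 m1 m2.
  stp N mc mA (B, h, b, a, A) 2 3 ((A, a, c, B) :: chain B b l c).
have w6 : within (a, b, c) 1 m2 m3.
  stp N mc mA (A, B, a, c, B) 0 3 ((B, h, b, a) :: chain B b l c).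
have w8 : within (a, b, c) 1 m4 m5.
  stp N mc mA (A, B, a, c, b) 3 0 ((B, k, b, a) :: chain B b l A).
have w10 : within (a, b, c) 1 s3 s4.
  stp N mc mA (B, a, k, b, a) 0 3 ((A, a, c, b) :: chain a b l A).
have head_neq e v : uniq (rcons l e) -> v \in behead (rcons l e) -> v != head e l.
  by case: (l) => [|n l'] //= /andP[nl _] hv; apply: contraNneq nl => <-.
have ulc : uniq (rcons l c) by rewrite rcons_uniq cl.
have ulA : uniq (rcons l A) by rewrite rcons_uniq Al.
have w3 : within (a, b, c) (size l) s2 g0.
  have := @chain_fan a b c B c l [:: (A, b, a, B); (B, h, b, A)]; rewrite -hh.
  apply; rewrite ?N //; first by rewrite !cons_uniq ulc !in_cons !mc !N.
    move=> v hv; have := head_neq c v ulc hv; rewrite -hh => vh.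
    have := mem_behead hv; rewrite mc => hv'.
    have [va vb vA vB] : [/\ a != v, b != v, A != v & B != v].
      by case/predU1P: hv' => [->|/nel[]//]; split; rewrite ?N.
    by rewrite /frame_avoids /= !inE !xpair_eqE ?(neqs vh) ?(neqs va) ?(neqs vA) ?(neqs vb) ?(neqs vB) ?N ?andbF.
  move=> v /nel[_ vb _ _ vB].
  by rewrite /frame_avoids /= !inE !xpair_eqE ?(neqs vb) ?(neqs vB) ?N ?andbF.
have w7 : within (a, b, c) 1 m3 m4.
  have n1 : nonadj (a, b, c) m3 (A, b) by apply: nonadj_chain; triv N mc mA.
  have n2 : nonadj (a, b, c) m4 (B, c) by apply: nonadj_chain; triv N mc mA.
  (* The flipped edge Bc lies on the last quadrilateral of the chain, or, for empty [l], on the one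
     with reflex vertex [B]. *)
  move: n1 n2; rewrite /m3 /m4 hh hk; case/lastP: (l) => [|l' D] n1 n2.
    by apply: (@step_by (B, A, c, b, a) 0 1 [:: (A, B, a, c)]) => //=; rewrite ?inE ?eqxx ?orbT //; perm_list.
  have e1 : head c (rcons l' D) = head D l' by case: (l').
  have e2 : head A (rcons l' D) = head D l' by case: (l').
  move: n1 n2; rewrite !chain_rcons e1 e2 => n1 n2.
  apply: (@step_by (D, B, A, c, b) 1 2 ([:: (A, B, a, c); (B, head D l', b, a)] ++ chain B b l' D)) => //;
    rewrite ?inE ?eqxx ?orbT // -cats1; by perm_list.
have w9 : within (a, b, c) (size l) m5 s3.
  apply: within_sym.
  have := @chain_fan a b c B A l [:: (A, a, c, b); (B, k, b, a)]; rewrite -hk.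
  apply; rewrite ?N //; first by rewrite !cons_uniq ulA !in_cons !mA !N.
    move=> v hv; have := head_neq A v ulA hv; rewrite -hk => vk.
    have := mem_behead hv; rewrite mA => hv'.
    have [va vb vB] : [/\ a != v, b != v & B != v].
      by case/predU1P: hv' => [->|/nel[]//]; split; rewrite ?N.
    by rewrite /frame_avoids /= !inE !xpair_eqE ?(neqs vk) ?(neqs va) ?(neqs vb) ?(neqs vB) ?N ?andbF.
  move=> v /nel[_ vb vc vA vB].
  by rewrite /frame_avoids /= !inE !xpair_eqE ?(neqs vb) ?(neqs vB) ?(neqs vA) ?(neqs vc) ?N ?andbF.
have we : within (a, b, c) 0 s4 (nested a b c (rcons (B :: l) A)).
  exists 0 => //; apply: reach0; first exact: tri_corners_refl.
  rewrite /s4 /nested chain_rcons /= -hk -cats1; perm_list.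
have wb : within (a, b, c) 0 (nested a b c (A :: B :: l)) s0.
  by exists 0 => //; apply: reach0; rewrite /nested /s0 /= ?hh ?inE ?eqxx.
have W := within_trans wb (within_trans w1 (within_trans w2 (within_trans w3 (within_trans w4 (within_trans w5
  (within_trans w6 (within_trans w7 (within_trans w8 (within_trans w9 (within_trans w10 we)))))))))).
by apply: within_leq W; clear; lia.
Qed.

End Sorting.

(** * Insertion sort and the quadratic bound *)

Section Connect.
Variable V : finType.
Implicit Types (s : state V) (u v w x y z a b c e : V) (l : seq V).

Lemma nested_unrcons a b c l v :
  within (a, b, c) 0 (nested a b c (rcons l v)) (add_quad (v, a, c, b) (nested a b v l)).
Proof. by apply: within_sym; apply: nested_rcons; apply: within_refl. Qed.

Lemma nested_inner a b c l v : ppt (a, b, c) (nested a b c (rcons l v)) ->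
  ppt (a, b, v) (nested a b v l) /\ c \notin verts (a, b, v) (nested a b v l).
Proof.
move=> hs; have hs' := within_ppt (nested_unrcons a b c l v) hs.
by split; [exact: ppt_inner hs'|exact: inner_notin hs'].
Qed.

Lemma nested_lift a b c m l l' v : ppt (a, b, c) (nested a b c (rcons l v)) ->
  within (a, b, v) m (nested a b v l) (nested a b v l') ->
  within (a, b, c) m (nested a b c (rcons l v)) (nested a b c (rcons l' v)).
Proof.
move=> hs hw; have [hi hc] := nested_inner hs; apply: nested_rcons.
exact: (within_trans (nested_unrcons a b c l v) (within_lift hi hc hw)).
Qed.

(** The labels before [e] form a nested state with outer face [(a, b, e)]; flips there lift through
    the surrounding quadrilaterals one at a time. *)
Lemma nested_prefix a b m l1 l1' e l2 : forall c, ppt (a, b, c) (nested a b c (l1 ++ e :: l2)) ->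
  (ppt (a, b, e) (nested a b e l1) -> within (a, b, e) m (nested a b e l1) (nested a b e l1')) ->
  within (a, b, c) m (nested a b c (l1 ++ e :: l2)) (nested a b c (l1' ++ e :: l2)).
Proof.
elim/last_ind: l2 => [|l2 v IH] c hs hw.
  by rewrite !cats1 in hs *; apply: nested_lift => //; apply: hw; have [] := nested_inner hs.
rewrite -!rcons_cons -!rcons_cat in hs *; apply: nested_lift => //; apply: IH => //.
by have [] := nested_inner hs.
Qed.

Lemma nested_uniq a b c l : ppt (a, b, c) (nested a b c l) -> uniq ([:: a; b; c] ++ l).
Proof. by move/ppt_uniq; rewrite /verts /= chain_heads. Qed.

Lemma outermost_ppt a b c x l : ppt (a, b, c) (nested a b c (x :: l)) ->
  within (a, b, c) (2 * size l + 8) (nested a b c (x :: l)) (nested a b c (rcons l x)).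
Proof.
move=> hs; case: l hs => [|B l] hs; first exact: within_leq (leq0n _) (within_refl _ _ _).
apply: within_leq (outermost _); first by rewrite leq_add2r leq_mul2l leqnSn orbT.
by have := nested_uniq hs.
Qed.

Lemma move_first a b c x l1 l2 : ppt (a, b, c) (nested a b c (x :: l1 ++ l2)) ->
  within (a, b, c) (2 * size l1 + 8) (nested a b c (x :: l1 ++ l2)) (nested a b c (l1 ++ x :: l2)).
Proof.
case: l2 => [|e l2] hs.
  by rewrite cats0 in hs *; rewrite cats1; apply: outermost_ppt.
have := @nested_prefix a b (2 * size l1 + 8) (x :: l1) (rcons l1 x) e l2 c hs (@outermost_ppt a b e x l1).
by rewrite cat_rcons.
Qed.

(** Any total order would do: its purpose is to single out one nested state as common target. *)
Definition rank_le : rel V := fun x y => enum_rank x <= enum_rank y.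

Lemma rank_le_trans : transitive rank_le. Proof. by move=> y x z; apply: leq_trans. Qed.
Lemma rank_le_total : total rank_le. Proof. by move=> x y; apply: leq_total. Qed.
Lemma rank_le_anti : antisymmetric rank_le.
Proof. by move=> x y; rewrite -eqn_leq => /eqP h; apply: enum_rank_inj; apply: val_inj. Qed.

Lemma sorted_insert x l : pairwise rank_le l ->
  exists l1 l2, l = l1 ++ l2 /\ pairwise rank_le (l1 ++ x :: l2).
Proof.
elim: l => [_|y l IH]; first by exists [::], [::].
rewrite [pairwise _ _]/= => /andP[hy hp]; case: (boolP (rank_le x y)) => hxy.
  exists [::], (y :: l); split=> //=; rewrite hxy hy hp /= !andbT.
  by apply/allP => z iz; apply: rank_le_trans hxy (allP hy z iz).
have [l1 [l2 [e hp']]] := IH hp; exists (y :: l1), l2; rewrite e; split=> //=.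
rewrite hp' andbT; apply/allP => z; rewrite mem_cat inE => iz.
have : (z == x) || (z \in l) by rewrite e mem_cat; case/or3P: iz => ->; rewrite ?orbT.
case/predU1P => [->|iz']; last exact: (allP hy).
by have := rank_le_total x y; rewrite (negbTE hxy).
Qed.

(** Only the first label of a nested list is ever moved. It therefore passes the rest of the
    unsorted part [u] together with the smaller labels [l1] of the sorted part in a single cyclic
    move. *)
Lemma insertion_sort a b c (u : seq V) : forall l, ppt (a, b, c) (nested a b c (u ++ l)) -> pairwise rank_le l ->
  exists2 l', within (a, b, c) (size u * (2 * #|V| + 8)) (nested a b c (u ++ l)) (nested a b c l') &
    pairwise rank_le l' /\ perm_eq l' (u ++ l).
Proof.
elim: u => [|x u IH] l hs hl; first by exists l; [exact: within_refl|].
have [l1 [l2 [e hp]]] := sorted_insert x hl.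
have e1 : (x :: u) ++ l = x :: (u ++ l1) ++ l2 by rewrite e catA.
have e2 : (u ++ l1) ++ x :: l2 = u ++ (l1 ++ x :: l2) by rewrite catA.
have hs' := hs; rewrite e1 in hs'.
have w := move_first hs'; rewrite -e1 e2 in w.
have [l' w' [h1 h2]] := IH _ (within_ppt w hs) hp.
exists l'; last first.
  split=> //; rewrite (permPl h2) e1 -e2; perm_list.
apply: within_leq (within_trans w w').
rewrite [size (x :: u) * _]mulSn !leq_add2r leq_mul2l /=.
have := nested_uniq hs; rewrite e => /card_uniqP h; apply: leq_trans (max_card (mem ([:: a; b; c] ++ (x :: u) ++ l1 ++ l2))).
rewrite h /= !size_cat; clear; lia.
Qed.

Lemma connect_adj a b c s x : ppt (a, b, c) s -> x \in verts (a, b, c) s ->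
  exists xs, [/\ path (adj_in (a, b, c) s) x xs, last x xs = c & size xs <= #|V|].
Proof.
move=> hs hx.
have sy : connect_sym (adj_in (a, b, c) s).
  by apply: sym_connect_sym => u v; rewrite /adj_in (dart_sym hs).
have hG u v : (u, v) \in darts (a, b, c) s -> connect (adj_in (a, b, c) s) x u = connect (adj_in (a, b, c) s) x v.
  by move=> huv; apply: (same_connect1r sy).
have hc : c \in verts (a, b, c) s by rewrite /verts !inE eqxx !orbT.
have := ppt_const hs hG hx hc; rewrite connect0 => /esym/connectP[xs hp e].
case/shortenP: hp e => xs' hp u _ e; exists xs'; split=> //.
have /card_uniqP h := u; apply: leq_trans (max_card (mem (x :: xs'))); rewrite h; exact: leqnSn.
Qed.

(** With m = [#|V|], the walk to [c] takes at most m^2 flips, the nesting m(2m + 1) and the sorting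
    m(2m + 8). The sum 5m^2 + 9m is at most 14m^2 because m is positive. *)
Lemma ppt_sorted a b c s : ppt (a, b, c) s -> exists2 l, pairwise rank_le l /\ perm_eq l (map head_of s.2) &
  within (a, b, c) (14 * #|V| ^ 2) s (nested a b c l).
Proof.
move=> hs; pose x := s.1.1.1.
have hx : x \in tri_verts s.1 by in_list.
have hxv : x \in verts (a, b, c) s.
  have [y [z ht]] := tri_vertsP hx; have [c1 _ _] := tri_pyz_corners (a, b, c) ht.
  exact: (ppt_verts hs (corner_dart c1 : (x, y) \in _)).
have [xs [hp hl hsz]] := connect_adj hs hxv.
have [s1 w1 hc] := approach hs hx hp hsz; rewrite hl in hc.
have hs1 := within_ppt w1 hs.
have [l1 w2] := normalize hs1 hc (erefl _).
have hs2 := within_ppt w2 hs1.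
have := @insertion_sort a b c l1 [::]; rewrite cats0 => /(_ hs2 isT)[l w3 [h1 h2]].
have w := within_trans w1 (within_trans w2 w3).
have hv : perm_eq l1 (map head_of s.2).
  have := within_verts (within_trans w1 w2); rewrite /verts /= !perm_cons.
  by rewrite chain_heads.
exists l; first by split=> //; rewrite (permPl h2).
apply: within_leq w.
have b1 : size l1 <= #|V|.
  have := nested_uniq hs2; rewrite cat_uniq => /and3P[_ _ /card_uniqP <-]; exact: max_card.
have b2 : size s1.2 <= #|V|.
  have := ppt_uniq hs1; rewrite /verts cat_uniq => /and3P[_ _ /card_uniqP].
  by rewrite size_map => <-; apply: max_card.
have b3 : 0 < #|V| by apply/card_gt0P; exists x.
move: b1 b2 b3; clear; move: #|V| (size l1) (size s1.2) => m i j h1 h2 h3.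
rewrite expnS expn1; nia.
Qed.

(** Both states sort to the same list, and the second route is run backwards; thus 28 = 2 * 14. *)
Lemma ppt_connected a b c s s' : ppt (a, b, c) s -> ppt (a, b, c) s' ->
  perm_eq (map head_of s.2) (map head_of s'.2) -> within (a, b, c) (28 * #|V| ^ 2) s s'.
Proof.
move=> hs hs' hp; have [l [h1 h2] w] := ppt_sorted hs; have [l' [h1' h2'] w'] := ppt_sorted hs'.
have e : l = l'.
  apply: (sorted_eq rank_le_trans rank_le_anti); rewrite ?(pairwise_sorted h1) ?(pairwise_sorted h1') //.
  by rewrite (permPl h2) (permPl hp) perm_sym.
rewrite -e in w'; have := within_trans w (within_sym w'); rewrite -mulnDl.
by [].
Qed.

End Connect.

(** * From embeddings to states *)

(** The points of order k form whole orbits, so they number k times the orbits of length k. *)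
Lemma fcard_order34 (T : finType) (f : T -> T) (D : {pred T}) : injective f -> fclosed f D ->
  (forall d, d \in D -> (order f d == 3) || (order f d == 4)) ->
  exists m3, let m4 := fcard f [predI D & order_set f 4] in
    [/\ fcard f D = m3 + m4, #|[predI D & order_set f 3]| = m3 * 3 & #|D| = m3 * 3 + m4 * 4].
Proof.
move=> injf cD h34; have sy := fconnect_sym injf.
have cl k : fclosed f [predI D & order_set f k].
  move=> x _ /eqP <-; rewrite !inE -(fclosed1 cD) [order f (f x)](@order_id_cycle _ f x) //.
  exact: (cycle_orbit injf).
have card3 k : #|[predI D & order_set f k]| = fcard f [predI D & order_set f k] * k.
  by rewrite (fcard_order_set injf _ (cl k)) //; apply/subsetP => x; rewrite inE => /andP[].
exists (fcard f [predI D & order_set f 3]) => m4; split.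
- rewrite /m4 /n_comp_mem -cardUI; set X := [predI _ & _]; set Y := [predI _ & _].
  rewrite [X in _ = _ + X]eq_card0 => [|x]; last first.
    by rewrite !inE; case: (order f x =P 3) => [->|]; rewrite ?andbF.
  rewrite addn0; apply: eq_card => x; rewrite !inE -andb_orr; case: (roots _ x) => //=.
  by rewrite -andb_orr; case: (boolP (x \in D)) => // /h34 ->.
- by rewrite card3.
- rewrite -!card3 -cardUI [X in _ = _ + X]eq_card0 ?addn0 => [|x]; last first.
    by rewrite !inE; case: (order f x =P 3) => [->|]; rewrite ?andbF.
  apply: eq_card => x; rewrite !inE -andb_orr /order_set /=.
  by case: (boolP (x \in D)) => [/h34 ->|]; rewrite ?andbT.
Qed.

Section Represent.
Variable n : nat.
Notation V := 'I_n.
Implicit Types (o : tri V) (s : state V) (u v w x y : V) (d e : V * V) (T : emb n).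

(** [rep_id] fixes the rotation off the neighbours, so that a state determines its embedding as a
    triple of functions. *)
Record rep T o s : Prop := Rep {
  rep_adj : forall u v, adj T u v = ((u, v) \in darts o s);
  rep_succ : forall u v w, (u, v, w) \in corners o s -> succ T v u = w;
  rep_id : forall u v, ~~ adj T v u -> succ T v u = u;
  rep_reflex : forall u v, reflex T u v = ((u, v) \in reflex_darts o s) }.

Section Phi.
Variable T : emb n.
Hypothesis wf : wf_rot T.

Lemma adj_sym u v : adj T u v = adj T v u.
Proof. by have [[_ h] _ _ _ _] := wf. Qed.

Lemma adj_succ v u : adj T v u -> adj T v (succ T v u).
Proof.
have [_ h1 h2 _ _] := wf; move=> huv; apply/negPn/negP => /[dup] hn /h1 /h2 e.
by rewrite e huv in hn.
Qed.

Lemma phi_dart d : dart T d -> dart T (phi T d).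
Proof. by case: d => u v; rewrite /dart /phi /= => h; rewrite h /= adj_succ // adj_sym. Qed.

Lemma phi_inj : injective (phi T).
Proof.
have [_ h1 h2 _ _] := wf.
have aux d e : dart T d -> ~~ dart T e -> phi T d = phi T e -> d = e.
  by move=> hd he; have := phi_dart hd; rewrite {2 3}/phi -/(dart T e) (negbTE he) => h e'; rewrite -e' h in he.
move=> d e; case: (boolP (dart T d)) => hd; case: (boolP (dart T e)) => he.
- move: hd he; case: d e => [u v] [u' v']; rewrite /dart /phi /= => -> -> [<- e].
  by congr (_, _); apply: h2 e.
- exact: aux.
- by move=> h; apply/esym; apply: aux.
- by rewrite /phi -!/(dart _ _) (negbTE hd) (negbTE he).
Qed.

Lemma phiE u v : adj T u v -> phi T (u, v) = (v, succ T v u).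
Proof. by rewrite /phi /= => ->. Qed.

Lemma dart_closed : fclosed (phi T) (dart T).
Proof.
apply: intro_closed; first exact: fconnect_sym phi_inj.
by move=> d _ /eqP <- h; exact: phi_dart.
Qed.

End Phi.

(** * Reading off the faces by Euler's formula *)

Section Decompose.
Variables (T : emb n) (a b c : V).
Hypothesis hT : is_4ppt T a b c.
Let f := phi T.

Let wf : wf_rot T. Proof. by case: hT => -[]. Qed.
Let injf : injective f. Proof. exact: phi_inj. Qed.
Let sy := fconnect_sym injf.

(** The dart that leads into the reflex angle at [v]. Pointedness makes it exist and be unique, so
    the default value never occurs. *)
Definition reflex_tail v : V * V := odflt (v, v) [pick d | [&& adj T d.1 d.2, d.2 == v & reflex T d.1 d.2]].

Lemma reflex_tailP v : [/\ dart T (reflex_tail v), (reflex_tail v).2 = v & reflex T (reflex_tail v).1 (reflex_tail v).2].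
Proof.
have [_ _ _ _ /(_ v)] := hT; rewrite /reflex_tail; case: pickP => [d /and3P[h1 /eqP h2 h3]|h] //=.
by rewrite eq_card0 // => d; rewrite inE h.
Qed.

Lemma reflex_tail_unique d : dart T d -> reflex T d.1 d.2 -> d = reflex_tail d.2.
Proof.
move=> h1 h2; have [_ _ _ _ /(_ d.2)] := hT; have [h3 h4 h5] := reflex_tailP d.2.
move/eqP/cards1P => [e he]; have hd : d \in [set e] by rewrite -he inE; apply/and3P.
have hr : reflex_tail d.2 \in [set e] by rewrite -he inE [adj _ _ _]h3 h5 h4 eqxx.
by move: hd hr; rewrite !inE => /eqP ed /eqP ->.
Qed.

Let outer := traject f (a, b) 3.

Lemma outer_embE : outer = [:: (a, b); (b, c); (c, a)].
Proof. by have [_ [h1 h2 h3 h4] _ _ _] := hT; rewrite /outer /= /f h2 h3. Qed.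

Lemma outer_emb_cycle : fcycle f outer.
Proof. by have [_ [h1 h2 h3 h4] _ _ _] := hT; rewrite outer_embE /= /f h2 h3 h4 !eqxx. Qed.

Lemma outer_emb_adj : [/\ adj T a b, adj T b c & adj T c a].
Proof.
have [_ [h1 h2 h3 h4] _ _ _] := hT.
have d1 := phi_dart wf (d := (a, b)) h1; rewrite h2 in d1.
by have d2 := phi_dart wf d1; rewrite h3 in d2.
Qed.

Lemma outer_neq : [/\ a != b, b != c & c != a].
Proof.
have [[irr _] _ _ _ _] := wf; have [h1 h2 h3] := outer_emb_adj.
by split; [move: h1|move: h2|move: h3]; apply: contraTneq => ->.
Qed.

Lemma outer_emb_uniq : uniq outer.
Proof.
have [h1 h2 h3] := outer_neq; rewrite outer_embE /= !inE !xpair_eqE (negbTE h1) (negbTE h2) /=.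
by rewrite eq_sym (negbTE h3).
Qed.

Lemma outer_order d : d \in outer -> order f d = 3.
Proof. exact: (order_cycle outer_emb_cycle outer_emb_uniq). Qed.

Lemma on_outerE d : on_outer T a b d = (d \in outer).
Proof. by rewrite /on_outer /same_face (fconnect_cycle outer_emb_cycle) // inE eqxx. Qed.

Lemma outer_step d e : fconnect f d e -> (d \in outer) = (e \in outer).
Proof. by move=> h; rewrite -!on_outerE /on_outer /same_face !(sy (a, b)) (same_connect sy h). Qed.

Lemma outer_dart_emb d : d \in outer -> dart T d.
Proof.
have [h1 h2 h3] := outer_emb_adj.
by rewrite outer_embE !inE => /or3P[] /eqP->.
Qed.

Lemma dart_step d e : fconnect f d e -> dart T d = dart T e.
Proof. exact: (closed_connect (dart_closed wf)). Qed.

Lemma order_step d e : fconnect f d e -> order f d = order f e.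
Proof. by move=> h; apply: eq_card => x; rewrite !inE; exact: (same_connect sy h). Qed.

Lemma face_order d : dart T d -> (order f d == 3) || (order f d == 4).
Proof.
move=> hd; case: (boolP (d \in outer)) => ho; first by rewrite outer_order.
have [_ _ _ /(_ d hd) h _] := hT; rewrite on_outerE in h.
by have /andP[] := h ho.
Qed.

Lemma inner_convex d : dart T d -> d \notin outer ->
  #|[set d' | fconnect f d d' & ~~ reflex T d'.1 d'.2]| = 3.
Proof.
move=> hd ho; have [_ _ _ /(_ d hd) h _] := hT; rewrite on_outerE in h.
by have /andP[_ /eqP] := h ho.
Qed.

(** Inner faces have three convex angles: an inner triangle has no reflex angle and a quadrilateral
    exactly one. *)
Lemma inner_reflex d : dart T d -> d \notin outer ->
  #|[set d' | fconnect f d d' & reflex T d'.1 d'.2]| + 3 = order f d.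
Proof.
move=> hd ho; rewrite -(inner_convex hd ho) /order -[RHS]cardsE.
rewrite -[RHS](cardsID [set d' | reflex T d'.1 d'.2]); congr (_ + _).
  by apply: eq_card => x; rewrite !inE.
by apply: eq_card => x; rewrite !inE andbC.
Qed.

Definition inner_verts := [seq v <- enum 'I_n | v \notin [:: a; b; c]].

Lemma inner_vertsE v : (v \in inner_verts) = (v \notin [:: a; b; c]).
Proof. by rewrite mem_filter mem_enum andbT. Qed.

Lemma size_inner_verts : size inner_verts + 3 = n.
Proof.
have [h1 h2 h3] := outer_neq.
rewrite -{2}(size_enum_ord n) -[in RHS](count_predC (mem [:: a; b; c])) addnC; congr (_ + _).
  rewrite -size_filter -[LHS]/(size [:: a; b; c]); apply/esym/perm_size/uniq_perm.
  - by rewrite filter_uniq ?enum_uniq.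
  - by rewrite /= !inE negb_or h1 h2 /= eq_sym h3.
  - by move=> v; rewrite mem_filter mem_enum andbT.
by rewrite size_filter.
Qed.

Lemma outer_tail v : (reflex_tail v \in outer) = (v \in [:: a; b; c]).
Proof.
have hr d : d \in outer -> reflex_tail d.2 = d.
  move=> hd; apply/esym/reflex_tail_unique; first exact: outer_dart_emb.
  by have [_ _ h _ _] := hT; apply: h; [exact: outer_dart_emb|rewrite on_outerE].
have [_ e _] := reflex_tailP v.
apply/idP/idP => [|hv].
  rewrite -{2}e outer_embE; case: (reflex_tail v) => u w /=.
  by rewrite !inE => /or3P[] /eqP[_ ->]; rewrite eqxx ?orbT.
suff [d hd ed] : exists2 d, d \in outer & d.2 = v by rewrite -ed hr.
by move: hv; rewrite outer_embE !inE => /or3P[] /eqP->; [exists (c, a)|exists (a, b)|exists (b, c)];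
  rewrite ?inE ?eqxx ?orbT.
Qed.

Lemma tail_order v : v \in inner_verts -> order f (reflex_tail v) = 4.
Proof.
rewrite inner_vertsE -outer_tail => hv; have [hd _ hr] := reflex_tailP v.
have := face_order hd; have := inner_reflex hd hv.
have : 0 < #|[set d' | fconnect f (reflex_tail v) d' & reflex T d'.1 d'.2]|.
  by apply/card_gt0P; exists (reflex_tail v); rewrite inE connect0.
by move: #|_| (order _ _) => m i; clear; lia.
Qed.

Lemma tail_connect u v : u \in inner_verts -> v \in inner_verts ->
  fconnect f (reflex_tail u) (reflex_tail v) -> u = v.
Proof.
move=> hu hv h; have [hd e1 r1] := reflex_tailP u; have [_ e2 r2] := reflex_tailP v.
have ho : reflex_tail u \notin outer by rewrite outer_tail -inner_vertsE.
have := inner_reflex hd ho; rewrite tail_order // => /(@addIn 3 _ 1)/eqP/cards1P[e he].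
have h1 : reflex_tail u \in [set e] by rewrite -he inE connect0 r1.
have h2 : reflex_tail v \in [set e] by rewrite -he inE h r2.
by rewrite -e1 -e2; move: h1 h2; rewrite !inE => /eqP-> /eqP->.
Qed.

Lemma order4_tail d : dart T d -> order f d = 4 ->
  exists2 v, v \in inner_verts & fconnect f (reflex_tail v) d.
Proof.
move=> hd ho; have nd : d \notin outer by apply/negP => /outer_order; rewrite ho.
have := inner_reflex hd nd; rewrite ho => /(@addIn 3 _ 1)/eqP/cards1P[e he].
have : e \in [set e] by rewrite inE.
rewrite -he inE => /andP[h1 h2]; have hde : dart T e by rewrite -(dart_step h1).
have er := reflex_tail_unique hde h2; exists e.2; last by rewrite -er sy.
by rewrite inner_vertsE -outer_tail -er -(outer_step h1).
Qed.

(** Sending an inner vertex to the face of its reflex angle is a bijection onto the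
    quadrilaterals. *)
Lemma card_quads : fcard f [predI dart T & order_set f 4] = size inner_verts.
Proof.
have ui : uniq inner_verts by rewrite filter_uniq ?enum_uniq.
rewrite -(card_uniqP ui) -(card_in_imset (f := fun v => froot f (reflex_tail v)) (D := mem inner_verts)).
  apply: eq_card => d; rewrite inE; apply/andP/imsetP => [[hr]|[v hv ->]].
    rewrite inE => /andP[hd /eqP ho]; have [v hv h] := order4_tail hd ho; exists v => //.
    by rewrite -(eqP hr); apply/eqP; rewrite root_connect // sy.
  split; first exact: roots_root.
  have h := connect_root (frel f) (reflex_tail v); rewrite inE.
  have [hd _ _] := reflex_tailP v.
  apply/andP; split; first by have := dart_step h; rewrite hd => /esym.
  by rewrite inE -(order_step h) tail_order.
move=> u v hu hv /eqP; rewrite root_connect //; exact: tail_connect.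
Qed.

(** With t triangles and q quadrilaterals, n = q + 3 and Euler's formula 2n + 2(t + q) = 3t + 4q + 4
    give t = 2, that is, six darts on triangles. *)
Lemma card_order3 : #|[predI dart T & order_set f 3]| = 6 /\ ndarts T = 6 + 4 * size inner_verts.
Proof.
have [m3 [h1 h2 h3]] := fcard_order34 injf (dart_closed wf) face_order.
have [[_ _ euler] _ _ _ _] := hT; rewrite /nfaces in euler.
have e1 : fcard f [pred d | adj T d.1 d.2] = m3 + size inner_verts.
  by rewrite -card_quads -h1; apply: eq_n_comp_r.
have e2 : ndarts T = m3 * 3 + size inner_verts * 4 by rewrite -card_quads -h3 /ndarts cardsE.
have e3 := size_inner_verts.
by rewrite h2; move: euler e1 e2 e3; rewrite -/f; clear; lia.
Qed.

Definition dcorner d : tri V := (d.1, d.2, (f d).2).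

Lemma phi_fst d : dart T d -> (f d).1 = d.2.
Proof. by case: d => u v h; rewrite /f phiE. Qed.

Lemma tri_of_face d : dart T d -> order f d = 3 ->
  tri_corners (dcorner d) = map dcorner (traject f d 3).
Proof.
move=> hd ho; have h1 := phi_dart wf hd; have h2 := phi_dart wf h1.
have e0 := iter_order injf d; rewrite ho /= in e0.
have e1 := phi_fst hd; have e2 := phi_fst h1; have e3 := phi_fst h2.
rewrite -/f e0 in e3; rewrite /= /dcorner -/f e0 e1 e2 -e3.
by case: (d).
Qed.

Definition quad_of d : quad V := (d.2, (f d).2, (f (f d)).2, d.1).

Lemma quad_of_face d : dart T d -> order f d = 4 ->
  quad_corners (quad_of d) = map dcorner (traject f d 4).
Proof.
move=> hd ho; have h1 := phi_dart wf hd; have h2 := phi_dart wf h1; have h3 := phi_dart wf h2.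
have e0 := iter_order injf d; rewrite ho /= in e0.
have e1 := phi_fst hd; have e2 := phi_fst h1; have e3 := phi_fst h2; have e4 := phi_fst h3.
rewrite -/f in e2 e3 e4; rewrite e0 in e4.
by rewrite /quad_corners /= /dcorner e0 e1 e2 e3 -e4.
Qed.

Lemma exists_tri : exists d, [/\ dart T d, d \notin outer & order f d = 3].
Proof.
have [h _] := card_order3; case: (pickP [pred d | [&& dart T d, d \notin outer & order f d == 3]]).
  by move=> d /and3P[h1 h2 /eqP h3]; exists d.
move=> h0; suff : #|[predI dart T & order_set f 3]| <= size outer by rewrite h.
have sub : {subset enum [predI dart T & order_set f 3] <= outer}.
  move=> d; rewrite mem_enum inE => /andP[h1 h2].
  by have := h0 d; rewrite /= [dart T d]h1 [_ == 3]h2 andbT /= => /negbFE.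
by have := uniq_leq_size (enum_uniq _) sub; rewrite -cardE.
Qed.

(** [L] lists darts face by face. It contains every dart and its length is the number of darts, so
    it has no repetitions; this is the distinctness that validity asks for. *)
Lemma state_of : exists s, [/\ rep T (a, b, c) s, ppt (a, b, c) s & map head_of s.2 = inner_verts].
Proof.
have [d0 [hd0 no0 ho0]] := exists_tri; have [N3 N] := card_order3.
pose L := outer ++ traject f d0 3 ++ flatten [seq traject f (reflex_tail v) 4 | v <- inner_verts].
pose s : state V := (dcorner d0, [seq quad_of (reflex_tail v) | v <- inner_verts]).
have eC : corners (a, b, c) s = map dcorner L.
  rewrite /L !map_cat /corners tri_of_face //; congr (_ ++ (_ ++ _)).
    by rewrite -(tri_of_face (d := (a, b))) ?outer_order ?outer_dart_emb // ?outer_embE ?inE ?eqxx //;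
      have [_ [h1 h2 h3 h4] _ _ _] := hT; rewrite /dcorner /f h2.
  rewrite /quads_corners map_flatten -!map_comp; congr flatten; apply/eq_in_map => v hv /=.
  by have [hd _ _] := reflex_tailP v; rewrite (quad_of_face hd) ?tail_order.
have eD : darts (a, b, c) s = L.
  by rewrite /darts eC -map_comp map_id_in // => d _; rewrite /= /dcorner; case: d.
have sub : {subset enum (dart T) <= L}.
  move=> d; rewrite mem_enum => hd; rewrite !mem_cat; case: (boolP (d \in outer)) => //= no.
  case/orP: (face_order hd) => [/eqP h3|/eqP h4]; last first.
    have [v hv h] := order4_tail hd h4; apply/orP; right; apply/flattenP.
    exists (traject f (reflex_tail v) 4); first by apply: map_f.
    by rewrite -(tail_order hv) -fconnect_orbit.
  apply/orP; left; have eo : traject f d0 3 = orbit f d0 by rewrite /orbit ho0.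
  (* The outer face and the face of [d0] use up the six darts on triangles, so [d] lies on the
     latter. *)
  have u6 : uniq (outer ++ traject f d0 3).
    rewrite cat_uniq outer_emb_uniq eo orbit_uniq andbT /=; apply/hasPn => e.
    by rewrite -fconnect_orbit => /outer_step <-.
  have sub6 : {subset outer ++ traject f d0 3 <= enum [predI dart T & order_set f 3]}.
    move=> e; rewrite mem_enum mem_cat eo -fconnect_orbit; case/orP => [he|he].
      by rewrite inE; apply/andP; split; [exact: outer_dart_emb|rewrite inE outer_order].
    by rewrite inE; apply/andP; split; [have := dart_step he; rewrite hd0 => /esym|rewrite inE -(order_step he) ho0].
  have [|_ e6] := uniq_min_size u6 sub6; first by rewrite -cardE N3.
  have : d \in enum [predI dart T & order_set f 3].
    by rewrite mem_enum inE; apply/andP; split=> //; rewrite inE h3.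
  by rewrite -e6 mem_cat (negbTE no).
have szL : size L = 6 + 4 * size inner_verts.
  rewrite !size_cat !size_traject [X in 3 + (3 + X)](_ : _ = 4 * size inner_verts) //.
  rewrite size_flatten /shape -map_comp; elim: inner_verts => //= v l ->.
  by rewrite mulnS.
have szD : size (enum (dart T)) = size L.
  by rewrite szL -N -cardE /ndarts cardsE.
have uL : uniq L by apply: leq_size_uniq (enum_uniq _) sub _; rewrite szD.
have mL d : (d \in L) = dart T d.
  have [|_ h] := uniq_min_size (enum_uniq _) sub; first by rewrite szD.
  by rewrite -h mem_enum.
have dC u v w : (u, v, w) \in corners (a, b, c) s -> adj T u v /\ succ T v u = w.
  by rewrite eC => /mapP[d]; rewrite mL => hd [-> -> ->]; case: d hd => x y h; rewrite /f phiE.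
have cD u v : adj T u v -> (u, v, succ T v u) \in corners (a, b, c) s.
  by move=> h; rewrite eC; apply/mapP; exists (u, v); [rewrite mL|rewrite /dcorner /f phiE].
have hh : map head_of s.2 = inner_verts.
  by rewrite /= -map_comp map_id_in // => v _ /=; have [_ h _] := reflex_tailP v.
have [[irr _] wid winj wrot wrefl] := wf.
exists s; split=> //.
- split.
  + by move=> u v; rewrite eD mL.
  + by move=> u v w /dC[].
  + by move=> u v; apply: wid.
  + move=> u v.
    have er : reflex_darts (a, b, c) s = outer ++ map reflex_tail inner_verts.
      rewrite /reflex_darts /outer_darts outer_embE -map_comp; congr (_ ++ _).
      by apply: eq_map => w /=; case: (reflex_tail w).
    rewrite er mem_cat; apply/idP/orP => [h|[h|/mapP[w hw e]]].
    * have ha : dart T (u, v) by apply: contraTT h => /wrefl ->.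
      have e := reflex_tail_unique ha h; rewrite e.
      case: (boolP (v \in [:: a; b; c])) => hv; first by left; rewrite outer_tail.
      by right; apply: map_f; rewrite inner_vertsE.
    * have [_ _ hr _ _] := hT; apply: (hr (u, v)); first exact: outer_dart_emb.
      by rewrite on_outerE.
    * by have [_ _] := reflex_tailP w; rewrite -e.
- split.
  + split; rewrite -/(darts (a, b, c) s) ?eD //.
    * have -> : map (@out_dart V) (corners (a, b, c) s) = map f L.
        rewrite eC -map_comp; apply/eq_in_map => d; rewrite mL => hd /=.
        by rewrite /out_dart /= -(phi_fst hd); case: (f d).
      apply: uniq_perm => //; first by rewrite map_inj_uniq.
      have sub2 : {subset map f L <= L}.
        by move=> _ /mapP[d hd ->]; rewrite mL in hd *; rewrite mL; exact: phi_dart.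
      by have [||_ h] := uniq_min_size _ sub2; rewrite ?size_map ?map_inj_uniq.
    * by move=> u v; rewrite !mL /dart /= adj_sym.
    * by move=> u; rewrite mL; exact: irr.
    * move=> v P hP u u'; rewrite !mL /dart /= => hu hu'.
      rewrite adj_sym // in hu; rewrite adj_sym // in hu'.
      have /connectP[p] := wrot v u u' hu hu'; elim: p u hu => [|w p IH] u hu /=; first by move=> _ ->.
      case/andP => /eqP ew hp e; rewrite (hP u w); last by rewrite -ew; apply: cD; rewrite adj_sym.
      by apply: IH => //; rewrite -ew; apply: adj_succ.
    * move=> P hP u v u' v' _ _; have [[_ hc _] _ _ _ _] := hT.
      have /connectP[p] := hc u u'; elim: p u {v} => [|w p IH] u /=; first by move=> _ ->.
      by case/andP => h hp e; rewrite (hP u w) ?mL //; apply: IH.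
  + have [n1 n2 n3] := outer_neq; rewrite /verts hh cat_uniq filter_uniq ?enum_uniq // andbT.
    rewrite /= !inE negb_or n1 n2 [a == c]eq_sym n3 /=; apply/hasPn => v.
    by rewrite inner_vertsE !inE.
  + move=> u v _; rewrite /verts hh mem_cat inner_vertsE.
    by rewrite -[[:: _; _; _]]/[:: a; b; c]; case: (u \in _).
Qed.

End Decompose.
End Represent.

(** * From states to embeddings *)

Section Realize.
Variable n : nat.
Notation V := 'I_n.
Implicit Types (o t : tri V) (q : quad V) (s : state V) (u v w x y z a b c : V) (d e : V * V) (T : emb n) (C R : seq (tri V)) (P : pent V).

(** [rep] without tags, for arbitrary corner lists: between deletion and insertion of an edge there
    is a pentagon, hence no state. *)
Record rot_rep T C : Prop := RotRep {
  rot_adj : forall u v, adj T u v = ((u, v) \in map fst C);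
  rot_succ : forall u v w, (u, v, w) \in C -> succ T v u = w;
  rot_id : forall u v, ~~ adj T v u -> succ T v u = u }.

Lemma rep_rot T o s : rep T o s -> rot_rep T (corners o s).
Proof. by case. Qed.

Lemma rot_rep_perm T C1 C2 : perm_eq C1 C2 -> rot_rep T C1 -> rot_rep T C2.
Proof.
move=> h [h1 h2 h3]; split=> // [u v|u v w]; first by rewrite h1 (perm_mem (perm_map _ h)).
by rewrite -(perm_mem h); apply: h2.
Qed.

Lemma rot_rep_same T1 T2 C : (forall u v, (u, v) \in map fst C -> (v, u) \in map fst C) ->
  rot_rep T1 C -> rot_rep T2 C -> same_rot T1 T2.
Proof.
move=> sC [h1 h2 h3] [k1 k2 k3]; have ea u v : adj T1 u v = adj T2 u v by rewrite h1 k1.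
split=> // v u; case: (boolP (adj T1 v u)) => [|hn]; last by rewrite h3 // k3 // -ea.
by rewrite h1 => /sC/mapP[[[u' v'] w] ic [-> ->]]; rewrite (h2 _ _ _ ic) (k2 _ _ _ ic).
Qed.

Lemma del_sym T x y : x != y -> same_rot (del T x y) (del T y x).
Proof.
move=> hxy; split=> [u v|v u] /=; first by rewrite orbC.
by case: (v =P x) => [->|//]; rewrite (negbTE hxy).
Qed.

Lemma rot_rep_same_rot T1 T2 C : same_rot T1 T2 -> rot_rep T1 C -> rot_rep T2 C.
Proof.
move=> [e1 e2] [h1 h2 h3]; split=> [u v|u v w|u v]; rewrite -?e1 -?e2 //; [exact: h2|exact: h3].
Qed.

(** [del] skips the lost neighbour in the rotations at [p0] and [p2], which is exactly how the
    corners there merge. *)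
Lemma rot_rep_del T m p0 p1 p2 k R :
  let C1 := [:: (m, p0, p2), (p2, p0, p1), (p0, p1, p2), (p1, p2, p0), (p0, p2, k) & R] in
  valid C1 -> rot_rep T C1 -> rot_rep (del T p0 p2) [:: (m, p0, p1), (p0, p1, p2), (p1, p2, k) & R].
Proof.
move=> C1 vC [h1 h2 h3]; set C0 := [:: _, _, _ & R].
have ef : perm_eq (map fst C1) [:: (p0, p2), (p2, p0) & map fst C0] by perm_list.
have eo : perm_eq (map (@out_dart _) C1) [:: (p0, p2), (p2, p0) & map (@out_dart _) C0].
  by rewrite /out_dart; perm_list.
have := valid_uniq vC; rewrite (perm_uniq ef) /= -/(map fst C0) in_cons negb_or.
case/and3P => /andP[e02 n02] n20 u0.
have := valid_uniq vC; rewrite -(perm_uniq (valid_out vC)) (perm_uniq eo) [uniq _]/= in_cons negb_or.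
case/and3P => /andP[_ o02] o20 _.
have ne : p0 != p2 by apply: contra e02 => /eqP->.
have ne' : p2 != p0 by rewrite eq_sym.
have ha u v : adj T u v = [|| (u, v) == (p0, p2), (u, v) == (p2, p0) | (u, v) \in map fst C0].
  by rewrite h1 (perm_mem ef).
have iC (c : tri V) : c \in C1 -> succ T c.1.2 c.1.1 = c.2 by case: c => [[u v] w]; exact: h2.
have s1 : succ T p0 m = p2 by apply: (iC (m, p0, p2)); in_list.
have s2 : succ T p0 p2 = p1 by apply: (iC (p2, p0, p1)); in_list.
have s3 : succ T p1 p0 = p2 by apply: (iC (p0, p1, p2)); in_list.
have s4 : succ T p2 p1 = p0 by apply: (iC (p1, p2, p0)); in_list.
have s5 : succ T p2 p0 = k by apply: (iC (p0, p2, k)); in_list.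
have mR u v w : (u, v, w) \in C0 -> [/\ (u, v) != (p2, p0), (u, v) != (p0, p2),
    (v, w) != (p2, p0) & (v, w) != (p0, p2)].
  move=> ic; split; apply/eqP => e.
  - by case/negP: n20; rewrite -e; exact: (map_f fst ic).
  - by case/negP: n02; rewrite -e; exact: (map_f fst ic).
  - by case/negP: o20; rewrite -e; exact: (map_f (@out_dart _) ic).
  - by case/negP: o02; rewrite -e; exact: (map_f (@out_dart _) ic).
have ne1 x y z : (x, y, z) \in C1 -> x != y.
  by move=> ic; apply: contra (valid_irr vC x) => /eqP e; rewrite {2}e; exact: (map_f fst ic).
have n01 : p0 != p1 by apply: (ne1 p0 p1 p2); in_list.
have n12 : p1 != p2 by apply: (ne1 p1 p2 p0); in_list.
split=> [u v|u v w ic|u v] /=.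
- rewrite ha !xpair_eqE; case b1: ((u == p0) && (v == p2)) => /=.
    by case/andP: b1 => /eqP-> /eqP->; rewrite (negbTE n02).
  case b2: ((u == p2) && (v == p0)) => /=; last by rewrite andbT.
  by case/andP: b2 => /eqP-> /eqP->; rewrite (negbTE n20).
- have [i1 i2 i3 i4] := mR _ _ _ ic; move: ic; rewrite !in_cons; case/or4P => [/eqP e|/eqP e|/eqP e|ic].
  + case: e i1 => -> -> ->; rewrite eqxx s1 eqxx s2 xpair_eqE eqxx andbT => i1.
    by rewrite ifN // eqxx andbF.
  + by case: e => -> -> ->; rewrite eq_sym (negbTE n01) (negbTE n12).
  + by case: e => -> -> ->; rewrite (negbTE ne') eqxx eq_sym (negbTE n01) s4 eqxx.
  + have sw : succ T v u = w by apply: h2; rewrite !in_cons ic !orbT.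
    rewrite sw; case: (v =P p0) => [e|_].
      rewrite e in i1 i4 *; rewrite !xpair_eqE !eqxx ?andbT /= in i1 i4.
      by rewrite (negbTE i1) (negbTE i4).
    case: (v =P p2) => [e|//]; rewrite e in i2 i3 *; rewrite !xpair_eqE !eqxx ?andbT /= in i2 i3.
    by rewrite (negbTE i2) (negbTE i3).
- rewrite negb_and negbK; case/orP => [hn|].
    have hv : succ T v u = u by apply: h3.
    have [a1 a2] : adj T p0 p2 /\ adj T p2 p0 by rewrite !ha !eqxx !orbT.
    rewrite hv; case: (v =P p0) => [e|_].
      by case: (u =P p2) => // e'; rewrite e e' a1 in hn.
    case: (v =P p2) => [e|//]; case: (u =P p0) => // e'; by rewrite e e' a2 in hn.
  by case/orP => /andP[/eqP-> /eqP->]; rewrite ?(negbTE ne') !eqxx.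
Qed.

Lemma rot_rep_tip o s T P i (R : seq (quad V)) : ppt o s -> rep T o s ->
  s.1 \in tri_corners (tip_tri P i) -> perm_eq s.2 (tip_quad P i :: R) ->
  rot_rep (del T (tip_edge P i).1 (tip_edge P i).2) (pent_corners P ++ frame_corners o R).
Proof.
case: P => [[[[p0 p1] p2] p3] p4] hs hr h1 h2.
have hc := corners_tip o h1 h2; set C := frame_corners o R in hc *.
have vC := valid_perm hc (ppt_valid hs); have rC := rot_rep_perm hc (rep_rot hr).
have H m x0 x1 x2 k (R' : seq (tri V)) : tip_edge (p0, p1, p2, p3, p4) i = (x0, x2) ->
  perm_eq (tri_corners (tip_tri (p0, p1, p2, p3, p4) i) ++ quad_corners (tip_quad (p0, p1, p2, p3, p4) i) ++ C)
    [:: (m, x0, x2), (x2, x0, x1), (x0, x1, x2), (x1, x2, x0), (x0, x2, k) & R'] ->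
  perm_eq [:: (m, x0, x1), (x0, x1, x2), (x1, x2, k) & R'] (pent_corners (p0, p1, p2, p3, p4) ++ C) ->
  rot_rep (del T (tip_edge (p0, p1, p2, p3, p4) i).1 (tip_edge (p0, p1, p2, p3, p4) i).2)
    (pent_corners (p0, p1, p2, p3, p4) ++ C).
  move=> -> k1 k2; apply: (rot_rep_perm k2); apply: rot_rep_del.
    exact: valid_perm vC.
  exact: rot_rep_perm rC.
move: H {vC rC hc h1 h2}; case: i => [|[|[|i]]] H.
- by apply: (H p4 p0 p1 p2 p3 [:: (p2, p3, p4), (p3, p4, p0) & C]) => //=; perm_list.
- by apply: (H p0 p1 p2 p3 p4 [:: (p4, p0, p1), (p3, p4, p0) & C]) => //=; perm_list.
- by apply: (H p1 p2 p3 p4 p0 [:: (p4, p0, p1), (p0, p1, p2) & C]) => //=; perm_list.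
- by apply: (H p2 p3 p4 p0 p1 [:: (p0, p1, p2), (p1, p2, p3) & C]) => //=; perm_list.
Qed.

Definition emb_of o s : emb n := Emb (fun u v => (u, v) \in darts o s)
  (next o s)
  (fun u v => (u, v) \in reflex_darts o s).

Lemma rep_emb_of o s : ppt o s -> rep (emb_of o s) o s.
Proof.
move=> hs; split=> // [u v w|u v hn] /=; first exact: next_corner.
by apply: next_id; rewrite (dart_sym hs).
Qed.

Lemma rep_eqv o s s' T : s'.1 \in tri_corners s.1 -> perm_eq s.2 s'.2 -> rep T o s -> rep T o s'.
Proof.
move=> h1 h2 hr.
have := rot_rep_perm _ (rep_rot hr); move=> /(_ (corners o s')) [|k1 k2 k3].
  rewrite /corners perm_cat2l; apply: perm_cat; last exact: perm_quads_corners.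
  exact: perm_tri_corners (tri_corners_sym h1).
split=> // u v; rewrite (rep_reflex hr) !mem_cat; congr (_ || _).
by rewrite (perm_mem (perm_map _ h2)).
Qed.

(** A flip sequence ends in an equality of embeddings, whose fields are functions; hence
    extensionality. *)
Lemma rep_inj o s T T' : ppt o s -> rep T o s -> rep T' o s -> T = T'.
Proof.
move=> hs r r'; have [e1 e2] := rot_rep_same (valid_sym (ppt_valid hs)) (rep_rot r) (rep_rot r').
have e3 u v : reflex T u v = reflex T' u v by rewrite (rep_reflex r) (rep_reflex r').
move: e1 e2 e3; case: T {r} => A S X; case: T' {r'} => A' S' X' /= e1 e2 e3.
have -> : A = A' by apply: functional_extensionality => u; apply: functional_extensionality.
have -> : S = S' by apply: functional_extensionality => u; apply: functional_extensionality.
by have -> : X = X' by apply: functional_extensionality => u; apply: functional_extensionality.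
Qed.

(** * Faces of a represented embedding *)

Section Faces.
Variables (o : tri V) (s : state V) (T : emb n).
Hypothesis hs : ppt o s.
Hypothesis hr : rep T o s.
Let f := phi T.

Lemma rep_phi u v w : (u, v, w) \in corners o s -> f (u, v) = (v, w).
Proof.
move=> ic; rewrite /f /phi /= (rep_adj hr) (corner_dart ic : (u, v) \in _).
by rewrite (rep_succ hr ic).
Qed.

Lemma rep_wf : wf_rot T.
Proof.
have sy u v : adj T u v = adj T v u by rewrite !(rep_adj hr) (dart_sym hs).
have eS v : succ T v =1 next o s v.
  move=> u; case: (boolP (adj T v u)) => h; last by rewrite (rep_id hr h) next_id // (dart_sym hs) -(rep_adj hr).
  by apply: (rep_succ hr); apply: next_dart => //; rewrite -(rep_adj hr) sy.
split=> //.
- by split=> // u; rewrite (rep_adj hr); apply: valid_irr (ppt_valid hs) u.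
- by move=> v u; exact: (rep_id hr).
- by move=> v; apply: (eq_inj (next_inj hs)) => u; rewrite eS.
- by move=> v u w hu hw; rewrite (eq_fconnect (eS v)) next_connect // -(rep_adj hr) sy.
- move=> u v hn; rewrite (rep_reflex hr); apply/negP => /(reflex_dart_mem).
  by rewrite -(rep_adj hr) (negbTE hn).
Qed.

Lemma rep_tri_cycle t : {subset tri_corners t <= corners o s} -> fcycle f (tri_darts t).
Proof.
case: t => [[x y] z] sub /=.
by rewrite (@rep_phi x y z) ?(@rep_phi y z x) ?(@rep_phi z x y) ?eqxx //; apply: sub; in_list.
Qed.

Lemma rep_quad_cycle q : q \in s.2 -> fcycle f (quad_darts q).
Proof.
move=> iq; have sub : {subset quad_corners q <= corners o s} by move=> c; apply: quad_corner_mem.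
case: q sub {iq} => [[[r x] y] z] sub /=.
by rewrite (@rep_phi z r x) ?(@rep_phi r x y) ?(@rep_phi x y z) ?(@rep_phi y z r) ?eqxx //; apply: sub;
  rewrite !inE eqxx ?orbT.
Qed.

Lemma rep_outer_cycle : fcycle f (outer_darts o).
Proof. by apply: rep_tri_cycle => c; apply: outer_corner_mem. Qed.

Lemma rep_inner_cycle : fcycle f (tri_darts s.1).
Proof. by apply: rep_tri_cycle => c; apply: tri_corner_mem. Qed.

Lemma outer_uniq : uniq (outer_darts o).
Proof. by have := uniq_darts hs; rewrite /darts map_cat cat_uniq => /and3P[]. Qed.

Lemma tri_uniq : uniq (tri_darts s.1).
Proof. by apply: (uniq_face hs); in_list. Qed.

Lemma quad_uniq q : q \in s.2 -> uniq (quad_darts q).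
Proof. by move=> iq; apply: (uniq_face hs); rewrite inE map_f ?orbT. Qed.

Lemma order_outer d : d \in outer_darts o -> order f d = 3.
Proof. by move/(order_cycle rep_outer_cycle outer_uniq) ->; case: (o) => [[? ?] ?]. Qed.

Lemma order_tri d : d \in tri_darts s.1 -> order f d = 3.
Proof. by move/(order_cycle rep_inner_cycle tri_uniq) ->; case: (s.1) => [[? ?] ?]. Qed.

Lemma order_quad q d : q \in s.2 -> d \in quad_darts q -> order f d = 4.
Proof.
by move=> iq /(order_cycle (rep_quad_cycle iq) (quad_uniq iq)) ->; case: (q) => [[[? ?] ?] ?].
Qed.

Lemma face_cases d : dart T d -> [\/ d \in outer_darts o, d \in tri_darts s.1 |
  exists2 q, q \in s.2 & d \in quad_darts q].
Proof.
case: d => u v; rewrite /dart /= (rep_adj hr) mem_darts.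
by case/or3P => [->|->|/hasP[q iq h]]; [constructor 1|constructor 2|constructor 3; exists q].
Qed.

Lemma rep_counts : ndarts T = 6 + 4 * size s.2 /\ nfaces T = 2 + size s.2.
Proof.
have injf : injective f := phi_inj rep_wf.
have eD : ndarts T = 6 + 4 * size s.2.
  rewrite /ndarts cardsE (eq_card (B := mem (darts o s))); last by case=> u v; exact: (rep_adj hr u v).
  rewrite (card_uniqP (uniq_darts hs)) size_map /corners /quads_corners !size_cat size_flatten.
  rewrite (_ : sumn _ = 4 * size s.2); first by case: (o) => [[? ?] ?]; case: (s.1) => [[? ?] ?].
  by rewrite /shape -map_comp; elim: (s.2) => //= q l ->; rewrite mulnS; case: q => [[[? ?] ?] ?].
split=> //.
have h34 d : d \in dart T -> (order f d == 3) || (order f d == 4).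
  case/face_cases => [/order_outer->|/order_tri->|[q iq /(order_quad iq) ->]] //.
have [m3 [h1 h2 h3]] := fcard_order34 injf (dart_closed rep_wf) h34.
have e3 : #|[predI dart T & order_set f 3]| = 6.
  have u : uniq (outer_darts o ++ tri_darts s.1).
    by have := uniq_darts hs; rewrite /darts /corners catA map_cat cat_uniq map_cat => /and3P[].
  rewrite (eq_card (B := mem (outer_darts o ++ tri_darts s.1))).
    by rewrite (card_uniqP u) size_cat !size_map; case: (o) => [[? ?] ?]; case: (s.1) => [[? ?] ?].
  move=> d; rewrite !inE mem_cat; apply/andP/orP => [[hd ho]|].
    case: (face_cases hd) => [->|->|[q iq /(order_quad iq) e]]; [by left|by right|].
    by rewrite e in ho.
  case=> h; rewrite ?(order_outer h) ?(order_tri h) //; split=> //; case: d h => u' v h; rewrite /dart /= -topredE /= /dart /= (rep_adj hr).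
    exact: outer_dart_mem.
  exact: tri_dart_mem.
have e2 : ndarts T = m3 * 3 + fcard f [predI dart T & order_set f 4] * 4 by rewrite -h3 /ndarts cardsE.
have e1 : nfaces T = m3 + fcard f [predI dart T & order_set f 4].
  by rewrite -h1; apply: eq_n_comp_r.
by move: eD e1 e2 e3; rewrite h2; clear; lia.
Qed.

End Faces.

(** That every label is a vertex of the state gives connectedness on all of ['I_n] and identifies n
    with the vertex count in Euler's formula. *)
Lemma rep_4ppt a b c s T : ppt (a, b, c) s -> rep T (a, b, c) s ->
  (forall v, v \in verts (a, b, c) s) -> is_4ppt T a b c.
Proof.
move=> hs hr full; have wf := rep_wf hs hr; have vC := ppt_valid hs.
have outE d : on_outer T a b d = (d \in outer_darts (a, b, c)).
  by rewrite /on_outer /same_face (fconnect_cycle (rep_outer_cycle hr)) // !inE eqxx.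
have c1 : (a, b, c) \in corners (a, b, c) s by apply: outer_corner_mem; in_list.
have c2 : (b, c, a) \in corners (a, b, c) s by apply: outer_corner_mem; in_list.
have c3 : (c, a, b) \in corners (a, b, c) s by apply: outer_corner_mem; in_list.
split.
- split=> //.
    move=> u v; have := ppt_const hs (G := connect (adj T) u) _ (full u) (full v).
    rewrite connect0 => <- // x y h; apply: same_connect1r; last by rewrite (rep_adj hr).
    by apply: sym_connect_sym => x' y'; rewrite !(rep_adj hr) (dart_sym hs).
  have [-> ->] := rep_counts hs hr.
  have e : n = size (verts (a, b, c) s).
    rewrite -[LHS]card_ord -(card_uniqP (ppt_uniq hs)); apply/esym/eq_card => v.
    by rewrite full.
  by rewrite /verts size_cat size_map /= in e; move: e; clear; lia.
- split; [rewrite (rep_adj hr); exact: (corner_dart c1)|exact: rep_phi c1|exact: rep_phi c2|exact: rep_phi c3].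
- move=> [u v] _; rewrite outE => h; rewrite (rep_reflex hr) mem_cat.
  by apply/orP; left.
- move=> d hd; rewrite outE => no.
  case: (face_cases hr hd) => [h|h|[q iq h]]; first by rewrite h in no.
    rewrite /face_size (order_tri hs hr h) /= -[X in _ == X](order_tri hs hr h) /order -[X in _ == X]cardsE; apply/eqP.
    apply: eq_card => e; rewrite !inE /same_face (fconnect_cycle (rep_inner_cycle hr) h).
    case: (boolP (e \in _)) => //= /mapP[c0 ic ->].
    by rewrite (rep_reflex hr) -surjective_pairing tri_not_reflex.
  rewrite /face_size (order_quad hs hr iq h) /=.
  have uq : uniq (map fst (quad_convex q)) by have := quad_uniq hs iq; rewrite /= => /andP[].
  rewrite (eq_card (B := mem (map fst (quad_convex q)))).
    by rewrite (card_uniqP uq); case: (q) => [[[? ?] ?] ?].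
  move=> e; rewrite !inE /same_face (fconnect_cycle (rep_quad_cycle hr iq) h) (rep_reflex hr) -surjective_pairing.
  rewrite in_cons; case: (boolP (e \in map fst (quad_convex q))) => [/mapP[c' ic ->]|_].
    by rewrite orbT (convex_not_reflex hs) //; apply/convexP; exists q.
  rewrite orbF; case: eqP => //= ->; rewrite mem_cat orbC.
  by have -> : (quad_reflex q).1 \in map (fun q => (quad_reflex q).1) s.2 by apply/mapP; exists q.
- move=> v; have [t ht] := reflex_dart (full v).
  apply/eqP/cards1P; exists (t, v); apply/setP => -[x y]; rewrite !inE /= (rep_adj hr) (rep_reflex hr).
  apply/and3P/eqP => [[_ /eqP-> hx]|[-> ->]]; first by rewrite (reflex_unique hs hx ht).
  by split=> //; exact: reflex_dart_mem.
Qed.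

Lemma tip_edge_dart P i : tip_edge P i \in quad_darts (tip_quad P i) /\
  swap (tip_edge P i) \in tri_darts (tip_tri P i).
Proof.
by case: P => [[[[p0 p1] p2] p3] p4]; case: i => [|[|[|i]]]; rewrite /swap /= !inE !eqxx ?orbT.
Qed.

(** Hence a flip changes no reflex tag outside the region of the pentagon. *)
Lemma tip_reflex P i : (quad_reflex (tip_quad P i)).1 = tip_edge P i \/
  (quad_reflex (tip_quad P i)).1 \in map fst (pent_corners P).
Proof.
case: P => [[[[p0 p1] p2] p3] p4]; case: i => [|[|[|i]]] /=; [right|right|right|left; done];
  in_list.
Qed.

Lemma pent_tip P i d : d \in map fst (pent_corners P) ->
  d \in tri_darts (tip_tri P i) \/ d \in quad_darts (tip_quad P i).
Proof.
move=> h; apply/orP; rewrite -mem_cat -map_cat (perm_mem (tip_darts P i)) !in_cons h !orbT //.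
Qed.

Lemma step_flip a b c s s' T T' : ppt (a, b, c) s -> rep T (a, b, c) s -> rep T' (a, b, c) s' ->
  (forall v, v \in verts (a, b, c) s) -> step (a, b, c) s s' -> flip a b c T T'.
Proof.
move=> hs r r' full st; have [P [i] [j] [R] [[h1 h2] [h3 h4] na na']] := st.
have hs' := ppt_step st hs.
have full' v : v \in verts (a, b, c) s' by rewrite (perm_mem (perm_verts_step st)).
have wf := rep_wf hs r; have wf' := rep_wf hs' r'.
have [eq1 et1] := tip_edge_dart P i; have [eq2 et2] := tip_edge_dart P j.
have iq1 : tip_quad P i \in s.2 by rewrite (perm_mem h2) mem_head.
have iq2 : tip_quad P j \in s'.2 by rewrite (perm_mem h4) mem_head.
rewrite -(perm_mem (perm_map fst (perm_tri_corners h1))) in et1.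
rewrite -(perm_mem (perm_map fst (perm_tri_corners h3))) in et2.
have tri1 d : same_face T (swap (tip_edge P i)) d = (d \in tri_darts s.1).
  exact: (fconnect_cycle (rep_inner_cycle r) et1).
have quad1 d : same_face T (tip_edge P i) d = (d \in quad_darts (tip_quad P i)).
  exact: (fconnect_cycle (rep_quad_cycle r iq1) eq1).
have outE d : on_outer T a b d = (d \in outer_darts (a, b, c)).
  by rewrite /on_outer /same_face (fconnect_cycle (rep_outer_cycle r)) // !inE eqxx.
have pE d : d = (d.1, d.2) by case: d.
have swapE d : swap d = (d.2, d.1) by [].
(* Tip edges are oriented along the quadrilateral, and their reverses along the triangle. So
   [(x, y)] is the reversed old edge, whereas [(p, q)] is the new edge along its quadrilateral,
   which selects the second alternative for the face sizes. *)
exists (tip_edge P i).2, (tip_edge P i).1, (tip_edge P j).1, (tip_edge P j).2; cbv zeta.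
rewrite -!swapE -!pE; split.
- split; rewrite ?outE.
  + by rewrite (adj_sym wf) (rep_adj r) -pE; exact: (quad_dart_mem _ iq1).
  + exact: (outer_tri_disjoint hs).
  + exact: (order_tri hs r).
  + exact: (outer_quad_disjoint hs iq1).
- split.
  + by rewrite (rep_adj r') -pE; exact: (quad_dart_mem _ iq2).
  + by rewrite (rep_adj r) -pE; case/and3P: na.
  + have ne : (tip_edge P i).1 != (tip_edge P i).2 by case/and3P: na'.
    (* Both embeddings, each without its tip edge, represent the same list: the pentagon and the
       frame. *)
    have k := rot_rep_same_rot (del_sym T ne) (rot_rep_tip hs r h1 h2).
    apply: rot_rep_same (rot_rep_tip hs' r' h3 h4) k.
    by apply: valid_sym; apply: (@valid_del_tip _ _ i); exact: valid_perm (corners_tip _ h1 h2) (ppt_valid hs).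
- right; rewrite /face_size (order_tri hs' r' et2) (order_quad hs' r' iq2 eq2).
  by rewrite (order_quad hs r iq1 eq1).
- move=> d hd; rewrite tri1 quad1 negb_or => /andP[n1 n2].
  have nP : d \notin map fst (pent_corners P).
    apply/negP => /(pent_tip i)[h|h]; last by rewrite h in n2.
    by rewrite (perm_mem (perm_map fst (perm_tri_corners h1))) h in n1.
  rewrite (rep_reflex r) (rep_reflex r') -!pE !mem_cat; congr (_ || _).
  rewrite (perm_mem (perm_map _ h2)) (perm_mem (perm_map _ h4)) /= !in_cons.
  rewrite [d == (quad_reflex (tip_quad P i)).1](_ : _ = false); last first.
    by apply/negbTE; apply: contra n2 => /eqP->; rewrite map_f // mem_head.
  rewrite [d == (quad_reflex (tip_quad P j)).1](_ : _ = false) //.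
  apply/negbTE/negP => /eqP e; case: (tip_reflex P j) => h; last by rewrite e h in nP.
  by case/and3P: na => _ /negP; rewrite -h -e [d]pE -(rep_adj r).
- by split; [exact: rep_4ppt r full|exact: rep_4ppt r' full'].
Qed.

(** Intermediate embeddings are read off the states by [emb_of]; at the end, [rep_inj] identifies
    the embedding with [T']. *)
Lemma reach_flip_seq a b c k s s' T T' : reach (a, b, c) k s s' -> ppt (a, b, c) s ->
  (forall v, v \in verts (a, b, c) s) -> rep T (a, b, c) s -> rep T' (a, b, c) s' ->
  flip_seq a b c T T' k.
Proof.
move=> h; elim: h T => {k s s'} [s s' h1 h2|k s1 s2 s3 st _ IH] T hs full r r'.
  have hs' : ppt (a, b, c) s' by apply: reach_ppt hs; apply: reach0.
  by rewrite (rep_inj hs' (rep_eqv h1 h2 r) r'); apply: flip_seq0.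
have hs2 := ppt_step st hs; have full2 v : v \in verts (a, b, c) s2.
  by rewrite (perm_mem (perm_verts_step st)).
have r2 := rep_emb_of hs2.
apply: flip_seqS (IH _ hs2 full2 r2 r'); exact: step_flip st.
Qed.

End Realize.

Theorem theorem3 :
  exists C : nat, forall (n : nat), 3 <= n ->
    forall (a b c : 'I_n) (T1 T2 : emb n),
      is_4ppt T1 a b c -> is_4ppt T2 a b c ->
      exists k : nat, k <= C * n ^ 2 /\ flip_seq a b c T1 T2 k.
Proof.
exists 28 => n _ a b c T1 T2 h1 h2.
have [s1 [r1 p1 e1]] := state_of h1; have [s2 [r2 p2 e2]] := state_of h2.
(* The reflex vertices of both states are listed by [inner_verts], which depends only on [a], [b],
   [c]. *)
have [k hk w] : within (a, b, c) (28 * #|'I_n| ^ 2) s1 s2 by apply: ppt_connected; rewrite // e1 e2.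
rewrite card_ord in hk; exists k; split=> //; apply: reach_flip_seq w p1 _ r1 r2 => v.
rewrite /verts e1 mem_cat inner_vertsE -[[:: _; _; _]]/[:: a; b; c]; by case: (v \in _).
Qed.
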